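(* Let $\tilde{\mathcal M}$, $\tilde g$, $\mathfrak R$, $H$, $c$, $\pi:\tilde{\mathcal M}\to\mathcal M$ be data defining a (pseudo-)projective Kähler manifold $\mathcal M$ as described in the context, with induced metric $g$ on $\mathcal M$, line bundle $L$, bundle $\mathcal H$, and horizontal subbundle $\mathrm{hor}(\mathcal H)\cong L\otimes T\mathcal M$. Let $\tilde D$ be the Levi-Civita connection of $\tilde g$. For a vector field $X$ on $\mathcal M$ with horizontal lift $\tilde X$, and a section $\xi$ of $\mathrm{hor}(\mathcal H)$ with corresponding vector field $\tilde\xi$ on $\tilde{\mathcal M}$, the vector field $\tilde D_{\tilde X}\tilde\xi$ on $\tilde{\mathcal M}$ defines a section $\mathcal D_X\xi$ of $\mathcal H$, and $$\hat{\mathcal D}_X\xi=p_h(\mathcal D_X\xi)$$ defines a connection on $\mathrm{hor}(\mathcal H)\cong L\otimes T\mathcal M$, where $p_h:\mathcal H\to\mathrm{hor}(\mathcal H)$ is the horizontal projection. This connection is the tensor product of the Hermitian connection on $L$ and the Levi-Civita connection of $g$ on $T\mathcal M$.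
   Context: Setting (projective Kähler manifold). $\tilde{\mathcal M}$ is a complex manifold of dimension $n+1$ with a Kähler or pseudo-Kähler metric $\tilde g$ of arbitrary signature, extended complex-bilinearly to the complexified tangent bundle. $\mathfrak R:\mathbb C^\times\times\tilde{\mathcal M}\to\tilde{\mathcal M}$, $(b,x)\mapsto\mathfrak R_b(x)$, is a free holomorphic action making $\pi:\tilde{\mathcal M}\to\mathcal M=\tilde{\mathcal M}/\mathbb C^\times$ a holomorphic principal $\mathbb C^\times$-bundle. $H$ is the fundamental holomorphic vector field (type $(1,0)$), normalized so that $(Hf)(x)=c\,\frac{d}{db}\big|_{b=1}f(\mathfrak R_b(x))$ for holomorphic $f$, with $c$ a nonzero real constant. It is assumed that $\tilde D_YH=cY$ for all $Y\in T^{1,0}\tilde{\mathcal M}$ and $\tilde g(H,\bar H)\neq0$ everywhere; then $\mathfrak R_b^*\tilde g=|b|^2\tilde g$. Metric on $\mathcal M$. Put $\mathcal K=\frac1{c^2}\tilde g(H,\bar H)$. In local holomorphic coordinates $z^i$ on $\mathcal M$, $g_{i\bar\jmath}=\pm\partial_i\partial_{\bar\jmath}\log|\mathcal K\circ s|$, with $\pm=\operatorname{sign}\mathcal K$ and $s$ any local holomorphic section of $\pi$; this is a well-defined (pseudo-)Kähler metric. Bundles. $T\mathcal M$, $T\tilde{\mathcal M}$ in the claim denote the holomorphic tangent bundles ($T^{1,0}$). On $T\tilde{\mathcal M}$ identify $(x,v)\sim(\mathfrak R_b(x),b^{-1}d\mathfrak R_bv)$; the quotient is the rank $n+1$ bundle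 $\mathcal H\to\mathcal M$. Sections $\xi$ of $\mathcal H$ correspond bijectively to vector fields $\tilde\xi$ of type $(1,0)$ on $\tilde{\mathcal M}$ with $(\mathfrak R_b)_*\tilde\xi=b\,\tilde\xi$ for all $b$. $L\subset\mathcal H$ is the line subbundle of classes of vertical vectors $(x,\lambda H(x))$, with Hermitian fiber metric $h([x,\lambda H(x)],\overline{[x,\sigma H(x)]})=\lambda\bar\sigma\,\tilde g_x(H,\bar H)$ (well defined); the Hermitian connection on $L$ is the unique connection compatible with $h$ and with the holomorphic structure (the Chern connection). It corresponds to a connection 1-form on the principal bundle $\tilde{\mathcal M}$, given in coordinates $(y,z^i)$ with $y\in\mathbb C^\times$ a fiber coordinate satisfying $\mathfrak R_b(y,z)=(by,z)$ by $\omega=y^{-1}dy+\partial_{z^i}\log|\mathcal K|\,dz^i$. A vector of type $(1,0)$ is horizontal if it is annihilated by $\omega$; horizontal lifts (of real or complexified vector fields, using complex conjugation for type $(0,1)$) and horizontal projections are taken with respect to this connection. $\mathrm{hor}(\mathcal H)\subset\mathcal H$ is the subbundle of classes of horizontal vectors; $\mathcal H=\mathrm{hor}(\mathcal H)\oplus L$, and $p_h$ is the corresponding projection. The isomorphism $\mathrm{hor}(\mathcal H)\cong L\otimes T\mathcal M$ sends the class of $(x,v)$, $v$ horizontal, to $[(x,H(x))]\otimes d\pi(v)$. *)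

(* Defs.v *)
From HB Require Import structures.
From mathcomp Require Import all_boot all_order all_algebra.
From mathcomp Require Import all_classical all_reals all_analysis.
From mathcomp Require Import complex.
Set Implicit Arguments.
Unset Strict Implicit.
Unset Printing Implicit Defensive.
Import Order.TTheory GRing.Theory Num.Theory.
Import numFieldNormedType.Exports.
Local Open Scope classical_set_scope.
Local Open Scope ring_scope.

(* - C^n is modelled by pairs (x, y) of real row vectors, standing for        *)
(*   x + i y, so that the real calculus of MathComp-Analysis applies.         *)
(* - Functions, vector fields and sections are total Rocq functions; they     *)
(*   are only constrained on the open set U on which they are said to be      *)
(*   smooth, so each of them also represents a local object over U.           *)
(*   U = setT gives the global ones.                                          *)

Fixpoint ndiff (R : realType) (V : normedModType R) (k : nat) (U : set V)
    (f : V -> R) : Prop :=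
  if k is k'.+1 then
    (forall u, U u -> differentiable f u) /\ (forall v, ndiff k' U ('D_v f))
  else True.

Definition csmooth (R : realType) (V : normedModType R) (U : set V)
    (f : V -> R[i]) : Prop :=
  forall k, ndiff k U (fun u => complex.Re (f u)) /\
            ndiff k U (fun u => complex.Im (f u)).

Definition cderiv (R : realType) (V : normedModType R) (v : V)
    (f : V -> R[i]) (u : V) : R[i] :=
  Complex ('D_v (fun w => complex.Re (f w)) u)
          ('D_v (fun w => complex.Im (f w)) u).

Definition iC (R : realType) : R[i] := Complex 0 1.

(* J is the multiplication by i on V; the second clause is the Cauchy-Riemann
   equation. *)
Definition holo (R : realType) (V : normedModType R) (J : V -> V) (U : set V)
    (f : V -> R[i]) : Prop :=
  csmooth U f /\
  forall u v, U u -> cderiv (J v) f u = iC R * cderiv v f u.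

Definition E (R : realType) (n : nat) : normedModType R :=
  ('rV[R]_n * 'rV[R]_n)%type.

Definition JE (R : realType) (n : nat) (u : E R n) : E R n := (- u.2, u.1).

Definition zc (R : realType) (n : nat) (i : 'I_n) (u : E R n) : R[i] :=
  Complex (u.1 ord0 i) (u.2 ord0 i).

(* Wirtinger derivatives: inl i is d/dz^i, inr i is d/d(conj z^i). *)
Definition wirt (R : realType) (n : nat) (A : 'I_n + 'I_n)
    (f : E R n -> R[i]) (u : E R n) : R[i] :=
  match A with
  | inl i => (cderiv ((delta_mx ord0 i, 0) : E R n) f u
              - iC R * cderiv ((0, delta_mx ord0 i) : E R n) f u) / 2%:R
  | inr i => (cderiv ((delta_mx ord0 i, 0) : E R n) f u
              + iC R * cderiv ((0, delta_mx ord0 i) : E R n) f u) / 2%:R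
  end.

Record cmanifold (R : realType) (n : nat) := CManifold {
  carrier :> topologicalType;
  cman_hausdorff : hausdorff_space carrier;
  cman_countable : @second_countable carrier;
  (* phi a is a chart with domain dom a; psi a, its inverse, is meaningful only
     on the image of dom a. *)
  chart : Type;
  dom : chart -> set carrier;
  phi : chart -> carrier -> E R n;
  psi : chart -> E R n -> carrier;
  dom_open : forall a, open (dom a);
  dom_cover : forall x, exists a, dom a x;
  im_open : forall a, open (phi a @` dom a);
  phiK : forall a x, dom a x -> psi a (phi a x) = x;
  phi_cont : forall a x, dom a x -> {for x, continuous (phi a)};
  psi_cont : forall a u, (phi a @` dom a) u -> {for u, continuous (psi a)};
  phi_holo : forall a b i,
    holo (@JE R n) (phi a @` (dom a `&` dom b))
      (fun u => zc i (phi b (psi a u)))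
}.

Section Manifold.
Variables (R : realType) (n : nat) (M : cmanifold R n).

Definition smooth_fun (U : set M) (f : M -> R[i]) : Prop :=
  forall a : chart M, csmooth (phi a @` (U `&` dom a)) (fun u => f (psi a u)).

Definition holo_fun (U : set M) (f : M -> R[i]) : Prop :=
  forall a : chart M,
    holo (@JE R n) (phi a @` (U `&` dom a)) (fun u => f (psi a u)).

Definition smooth_near (x : M) (f : M -> R[i]) : Prop :=
  exists U, [/\ open U, U x & smooth_fun U f].

Definition holo_near (x : M) (f : M -> R[i]) : Prop :=
  exists U, [/\ open U, U x & holo_fun U f].

(* Complexified tangent vectors are first-order differential operators on
   functions which are smooth near the base point. They take the value 0 on
   the other functions, so that Leibniz equality is equality of tangent
   vectors. *)
Definition tvec := (M -> R[i]) -> R[i]^o.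

Definition pd (a : chart M) (A : 'I_n + 'I_n) (x : M) : tvec :=
  fun f => if `[< smooth_near x f >]
           then wirt A (fun u => f (psi a u)) (phi a x) else 0.

Definition is_tvec (x : M) (v : tvec) : Prop :=
  exists a (k : 'I_n + 'I_n -> R[i]),
    dom a x /\ v = \sum_A k A *: pd a A x.

Definition type10 (x : M) (v : tvec) : Prop :=
  exists a (k : 'I_n -> R[i]), dom a x /\ v = \sum_i k i *: pd a (inl i) x.

Definition conjv (v : tvec) : tvec :=
  fun f => conjc (v (fun x => conjc (f x))).

Definition type01 (x : M) (v : tvec) : Prop := type10 x (conjv v).

Definition vfield := M -> tvec.

Definition smooth_vf (U : set M) (X : vfield) : Prop :=
  (forall x, U x -> is_tvec x (X x)) /\
  (forall V f, open V -> V `<=` U -> smooth_fun V f ->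
     smooth_fun V (fun x => X x f)).

Definition smooth_vf10 (U : set M) (X : vfield) : Prop :=
  smooth_vf U X /\ (forall x, U x -> type10 x (X x)).

Definition holo_vf (U : set M) (X : vfield) : Prop :=
  smooth_vf10 U X /\
  (forall V f, open V -> V `<=` U -> holo_fun V f ->
     holo_fun V (fun x => X x f)).

(* A connection on a complex vector bundle over M with fibres in F, fibrewise
   operations add and scale, and smooth sections over open sets given by sec.
   The covariant derivative is extended complex-linearly to complexified
   vector fields. Since it acts on local sections, cutting off by the
   indicator function of U shows that it is automatically local. *)
Definition is_connection (F : Type) (add : F -> F -> F)
    (scale : R[i] -> F -> F) (sec : set M -> (M -> F) -> Prop)
    (D : vfield -> (M -> F) -> M -> F) : Prop :=
  forall (U : set M) (X X' : vfield) (s s' : M -> F) (f : M -> R[i]),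
    open U -> smooth_vf U X -> smooth_vf U X' -> sec U s -> sec U s' ->
    smooth_fun U f ->
    sec U (D X s) /\
    forall p, U p ->
      [/\ D (fun q => X q + X' q) s p = add (D X s p) (D X' s p),
          D (fun q => f q *: X q) s p = scale (f p) (D X s p),
          D X (fun q => add (s q) (s' q)) p = add (D X s p) (D X s' p) &
          D X (fun q => scale (f q) (s q)) p
            = add (scale (X p f) (s p)) (scale (f p) (D X s p))].

Definition tensor2 := M -> tvec -> tvec -> R[i].

Definition bilinear_sym (g : tensor2) : Prop :=
  forall x (v v' w : tvec) (k : R[i]),
    is_tvec x v -> is_tvec x v' -> is_tvec x w ->
    g x (k *: v + v') w = k * g x v w + g x v' w /\ g x v w = g x w v.

(* The components of the fundamental form g(J., .), where J is i on type (1,0)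
   and -i on type (0,1). *)
Definition fund_form (g : tensor2) (a : chart M) (A B : 'I_n + 'I_n)
    (x : M) : R[i] :=
  (if A is inl _ then iC R else - iC R) * g x (pd a A x) (pd a B x).

(* A metric is given by its complex-bilinear extension to the complexified
   tangent bundle, of arbitrary signature. The last clause says that the
   fundamental form is closed. *)
Record pseudo_kahler (g : tensor2) : Prop := PseudoKahler {
  pk_bilin : bilinear_sym g;
  pk_real : forall x v w, is_tvec x v -> is_tvec x w ->
    g x (conjv v) (conjv w) = conjc (g x v w);
  pk_nondeg : forall x v, is_tvec x v ->
    (forall w, is_tvec x w -> g x v w = 0) -> v = 0;
  pk_smooth : forall U X Y, open U -> smooth_vf U X -> smooth_vf U Y ->
    smooth_fun U (fun x => g x (X x) (Y x));
  pk_herm : forall x v w, type10 x v -> type10 x w -> g x v w = 0;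
  pk_closed : forall a A B B' x, dom a x ->
    pd a A x (fund_form g a B B') + pd a B x (fund_form g a B' A)
      + pd a B' x (fund_form g a A B) = 0
}.

Record levi_civita (g : tensor2) (D : vfield -> vfield -> vfield) : Prop :=
  LeviCivita {
  lc_conn : is_connection (fun v w : tvec => v + w)
              (fun (k : R[i]) (v : tvec) => k *: v) smooth_vf D;
  lc_torsion : forall U X Y p f,
    open U -> smooth_vf U X -> smooth_vf U Y -> U p -> smooth_near p f ->
    D X Y p f - D Y X p f
      = X p (fun q => Y q f) - Y p (fun q => X q f);
  lc_metric : forall U X Y Z p,
    open U -> smooth_vf U X -> smooth_vf U Y -> smooth_vf U Z -> U p ->
    X p (fun q => g q (Y q) (Z q)) = g p (D X Y p) (Z p) + g p (Y p) (D X Z p)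
}.

End Manifold.

Section Maps.
Variables (R : realType) (m n : nat) (M : cmanifold R m) (N : cmanifold R n).

Definition holo_map (U : set M) (F : M -> N) : Prop :=
  (forall x, U x -> {for x, continuous F}) /\
  (forall (b : chart N) i,
     holo_fun (U `&` F @^-1` dom b) (fun x => zc i (phi b (F x)))).

Definition push (F : M -> N) (x : M) (v : tvec M) : tvec N :=
  fun f => if `[< smooth_near (F x) f >] then v (fun y => f (F y)) else 0.

End Maps.

Definition toC (R : realType) (b : E R 1) : R[i] := zc ord0 b.

Definition oneE (R : realType) : E R 1 := (const_mx 1, 0).

Record proj_kahler (R : realType) (n : nat) := ProjKahler {
  tot : cmanifold R n.+1;
  base : cmanifold R n;
  proj : tot -> base;
  (* only the values at b != 0 matter *)
  act : R[i] -> tot -> tot;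
  cst : R;
  fund : vfield tot;
  tmet : tensor2 tot;
  tD : vfield tot -> vfield tot -> vfield tot;
  act1 : forall x, act 1 x = x;
  actM : forall b b' x, b != 0 -> b' != 0 -> act (b * b') x = act b (act b' x);
  act_free : forall b x, b != 0 -> act b x = x -> b = 1;
  act_cont : forall (b : E R 1) (x : tot), toC b != 0 ->
    {for (b, x), continuous (fun q : E R 1 * tot => act (toC q.1) q.2)};
  act_holo : forall (a a' : chart tot) i,
    @holo R (E R 1 * E R n.+1)%type (fun w => (JE w.1, JE w.2))
      [set w | [/\ toC w.1 != 0, (phi a @` dom a) w.2
                 & dom a' (act (toC w.1) (psi a w.2))]]
      (fun w => zc i (phi a' (act (toC w.1) (psi a w.2))));
  proj_holo : holo_map setT proj;
  proj_fib : forall x x', proj x = proj x' <-> exists b, b != 0 /\ x' = act b x;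
  proj_triv : forall p, exists U s (y : tot -> R[i]),
    [/\ [/\ open U, U p, holo_map U s & forall q, U q -> proj (s q) = q],
        holo_fun (proj @^-1` U) y &
        forall x, U (proj x) -> y x != 0 /\ x = act (y x) (s (proj x))];
  cst_neq0 : cst != 0;
  fund_holo : holo_vf setT fund;
  fundE : forall x f, holo_near x f ->
    fund x f = cst%:C%C * wirt (inl ord0) (fun b : E R 1 => f (act (toC b) x))
                               (oneE R);
  tmet_kahler : pseudo_kahler tmet;
  tD_lc : levi_civita tmet tD;
  tD_fund : forall U Y x, open U -> smooth_vf10 U Y -> U x ->
    tD Y fund x = cst%:C%C *: Y x;
  fund_neq0 : forall x, tmet x (fund x) (conjv (fund x)) != 0
}.

Section ProjKahler.
Variables (R : realType) (n : nat) (P : proj_kahler R n).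
Let tM := tot P.
Let M := base P.

Definition kpot (x : tM) : R :=
  complex.Re (tmet x (fund x) (conjv (fund x))) / cst P ^+ 2.

Definition logk (x : tM) : R[i] := (ln `|kpot x|)%:C%C.

Definition hol_section (U : set M) (s : M -> tM) : Prop :=
  [/\ open U, holo_map U s & forall q, U q -> proj (s q) = q].

(* This determines g, since the coordinate vectors span the complexified
   tangent spaces. *)
Definition induced_metric (g : tensor2 M) : Prop :=
  bilinear_sym g /\
  forall (a : chart M) U s p, hol_section U s -> U p -> dom a p ->
  forall i j,
    [/\ g p (pd a (inl i) p) (pd a (inr j) p)
          = (Num.sg (kpot (s p)))%:C%C *
            wirt (inl i) (wirt (inr j) (fun u => logk (s (psi a u)))) (phi a p),
        g p (pd a (inl i) p) (pd a (inl j) p) = 0 &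
        g p (pd a (inr i) p) (pd a (inr j) p) = 0].

(* The fibre coordinate y which equals 1 on the section s; together with
   z^i = (coordinates of the chart a) o proj it gives coordinates (y, z), in
   which the point (y, z) is act y (s z). *)
Definition ycoord (s : M -> tM) (x : tM) : R[i] :=
  xget 0 [set b | b != 0 /\ x = act b (s (proj x))].

(* y^-1 dy + d_{z^i} log|K| dz^i *)
Definition omega (s : M -> tM) (a : chart M) (x : tM) (v : tvec tM) : R[i] :=
  (ycoord s x)^-1 * v (ycoord s) +
  \sum_i wirt (inl i) (fun u => logk (act (ycoord s x) (s (psi a u))))
              (phi a (proj x))
         * v (fun x' => zc i (phi a (proj x'))).

Definition horizontal10 (x : tM) (v : tvec tM) : Prop :=
  type10 x v /\
  forall U s a, hol_section U s -> U (proj x) -> dom a (proj x) ->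
    omega s a x v = 0.

Definition horizontal (x : tM) (v : tvec tM) : Prop :=
  exists v1 v2, [/\ horizontal10 x v1, horizontal10 x v2 & v = v1 + conjv v2].

Definition hlift (X : vfield M) : vfield tM :=
  fun x => xget 0 [set v | horizontal x v /\ push (@proj R n P) x v = X (proj x)].

(* An element of H is an equivalence class, i.e. a set of pairs (x, v). *)
Definition Helt := set (tM * tvec tM).

Definition Hclass (x : tM) (v : tvec tM) : Helt :=
  [set q | exists b, b != 0 /\ q = (act b x, b^-1 *: push (act b) x v)].

Definition inH (p : M) (A : Helt) : Prop :=
  exists x v, [/\ proj x = p, type10 x v & A = Hclass x v].

Definition inhor (p : M) (A : Helt) : Prop :=
  exists x v, [/\ proj x = p, horizontal10 x v & A = Hclass x v].

Definition inL (p : M) (A : Helt) : Prop :=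
  exists x (l : R[i]), proj x = p /\ A = Hclass x (l *: fund x).

(* Fibrewise operations: [x, v] + [x, w] = [x, v + w], k [x, v] = [x, k v]. *)
Definition hadd (A B : Helt) : Helt :=
  [set q | exists v w, [/\ A (q.1, v), B (q.1, w) & q.2 = v + w]].

Definition hscale (k : R[i]) (A : Helt) : Helt :=
  [set q | exists v, A (q.1, v) /\ q.2 = k *: v].

(* field_of and class_of are the two directions of the correspondence between
   sections of H and equivariant vector fields on tM; class_of V p is an
   element of H exactly when V is equivariant of type (1,0) over p. *)
Definition field_of (xi : M -> Helt) : vfield tM :=
  fun x => xget 0 [set v | xi (proj x) (x, v)].

Definition class_of (V : vfield tM) : M -> Helt :=
  fun p => [set q | proj q.1 = p /\ q.2 = V q.1].

Definition sec_in (inB : M -> Helt -> Prop) (U : set M) (xi : M -> Helt) :=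
  (forall p, U p -> inB p (xi p)) /\
  smooth_vf ((@proj R n P) @^-1` U) (field_of xi).

Definition secH := sec_in inH.
Definition sechor := sec_in inhor.
Definition secL := sec_in inL.

(* p_h [x, v] = [x, w] where w is horizontal and v - w is vertical. *)
Definition p_h (A : Helt) : Helt :=
  [set q | exists v (l : R[i]),
     [/\ A (q.1, v), horizontal10 q.1 q.2 & v = q.2 + l *: fund q.1]].

Definition calD (X : vfield M) (xi : M -> Helt) : M -> Helt :=
  class_of (tD (hlift X) (field_of xi)).

Definition hatD (X : vfield M) (xi : M -> Helt) : M -> Helt :=
  fun p => p_h (calD X xi p).

(* hermL p A B is h(A, conj B). *)
Definition hermL (p : M) (A B : Helt) : R[i] :=
  xget 0 [set k | exists x (l s : R[i]),
    [/\ proj x = p, A = Hclass x (l *: fund x), B = Hclass x (s *: fund x)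
      & k = l * conjc s * tmet x (fund x) (conjv (fund x))]].

Record chern_connection (nL : vfield M -> (M -> Helt) -> M -> Helt) : Prop :=
  ChernConnection {
  ch_conn : is_connection hadd hscale secL nL;
  ch_metric : forall U X s t p,
    open U -> smooth_vf U X -> secL U s -> secL U t -> U p ->
    X p (fun q => hermL q (s q) (t q))
      = hermL p (nL X s p) (t p)
        + hermL p (s p) (nL (fun q => conjv (X q)) t p);
  ch_holo : forall U X s p,
    open U -> smooth_vf U X -> (forall q, U q -> type01 q (X q)) ->
    secL U s -> holo_vf ((@proj R n P) @^-1` U) (field_of s) -> U p ->
    nL X s p = hscale 0 (s p)
}.

(* The (finite-dimensional) fibre of the tensor product at p is realized in
   the dual of the space of bilinear forms on L_p x T_p. *)
Definition bilin_form (p : M) (B : Helt -> tvec M -> R[i]) : Prop :=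
  forall (k : R[i]) A A' (v v' : tvec M),
    inL p A -> inL p A' -> type10 p v -> type10 p v' ->
    [/\ B (hadd A A') v = B A v + B A' v, B (hscale k A) v = k * B A v,
        B A (v + v') = B A v + B A v' & B A (k *: v) = k * B A v].

Definition LTelt := (Helt -> tvec M -> R[i]) -> R[i]^o.

Definition tens (p : M) (A : Helt) (v : tvec M) : LTelt :=
  fun B => if `[< bilin_form p B >] then B A v else 0.

Definition secLT (U : set M) (t : M -> LTelt) : Prop :=
  forall p, U p -> exists V k (s : 'I_k -> M -> Helt) (Y : 'I_k -> vfield M),
    [/\ open V, V p, V `<=` U,
        forall i, secL V (s i) /\ smooth_vf10 V (Y i) &
        forall q, V q -> t q = \sum_i tens q (s i q) (Y i q)].

Definition isoLT (p : M) (A : Helt) : LTelt :=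
  xget 0 [set t | exists x v,
    [/\ proj x = p, horizontal10 x v, A = Hclass x v
      & t = tens p (Hclass x (fund x)) (push (@proj R n P) x v)]].

Definition isoLT_inv (p : M) (t : LTelt) : Helt :=
  xget set0 [set A | inhor p A /\ isoLT p A = t].

Definition tensor_connection
    (nL : vfield M -> (M -> Helt) -> M -> Helt)
    (D : vfield M -> vfield M -> vfield M)
    (N : vfield M -> (M -> LTelt) -> M -> LTelt) : Prop :=
  is_connection (fun t t' : LTelt => t + t')
    (fun (k : R[i]) (t : LTelt) => k *: t) secLT N /\
  forall U X s Y p,
    open U -> smooth_vf U X -> secL U s -> smooth_vf10 U Y -> U p ->
    N X (fun q => tens q (s q) (Y q)) p
      = tens p (nL X s p) (Y p) + tens p (s p) (D X Y p).

(* hatD transported to the tensor product by isoLT : hor(H) -> L (x) TM. *)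
Definition hatD_LT (X : vfield M) (t : M -> LTelt) : M -> LTelt :=
  fun p => isoLT p (hatD X (fun q => isoLT_inv q (t q)) p).

End ProjKahler.

(* Main.v *)
Require Import Defs.
From HB Require Import structures.
From mathcomp Require Import all_boot all_order all_algebra.
From mathcomp Require Import all_classical all_reals all_analysis.
From mathcomp Require Import complex ring.
Set Implicit Arguments.
Unset Strict Implicit.
Unset Printing Implicit Defensive.
Import Order.TTheory GRing.Theory Num.Theory.
Import numFieldNormedType.Exports.
Local Open Scope classical_set_scope.
Local Open Scope ring_scope.
#[local] Arguments conjc {R} x : simpl never.

(* Let N = g~(H, conj H), which the action multiplies by |b|^2. On type (1,0)
   vectors omega is then a multiple of g~(., conj H), so horizontal means
   orthogonal to the vertical directions, and horizontal vectors annihilate N.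
   The vertical part of the bracket [X~, Z~] of horizontal lifts of types (1,0)
   and (0,1) is the curvature d dbar log|K| of omega. Together with
   D~_Y H = c Y it yields g~(X~, Z~) = |K| g(X, Z) for all horizontal lifts.
   Since |K| is annihilated by horizontal vectors, Koszul's formula shows that
   D~_X~ Y~ is the lift of D_X Y plus a vertical vector.
   A section s (x) Y with s = sigma H corresponds to the field sigma Y~, whose
   derivative along X~ has the horizontal part X~(sigma) Y~ + sigma (D_X Y)~.
   Compatibility with h, tested against a local holomorphic frame of L, shows
   that the Chern derivative of s is X~(sigma) H, again because N is constant
   in horizontal directions. *)

(** * Calculus on C^n *)

(** The constant c explains the normalization of K. If be is the conj H component of [X~, Z~], then
    D~_Y H = c Y gives c g~(X~, Z~) = - be N, and applying the bracket to conj y gives c be = - d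
    dbar log|K o s|. Hence g~(X~, Z~) = (N / c^2) d dbar log|K o s|, and the sign in the definition
    of g turns K = N / c^2 into |K|. The obstacle is that the data are infinitesimal: [proj_kahler]
    states neither a scaling law for g~ nor equivariance of D~, and [induced_metric] gives only the
    components of g. The scaling is therefore proved for N alone, which suffices because v N = c
    g~(v, conj H) for v of type (1,0). Smoothness and nondegeneracy of g are brought down from g~.
    That D~_X~ xi~ defines a section of H is read off from the local form xi~ = y^-1 Y~: lifts and H
    are invariant, y^-1 has weight -1, and the coefficient of the vertical part of D~_X~ Y~ is
    invariant because |K| and N scale alike. *)

Section RealCalculus.
Variables (R : realType).
Implicit Types (V : normedModType R) (k : nat).

(** Once the neighbourhood is moved to 0, the first-order expansion of f at x is also one of g;
    [diff_unique] then identifies its linear part with the differential of g. *)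
Lemma near_eq_differentiable (V W : normedModType R) (f g : V -> W) (x : V) :
  (\forall y \near x, f y = g y) -> differentiable f x -> differentiable g x.
Proof.
move=> fg df; have fgx := nbhs_singleton fg.
have fg0 : \forall h \near (0 : V), f (h + x) = g (h + x).
  by move: fg; rewrite (near_shift 0 x) subr0.
have /diff_locallyP[dfc dfx] := df.
have gx : g \o shift x = cst (g x) + 'd f x +o_ (0 : V) id.
  apply/eqaddoP => e e0; have /eqaddoP/(_ e e0) := dfx.
  move=> H; near=> h.
  have -> : (g \o shift x - (cst (g x) + 'd f x)) h =
            (f \o shift x - (cst (f x) + 'd f x)) h.
    rewrite -[LHS]/(g (h + x) - (g x + 'd f x h)).
    rewrite -[RHS]/(f (h + x) - (f x + 'd f x h)).
    rewrite fgx; congr (_ - _); apply/esym.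
    by near: h.
  by near: h.
by apply/diff_locallyP; rewrite (diff_unique dfc gx).
Unshelve. all: by end_near. Qed.

(** [ndiff] differentiates total functions, while the rules of calculus hold only on U. Since U is
    open, derivatives also agree on U, so this is how a formula for a derivative is substituted in
    the closure properties below. *)
Lemma ndiff_open_eq V k (U : set V) (f g : V -> R) :
  open U -> (forall u, U u -> f u = g u) -> ndiff k U f -> ndiff k U g.
Proof.
move=> oU; elim: k f g => // k IH f g fg [df dvf]; split => [u Uu|v].
  apply: near_eq_differentiable (df u Uu).
  by apply: filterS (open_nbhs_nbhs (conj oU Uu)).
apply: IH (dvf v) => u Uu; apply: near_eq_derive.
by apply: filterS (open_nbhs_nbhs (conj oU Uu)).
Qed.

Lemma ndiff_pred V k (U : set V) (f : V -> R) : ndiff k.+1 U f -> ndiff k U f.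
Proof.
elim: k f => // k IH f [df dvf]; split => // v; exact: IH (dvf v).
Qed.

Lemma ndiff_sub V k (U W : set V) (f : V -> R) :
  U `<=` W -> ndiff k W f -> ndiff k U f.
Proof.
move=> UW; elim: k f => // k IH f [df dvf]; split => [u /UW|v].
  exact: df.
exact: IH (dvf v).
Qed.

(** W may even be a singleton: [ndiff] tests the iterated derivatives of one total function point by
    point. The germ predicate [csn] relies on this. *)
Lemma ndiff_bigcup V k (U : set V) (f : V -> R) :
  (forall u, U u -> exists W : set V, W u /\ ndiff k W f) -> ndiff k U f.
Proof.
elim: k f => // k IH f H; split => [u /H[W [Wu [df _]]]|v]; first exact: df.
by apply: IH => u /H[W [Wu [_ dvf]]]; exists W; split=> //; exact: dvf.
Qed.

Lemma ndiff_cst V k (U : set V) (c : R) : ndiff k U (fun=> c).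
Proof.
elim: k c => // k IH c; split => [u Uu|v]; first exact: differentiable_cst.
suff -> : ('D_v (fun=> c) : V -> R) = (fun=> 0) by exact: IH.
by apply/funext => u; rewrite -[fun=> c]/(cst c) derive_cst.
Qed.

Lemma ndiffD V k (U : set V) (f g : V -> R) : open U ->
  ndiff k U f -> ndiff k U g -> ndiff k U (fun u => f u + g u).
Proof.
move=> oU; elim: k f g => // k IH f g [df dvf] [dg dvg]; split => [u Uu|v].
  exact: differentiableD (df u Uu) (dg u Uu).
apply: (ndiff_open_eq oU _ (IH _ _ (dvf v) (dvg v))) => u Uu.
by rewrite deriveD //; apply: diff_derivable; [exact: df|exact: dg].
Qed.

Lemma ndiffN V k (U : set V) (f : V -> R) : open U ->
  ndiff k U f -> ndiff k U (fun u => - f u).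
Proof.
move=> oU; elim: k f => // k IH f [df dvf]; split => [u Uu|v].
  exact: differentiableN (df u Uu).
apply: (ndiff_open_eq oU _ (IH _ (dvf v))) => u Uu.
by rewrite deriveN //; apply: diff_derivable; exact: df.
Qed.

Lemma ndiffM V k (U : set V) (f g : V -> R) : open U ->
  ndiff k U f -> ndiff k U g -> ndiff k U (fun u => f u * g u).
Proof.
move=> oU; elim: k f g => // k IH f g nf ng.
have [df dvf] := nf; have [dg dvg] := ng; split => [u Uu|v].
  exact: differentiableM (df u Uu) (dg u Uu).
apply: (ndiff_open_eq oU _ (ndiffD oU (IH _ _ (ndiff_pred nf) (dvg v))
                               (IH _ _ (ndiff_pred ng) (dvf v)))) => u Uu.
by rewrite deriveM //; apply: diff_derivable; [exact: df|exact: dg].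
Qed.

(** Induction on k for a fixed f: the derivative of f^-1 involves the inverse of the same f, at one
    order less. *)
Lemma ndiffV V k (U : set V) (f : V -> R) : open U ->
  (forall u, U u -> f u != 0) ->
  ndiff k U f -> ndiff k U (fun u => (f u)^-1).
Proof.
move=> oU f0; elim: k => // k IH nf.
have [df dvf] := nf; split => [u Uu|v].
  exact: differentiableV (df u Uu) (f0 u Uu).
have iV := IH (ndiff_pred nf).
apply: (ndiff_open_eq oU _ (ndiffM oU (ndiffN oU (ndiffM oU iV iV)) (dvf v))).
move=> u Uu; rewrite deriveV ?f0 //; last by apply: diff_derivable; exact: df.
by rewrite /GRing.scale /= -invfM expr2.
Qed.

(** The derivative has the same expression on both half-lines, so log|K| can be differentiated
    whatever the sign of K. *)
Lemma is_derive_ln_norm (x : R) : x != 0 ->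
  is_derive x 1 (fun y => ln `|y|) x^-1.
Proof.
move=> x0; have [xgt0|xlt0] := ltP 0 x.
  apply: (@near_eq_is_derive _ _ _ (@ln R));
    last exact: is_derive1_ln.
  near=> y; rewrite gtr0_norm //; near: y.
  exact: (open_nbhs_nbhs (conj (@open_gt _ 0) xgt0)).
have {}xlt0 : x < 0 by rewrite lt_neqAle x0.
apply: (@near_eq_is_derive _ _ _ (@ln R \o -%R)).
  near=> y; rewrite ltr0_norm //; near: y.
  exact: (open_nbhs_nbhs (conj (@open_lt _ 0) xlt0)).
have d1 : is_derive (- x) 1 (@ln R) (- x)^-1.
  by apply: is_derive1_ln; rewrite oppr_gt0.
have d2 : is_derive x 1 (-%R : R -> R) (- 1) by exact: is_deriveNid.
apply: is_derive_eq (is_derive1_comp d1 d2) _.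
by rewrite invrN mulrNN mulr1.
Unshelve. all: by end_near. Qed.

Lemma differentiable_ln_norm V (f : V -> R) u : differentiable f u ->
  f u != 0 -> differentiable (fun w => ln `|f w|) u.
Proof.
move=> df f0.
apply: (@differentiable_comp _ _ _ _ f (fun y => ln `|y|)) => //.
by apply/derivable1_diffP; case: (is_derive_ln_norm f0).
Qed.

Lemma derive_ln_norm V (f : V -> R) u v : differentiable f u ->
  f u != 0 -> 'D_v (fun w => ln `|f w|) u = (f u)^-1 * 'D_v f u.
Proof.
move=> df f0; rewrite !deriveE //; last exact: differentiable_ln_norm.
have dl : differentiable (fun y => ln `|y|) (f u).
  by apply/derivable1_diffP; case: (is_derive_ln_norm f0).
rewrite -[fun w => _]/((fun y => ln `|y|) \o f) diff_comp //=.
rewrite -[X in 'd _ (f u) X = _]mulr1 [LHS]linearZ /= -[X in _ *: X]deriveE //.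
have -> : 'D_1 (fun y : R => ln `|y|) (f u) = (f u)^-1.
  exact: (@derive_val _ _ _ _ _ _ _ (is_derive_ln_norm f0)).
exact: mulrC.
Qed.

Lemma ndiff_ln_norm V k (U : set V) (f : V -> R) : open U ->
  (forall u, U u -> f u != 0) ->
  ndiff k U f -> ndiff k U (fun u => ln `|f u|).
Proof.
move=> oU f0; case: k => // k nf; have [df dvf] := nf; split => [u Uu|v].
  by apply: differentiable_ln_norm; [exact: df|exact: f0].
apply: (ndiff_open_eq oU _ (ndiffM oU (ndiffV oU f0 (ndiff_pred nf)) (dvf v))).
by move=> u Uu; rewrite derive_ln_norm //; [exact: df|exact: f0].
Qed.

Lemma ndiff_sum V k (U : set V) (I : Type) (r : seq I) (P : pred I)
    (F : I -> V -> R) : open U ->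
  (forall i, P i -> ndiff k U (F i)) ->
  ndiff k U (fun u => \sum_(i <- r | P i) F i u).
Proof.
move=> oU H; elim: r => [|i r IH].
  have -> : (fun u => \sum_(i <- [::] | P i) F i u) = fun=> 0.
    by apply/funext => u; rewrite big_nil.
  exact: ndiff_cst.
have -> : (fun u => \sum_(j <- i :: r | P j) F j u) =
  fun u => (if P i then F i u else 0) + \sum_(j <- r | P j) F j u.
  by apply/funext => u; rewrite big_cons; case: ifP => // _; rewrite add0r.
apply: ndiffD => //; case: (P i) (H i) => [/(_ isT) //|_]; exact: ndiff_cst.
Qed.

Definition eA m (A : 'I_m + 'I_m) : E R m :=
  match A with inl i => (delta_mx ord0 i, 0) | inr i => (0, delta_mx ord0 i) end.

Definition rc m (A : 'I_m + 'I_m) (u : E R m) : R :=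
  match A with inl i => u.1 ord0 i | inr i => u.2 ord0 i end.

Lemma E_decomp m (u : E R m) : u = \sum_A rc A u *: eA A.
Proof.
rewrite big_sumType /=; case: u => u1 u2 /=.
have H1 : forall (v : 'rV[R]_m), v = \sum_i v ord0 i *: delta_mx ord0 i.
  by move=> v; rewrite [LHS]matrix_sum_delta big_ord1.
have -> : \sum_i u1 ord0 i *: ((delta_mx ord0 i, 0) : E R m) = (u1, 0).
  rewrite [u1 in RHS]H1; elim/big_ind2 : _ => // [x1 x2 y1 y2 -> ->|i _].
    by rewrite -[LHS]/(_ , _) /= addr0.
  by rewrite -[LHS]/(_ , _) /= scaler0.
have -> : \sum_i u2 ord0 i *: ((0, delta_mx ord0 i) : E R m) = (0, u2).
  rewrite [u2 in RHS]H1; elim/big_ind2 : _ => // [x1 x2 y1 y2 -> ->|i _].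
    by rewrite -[LHS]/(_ , _) /= addr0.
  by rewrite -[LHS]/(_ , _) /= scaler0.
by rewrite -[RHS]/(_ , _) /= addr0 add0r.
Qed.

Lemma rc_linear m (A : 'I_m + 'I_m) : linear (rc A : E R m -> R).
Proof. by move=> a u v; case: A => i /=; rewrite !mxE. Qed.

HB.instance Definition _ m (A : 'I_m + 'I_m) :=
  GRing.isLinear.Build R (E R m) R *%R (rc A) (@rc_linear m A).

Lemma rc_continuous m (A : 'I_m + 'I_m) : continuous (rc A : E R m -> R).
Proof.
move=> u; case: A => i /=.
  exact: (@continuous_comp _ _ _ (fst : E R m -> _) (fun M : 'rV_m => M ord0 i) u
    (@cvg_fst _ _ _ _ _) (@coord_continuous _ _ _ _ _ _)).
exact: (@continuous_comp _ _ _ (snd : E R m -> _) (fun M : 'rV_m => M ord0 i) u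
    (@cvg_snd _ _ _ _ _) (@coord_continuous _ _ _ _ _ _)).
Qed.

Lemma rc_differentiable m (A : 'I_m + 'I_m) u :
  differentiable (rc A : E R m -> R) u.
Proof. apply: linear_differentiable; exact: rc_continuous. Qed.

Lemma derive_rc m (A : 'I_m + 'I_m) u v :
  'D_v (rc A : E R m -> R) u = rc A v.
Proof.
rewrite deriveE; last exact: rc_differentiable.
by rewrite diff_lin //; exact: rc_continuous.
Qed.

Lemma differentiable_E V m (G : V -> E R m) u :
  (forall A, differentiable (fun w => rc A (G w)) u) -> differentiable G u.
Proof.
move=> H.
have -> : G = \sum_A (fun w => rc A (G w) *: eA A).
  by apply/funext => w; rewrite fct_sumE [LHS]E_decomp.
elim/big_ind : _ => [|f g df dg|A _]; first exact: differentiable_cst.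
- exact: differentiableD.
- exact: differentiableZl (H A).
Qed.

Lemma derive_comp V m (G : V -> E R m) (f : E R m -> R) u v :
  (forall A, differentiable (fun w => rc A (G w)) u) ->
  differentiable f (G u) ->
  'D_v (fun w => f (G w)) u =
  \sum_A 'D_(eA A) f (G u) * 'D_v (fun w => rc A (G w)) u.
Proof.
move=> dA df; have dG := differentiable_E dA.
have dfG : differentiable (f \o G) u by exact: differentiable_comp.
rewrite deriveE // -[fun w => f (G w)]/(f \o G) diff_comp //=.
rewrite [X in 'd f _ X]E_decomp linear_sum; apply: eq_bigr => A _.
rewrite linearZ /= deriveE // mulrC; congr (_ * _).
have dr := @rc_differentiable m A (G u).
rewrite (deriveE _ (dA A)) -[fun w => rc A (G w)]/(rc A \o G).
rewrite (diff_comp dG dr) [RHS]/comp diff_lin //; exact: rc_continuous.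
Qed.

Lemma ndiff_comp V m k (U : set (E R m)) (W : set V) (G : V -> E R m)
    (f : E R m -> R) : open W -> (forall w, W w -> U (G w)) ->
  (forall A, ndiff k W (fun w => rc A (G w))) -> ndiff k U f ->
  ndiff k W (fun w => f (G w)).
Proof.
move=> oW WU; elim: k f => // k IH f nG [df dvf]; split => [u Wu|v].
  have dfu := df _ (WU _ Wu).
  apply: (@differentiable_comp _ _ _ _ G f) => //.
  by apply: differentiable_E => A; have [dA _] := nG A; exact: dA u Wu.
have nG' A := ndiff_pred (nG A).
have nS : ndiff k W (fun w => \sum_A 'D_(eA A) f (G w)
                               * 'D_v (fun w => rc A (G w)) w).
  apply: ndiff_sum => // A _; apply: ndiffM => //.
    exact: IH nG' (dvf _).
  by have [_ dA] := nG A; exact: dA.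
apply: (ndiff_open_eq oW _ nS) => u Wu; rewrite derive_comp //.
- by move=> A; have [dA _] := nG A; exact: dA u Wu.
- exact: df _ (WU _ Wu).
Qed.

End RealCalculus.

(** * Complex-valued functions and Wirtinger derivatives *)

Section ComplexCalculus.
Variable R : realType.
Local Notation C := R[i].
Local Notation Re := (@complex.Re R).
Local Notation Im := (@complex.Im R).
Implicit Types (V : normedModType R).

Lemma ReD (x y : C) : Re (x + y) = Re x + Re y. Proof. by case: x y => [? ?] []. Qed.
Lemma ImD (x y : C) : Im (x + y) = Im x + Im y. Proof. by case: x y => [? ?] []. Qed.
Lemma ReN (x : C) : Re (- x) = - Re x. Proof. by case: x. Qed.
Lemma ImN (x : C) : Im (- x) = - Im x. Proof. by case: x. Qed.
Lemma ReM (x y : C) : Re (x * y) = Re x * Re y - Im x * Im y.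
Proof. by case: x y => [? ?] []. Qed.
Lemma ImM (x y : C) : Im (x * y) = Re x * Im y + Im x * Re y.
Proof. by case: x y => [? ?] []. Qed.
Lemma ReJ (x : C) : Re (conjc x) = Re x. Proof. by case: x. Qed.
Lemma ImJ (x : C) : Im (conjc x) = - Im x. Proof. by case: x. Qed.
Lemma complex_eqP (x y : C) : Re x = Re y -> Im x = Im y -> x = y.
Proof. by case: x y => [? ?] [? ?] /= -> ->. Qed.
Lemma Re_real (x : R) : Re (x%:C%C) = x. Proof. by []. Qed.
Lemma Im_real (x : R) : Im (x%:C%C) = 0. Proof. by []. Qed.
Lemma iC_sqr : iC R * iC R = -1 :> C.
Proof. by apply: complex_eqP; rewrite ?ReM ?ImM /= ?ReN ?ImN /=; ring. Qed.
Lemma conjc_iC : conjc (iC R) = - iC R.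
Proof. by apply: complex_eqP; rewrite ?ReN ?ImN /= ?oppr0. Qed.
Lemma two_neq0 : (2%:R : C) != 0.
Proof. by rewrite pnatr_eq0. Qed.

Definition cdif V (f : V -> C) (u : V) :=
  differentiable (fun w => Re (f w)) u /\ differentiable (fun w => Im (f w)) u.

Lemma csmooth_cdif V (U : set V) f u : csmooth U f -> U u -> cdif f u.
Proof.
by move=> sf Uu; have [[d1 _] [d2 _]] := sf 1%N; split; [exact: d1|exact: d2].
Qed.

Section Cderiv.
Variables (V : normedModType R).
Implicit Types (f g : V -> C) (u v : V).

Lemma cdif_cst (c : C) u : cdif (fun=> c) u.
Proof. by split; exact: differentiable_cst. Qed.

Lemma cderiv_eq f g u v : (\forall w \near u, f w = g w) ->
  cderiv v f u = cderiv v g u.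
Proof.
by move=> fg; apply: complex_eqP => /=; apply: near_eq_derive;
  apply: filterS fg => w ->.
Qed.

Lemma cderivJ f u v : cdif f u ->
  cderiv v (fun w => conjc (f w)) u = conjc (cderiv v f u).
Proof.
move=> [f1 f2]; apply: complex_eqP; rewrite ?ReJ ?ImJ /=.
  by under eq_fun do rewrite ReJ.
under eq_fun do rewrite ImJ.
by rewrite -[LHS]/('D_v (- (fun w => Im (f w))) u) deriveN //; exact: diff_derivable.
Qed.

Lemma cderiv_cst (c : C) u v : cderiv v (fun=> c) u = 0.
Proof. by apply: complex_eqP => /=; exact: derive_cst. Qed.

Lemma cderivM f g u v : cdif f u -> cdif g u ->
  cderiv v (fun w => f w * g w) u = cderiv v f u * g u + f u * cderiv v g u.
Proof.
move=> [f1 f2] [g1 g2]; have dM := @deriveM R V.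
have D (h : V -> R) : differentiable h u -> derivable h u v.
  exact: diff_derivable.
apply: complex_eqP; rewrite ?(ReD, ImD) ?(ReM, ImM) /=.
  under eq_fun do rewrite ReM.
  rewrite -[LHS]/('D_v ((fun w => Re (f w)) * (fun w => Re (g w)) -
                        (fun w => Im (f w)) * (fun w => Im (g w))) u).
  rewrite deriveB; [|by apply: derivableM; exact: D..].
  rewrite !dM; [|exact: D..].
  rewrite /GRing.scale /=.
  move: ('D_v _ u) ('D_v _ u) ('D_v _ u) ('D_v _ u).
  move: (Re (f u)) (Im (f u)) (Re (g u)) (Im (g u)).
  by move=> *; ring.
under eq_fun do rewrite ImM.
rewrite -[LHS]/('D_v ((fun w => Re (f w)) * (fun w => Im (g w)) +
                        (fun w => Im (f w)) * (fun w => Re (g w))) u).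
rewrite deriveD; [|by apply: derivableM; exact: D..].
rewrite !dM; [|exact: D..].
rewrite /GRing.scale /=.
move: ('D_v _ u) ('D_v _ u) ('D_v _ u) ('D_v _ u) (Re (f u)) (Im (f u)) (Re (g u)) (Im (g u)).
by move=> *; ring.
Qed.

Lemma cderiv_ln (f : V -> R) u v : differentiable f u -> f u != 0 ->
  cderiv v (fun w => (ln `|f w|)%:C%C) u =
  (f u)^-1%:C%C * cderiv v (fun w => (f w)%:C%C) u.
Proof.
move=> df f0; apply: complex_eqP; rewrite ?ReM ?ImM /=.
  by rewrite derive_ln_norm // mul0r subr0.
rewrite -[fun=> 0]/(cst 0) derive_cst; ring.
Qed.

End Cderiv.

Section Csmooth.
Variables (V : normedModType R) (U : set V).
Implicit Types (f g : V -> C).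

Lemma csmooth_eq f g : open U -> (forall u, U u -> f u = g u) ->
  csmooth U f -> csmooth U g.
Proof.
move=> oU fg sf k; have [s1 s2] := sf k.
by split; [apply: ndiff_open_eq s1|apply: ndiff_open_eq s2] => // u Uu; rewrite fg.
Qed.

Lemma csmooth_sub (W : set V) f : U `<=` W -> csmooth W f -> csmooth U f.
Proof.
move=> UW sf k; have [s1 s2] := sf k.
by split; [apply: ndiff_sub s1|apply: ndiff_sub s2].
Qed.

Lemma csmooth_bigcup f :
  (forall u, U u -> exists W : set V, W u /\ csmooth W f) -> csmooth U f.
Proof.
move=> H k; split; apply: ndiff_bigcup => u /H[W [Wu sf]]; exists W; split=> //;
by have [] := sf k.
Qed.

Lemma csmooth_cst (c : C) : csmooth U (fun=> c).
Proof. by move=> k; split; exact: ndiff_cst. Qed.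

Lemma csmooth_cderiv f v : csmooth U f -> csmooth U (cderiv v f).
Proof.
move=> sf k; have [[_ s1] [_ s2]] := sf k.+1.
by split; [exact: s1|exact: s2].
Qed.

Hypothesis oU : open U.

Lemma csmoothD f g : csmooth U f -> csmooth U g ->
  csmooth U (fun u => f u + g u).
Proof.
move=> sf sg k; have [f1 f2] := sf k; have [g1 g2] := sg k; split.
  under eq_fun do rewrite ReD; exact: ndiffD.
under eq_fun do rewrite ImD; exact: ndiffD.
Qed.

Lemma csmoothJ f : csmooth U f -> csmooth U (fun u => conjc (f u)).
Proof.
move=> sf k; have [f1 f2] := sf k; split.
  by under eq_fun do rewrite ReJ.
by under eq_fun do rewrite ImJ; exact: ndiffN.
Qed.

Lemma csmoothM f g : csmooth U f -> csmooth U g ->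
  csmooth U (fun u => f u * g u).
Proof.
move=> sf sg k; have [f1 f2] := sf k; have [g1 g2] := sg k; split.
  under eq_fun do rewrite ReM.
  by apply: ndiffD => //; [|apply: ndiffN => //]; exact: ndiffM.
under eq_fun do rewrite ImM.
by apply: ndiffD => //; exact: ndiffM.
Qed.

Lemma csmoothV f : (forall u, U u -> f u != 0) -> csmooth U f ->
  csmooth U (fun u => (f u)^-1).
Proof.
move=> f0 sf k; have [f1 f2] := sf k.
have n0 u : U u -> Re (f u) * Re (f u) + Im (f u) * Im (f u) != 0.
  move/f0; rewrite -!expr2 paddr_eq0 ?sqr_ge0 // !expf_eq0 /=.
  by case: (f u) => a b; rewrite eq_complex.
have nV : ndiff k U (fun u => (Re (f u) * Re (f u) + Im (f u) * Im (f u))^-1).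
  apply: ndiffV => //; apply: ndiffD => //; exact: ndiffM.
have HR : (fun u => Re (f u)^-1) = (fun u =>
    Re (f u) * (Re (f u) * Re (f u) + Im (f u) * Im (f u))^-1).
  by apply/funext => u; case: (f u) => a b; rewrite /= !expr2.
have HI : (fun u => Im (f u)^-1) = (fun u =>
    - (Im (f u) * (Re (f u) * Re (f u) + Im (f u) * Im (f u))^-1)).
  by apply/funext => u; case: (f u) => a b; rewrite /= !expr2.
rewrite HR HI; split; first exact: ndiffM.
by apply: ndiffN => //; exact: ndiffM.
Qed.

Lemma csmooth_ln (f : V -> R) : (forall u, U u -> f u != 0) ->
  csmooth U (fun u => (f u)%:C%C) -> csmooth U (fun u => (ln `|f u|)%:C%C).
Proof.
move=> f0 sf k; have [f1 f2] := sf k; split; last exact: ndiff_cst.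
exact: ndiff_ln_norm.
Qed.

End Csmooth.

Definition Zc m (A : 'I_m + 'I_m) (u : E R m) : C :=
  match A with inl i => zc i u | inr i => conjc (zc i u) end.

Definition flipA (m : nat) (A : 'I_m + 'I_m) : 'I_m + 'I_m :=
  match A with inl i => inr i | inr i => inl i end.

Section Wirt.
Variable m : nat.
Implicit Types (f g : E R m -> C) (A : 'I_m + 'I_m).

Lemma wirt_eq A f g u : (\forall w \near u, f w = g w) -> wirt A f u = wirt A g u.
Proof. by move=> fg; case: A => i /=; rewrite !(cderiv_eq _ fg). Qed.

Lemma wirtM A f g u : cdif f u -> cdif g u ->
  wirt A (fun w => f w * g w) u = wirt A f u * g u + f u * wirt A g u.
Proof.
move=> df dg; case: A => i /=; rewrite !cderivM //;
move: (cderiv _ f u) (cderiv _ f u) (cderiv _ g u) (cderiv _ g u) (iC R) (f u) (g u);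
by move=> *; ring.
Qed.

Lemma wirt_cst A (c : C) (u : E R m) : wirt A (fun=> c) u = 0.
Proof. by case: A => i /=; rewrite !cderiv_cst; ring. Qed.

Lemma wirtJ A f u : cdif f u ->
  wirt A (fun w => conjc (f w)) u = conjc (wirt (flipA A) f u).
Proof.
move=> df; case: A => i; rewrite /wirt /flipA !cderivJ //.
  rewrite rmorphM rmorphD rmorphM /= conjc_iC fmorphV rmorph_nat.
  by rewrite mulNr.
rewrite rmorphM rmorphB rmorphM /= conjc_iC fmorphV rmorph_nat.
by rewrite mulNr opprK.
Qed.

Lemma wirt_ln A (f : E R m -> R) u : cdif (fun w => (f w)%:C%C) u -> f u != 0 ->
  wirt A (fun w => (ln `|f w|)%:C%C) u =
  (f u)^-1%:C%C * wirt A (fun w => (f w)%:C%C) u.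
Proof.
move=> [df _] f0; case: A => i /=; rewrite !cderiv_ln //;
move: (cderiv _ _ u) (cderiv _ _ u) (iC R) ((f u)^-1%:C%C);
by move=> *; ring.
Qed.

Lemma csmooth_wirt A f U : open U -> csmooth U f -> csmooth U (wirt A f).
Proof.
move=> oU sf; have cv v := csmooth_cderiv v sf; have cc c := csmooth_cst U (c : C).
have H (a : C) v w : csmooth U (fun u => (cderiv v f u + a * cderiv w f u) / 2%:R).
  by apply: csmoothM => //; apply: csmoothD => //; exact: csmoothM.
case: A => i; last exact: H.
have -> : wirt (inl i) f = fun u =>
  (cderiv ((delta_mx ord0 i, 0) : E R m) f u
     + (- iC R) * cderiv ((0, delta_mx ord0 i) : E R m) f u) / 2%:R.
  by apply/funext => u; rewrite mulNr.
exact: H.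
Qed.

Lemma wirt_cderiv f u v : cdif f u ->
  cderiv v f u = \sum_A wirt A f u * Zc A v.
Proof.
move=> df; rewrite big_sumType /= -big_split /=.
have -> : cderiv v f u = \sum_A (rc A v)%:C%C * cderiv (eA R A) f u.
  case: df => f1 f2; apply: complex_eqP.
    rewrite (big_morph Re ReD (erefl _)) [LHS]/= deriveE //.
    rewrite [in LHS](E_decomp v) linear_sum; apply: eq_bigr => A _.
    by rewrite linearZ ReM Re_real Im_real mul0r subr0 /= deriveE.
  rewrite (big_morph Im ImD (erefl _)) [LHS]/= deriveE //.
  rewrite [in LHS](E_decomp v) linear_sum; apply: eq_bigr => A _.
  by rewrite linearZ ImM Re_real Im_real mul0r addr0 /= deriveE.
rewrite big_sumType /= -big_split /=; apply: eq_bigr => i _.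
set p := cderiv _ f u; set q := cderiv _ f u; rewrite /zc /conjc.
set a := v.1 ord0 i; set b := v.2 ord0 i.
have -> : Complex a b = a%:C%C + iC R * b%:C%C :> C.
  by apply: complex_eqP; rewrite ?(ReD, ImD) ?(ReM, ImM) /=; ring.
have -> : Complex a (- b) = a%:C%C - iC R * b%:C%C :> C.
  by apply: complex_eqP; rewrite ?(ReD, ImD, ReN, ImN) ?(ReM, ImM) /=; ring.
(* The products i i and 2 / 2 are isolated as factors so that i^2 = -1 and 2 / 2 = 1 can be
   rewritten. *)
transitivity ((a%:C%C * p - (iC R * iC R) * (b%:C%C * q)) * (2%:R / 2%:R)); last by ring.
by rewrite iC_sqr divff ?two_neq0 //; move: p q => p q; ring.
Qed.

Lemma rc_eA A B : rc A (eA R B) = (A == B)%:R.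
Proof. by case: A B => i [] j /=; rewrite mxE ?eqxx. Qed.

Lemma cderiv_comp V (G : V -> E R m) f u v :
  (forall i, cdif (fun w => zc i (G w)) u) -> cdif f (G u) ->
  cderiv v (fun w => f (G w)) u =
  \sum_A wirt A f (G u) * cderiv v (fun w => Zc A (G w)) u.
Proof.
(* w is dG(v) in real coordinates: differentiating f o G along v is differentiating f along w, to
   which [wirt_cderiv] applies. *)
move=> dG df; pose w : E R m := \sum_A 'D_v (fun w => rc A (G w)) u *: eA R A.
have dG' A : differentiable (fun w => rc A (G w)) u.
  by case: A => i; have [] := dG i.
have rcw A : rc A w = 'D_v (fun w => rc A (G w)) u.
  rewrite linear_sum (bigD1 A) //= big1 ?addr0 => [|B BA].
    by rewrite linearZ /= rc_eA eqxx mulr1.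
  by rewrite linearZ /= rc_eA eq_sym (negbTE BA) mulr0.
have -> : cderiv v (fun w => f (G w)) u = cderiv w f (G u).
  have [f1 f2] := df.
  apply: complex_eqP => /=.
    rewrite (@derive_comp _ _ _ G (fun z => Re (f z))) // [RHS]deriveE // linear_sum.
    by apply: eq_bigr => A _; rewrite linearZ /= deriveE // mulrC.
  rewrite (@derive_comp _ _ _ G (fun z => Im (f z))) // [RHS]deriveE // linear_sum.
  by apply: eq_bigr => A _; rewrite linearZ /= deriveE // mulrC.
rewrite wirt_cderiv //; apply: eq_bigr => A _; congr (_ * _).
have zE i : zc i w = cderiv v (fun w => zc i (G w)) u.
  by apply: complex_eqP; rewrite /= -?(rcw (inl i)) -?(rcw (inr i)).
by case: A => i /=; rewrite zE // cderivJ.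
Qed.

Lemma csmooth_comp V (W : set V) (U : set (E R m)) (G : V -> E R m) f :
  open W -> (forall w, W w -> U (G w)) ->
  (forall i, csmooth W (fun w => zc i (G w))) -> csmooth U f ->
  csmooth W (fun w => f (G w)).
Proof.
move=> oW WU sG sf k; have [f1 f2] := sf k.
have nG A : ndiff k W (fun w => rc A (G w)).
  by case: A => i; have [] := sG i k.
by split; [exact: (ndiff_comp oW WU nG f1)|exact: (ndiff_comp oW WU nG f2)].
Qed.

Lemma csmooth_zc i U : csmooth U (@zc R m i).
Proof.
have H A k : ndiff k U (@rc R m A).
  case: k => // k; split => [u _|v]; first exact: rc_differentiable.
  have -> : 'D_v (@rc R m A) = fun=> rc A v by apply/funext => u; exact: derive_rc.
  exact: ndiff_cst.
by move=> k; split; [exact: (H (inl i))|exact: (H (inr i))].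
Qed.

Lemma cderiv_zc i u v : cderiv v (@zc R m i) u = zc i v.
Proof.
apply: complex_eqP => /=.
  exact: (@derive_rc R m (inl i)).
exact: (@derive_rc R m (inr i)).
Qed.

Lemma cdif_zc i u : cdif (@zc R m i) u.
Proof. exact: (csmooth_cdif (@csmooth_zc i setT)). Qed.

Lemma wirt_Zc A B u : wirt A (Zc B) u = (A == B)%:R.
Proof.
have H i j : wirt (inl i) (zc j) u = (i == j)%:R :> C
          /\ wirt (inr i) (zc j) u = 0 :> C.
  rewrite /= !cderiv_zc /zc /= !mxE eqxx /= [j == i]eq_sym; case: (i == j) => /=.
    have -> : Complex 1 0 = 1 :> C by [].
    have -> : Complex 0 1 = iC R :> C by [].
    rewrite iC_sqr opprK subrr mul0r; split=> //.
    by rewrite -[1 + 1]/(2%:R) divff // two_neq0.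
  have -> : Complex 0 0 = 0 :> C by [].
  by rewrite mulr0 subr0 addr0 mul0r.
case: B => j.
  by case: A => i; [rewrite (H i j).1|rewrite (H i j).2].
have -> : Zc (inr j) = (fun w : E R m => conjc (zc j w)) by [].
rewrite wirtJ; last exact: cdif_zc.
case: A => i; rewrite [flipA _]/=.
  by rewrite (H i j).2 rmorph0.
by rewrite (H i j).1 rmorph_nat.
Qed.

End Wirt.

Lemma wirt_comp p m (G : E R p -> E R m) f u A :
  (forall i, cdif (fun w => zc i (G w)) u) -> cdif f (G u) ->
  wirt A (fun w => f (G w)) u =
  \sum_B wirt B f (G u) * wirt A (fun w => Zc B (G w)) u.
Proof.
move=> dG df.
have H v := cderiv_comp v dG df.
case: A => i; rewrite [LHS]/= !H.
  rewrite mulr_sumr -sumrB mulr_suml.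
  apply: eq_bigr => B _; move: (wirt B f (G u)) => w; rewrite /wirt /=.
  by move: (cderiv _ _ u) (cderiv _ _ u) (iC R) => *; ring.
rewrite mulr_sumr -big_split mulr_suml.
apply: eq_bigr => B _; move: (wirt B f (G u)) => w; rewrite /wirt /=.
by move: (cderiv _ _ u) (cderiv _ _ u) (iC R) => *; ring.
Qed.

Section Holo.

Lemma holo_wirt m U (f : E R m -> C) u i : holo (@JE R m) U f -> U u ->
  wirt (inr i) f u = 0.
Proof.
move=> [_ H] Uu /=.
have := H u ((delta_mx ord0 i, 0) : E R m) Uu; rewrite /JE /= oppr0 => ->.
by rewrite mulrA iC_sqr mulN1r subrr mul0r.
Qed.

Lemma holo_sub V (J : V -> V) (U W : set V) f : U `<=` W -> holo J W f -> holo J U f.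
Proof.
move=> UW [s h]; split => [|u v Uu]; [exact: csmooth_sub s|exact/h/UW].
Qed.

Lemma holo_eq V (J : V -> V) (U : set V) f g : open U ->
  (forall u, U u -> f u = g u) -> holo J U f -> holo J U g.
Proof.
move=> oU fg [sf hf]; split; first exact: csmooth_eq sf.
move=> u v Uu; have N : \forall w \near u, g w = f w.
  by apply: filterS (open_nbhs_nbhs (conj oU Uu)) => w /fg.
by rewrite !(cderiv_eq _ N); exact: hf.
Qed.

Lemma holoM V (J : V -> V) (U : set V) f g : open U ->
  holo J U f -> holo J U g -> holo J U (fun u => f u * g u).
Proof.
move=> oU [sf hf] [sg hg]; split; first exact: csmoothM.
move=> u v Uu; have df := csmooth_cdif sf Uu; have dg := csmooth_cdif sg Uu.
by rewrite !cderivM // hf // hg //; ring.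
Qed.

Lemma holoV V (J : V -> V) (U : set V) f : open U -> (forall u, U u -> f u != 0) ->
  holo J U f -> holo J U (fun u => (f u)^-1).
Proof.
move=> oU f0 [sf hf]; have sV := csmoothV oU f0 sf; split=> // u v Uu.
have D w : cderiv w (fun u => (f u)^-1) u = - (f u)^-1 * (f u)^-1 * cderiv w f u.
  have L : cderiv w (fun u => f u * (f u)^-1) u = 0.
    rewrite -[RHS](cderiv_cst 1 u w); apply: cderiv_eq.
    by apply: filterS (open_nbhs_nbhs (conj oU Uu)) => z /f0 z0; rewrite divff.
  move: L; rewrite cderivM; [|exact: csmooth_cdif Uu|exact: csmooth_cdif Uu].
  move/eqP; rewrite addr_eq0 => /eqP L.
  transitivity ((f u)^-1 * (f u * cderiv w (fun u => (f u)^-1) u)).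
    by rewrite mulrA mulVf ?f0 // mul1r.
  by rewrite -[f u * _]opprK -L; ring.
by rewrite !D hf //; ring.
Qed.

End Holo.

End ComplexCalculus.

(** * Functions and tangent vectors on complex manifolds *)

Section SmoothGerms.
Variable R : realType.
Local Notation C := R[i].
Variable V : normedModType R.
Implicit Types (f g : V -> C) (u : V).

(** Smoothness of a germ, stated with a filter so that it combines with other neighbourhood
    conditions without carrying open sets. *)
Definition csn u f := \forall w \near u, csmooth [set w] f.

Lemma csnP u f : csn u f <-> exists W : set V, [/\ open W, W u & csmooth W f].
Proof.
split=> [sf|[W [oW Wu sf]]].
  exists [set w | csmooth [set w] f]°; split.
  - exact: open_interior.
  - exact: sf.
  - apply: csmooth_bigcup => w Ww; exists [set w]; split=> //.
    exact: nbhs_singleton Ww.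
apply: filterS (open_nbhs_nbhs (conj oW Wu)) => w Ww.
by apply: csmooth_sub sf => z ->.
Qed.

Lemma csn_open (W : set V) f u : open W -> csmooth W f -> W u -> csn u f.
Proof. by move=> oW sf Wu; apply/csnP; exists W. Qed.

Lemma csn_cdif u f : csn u f -> cdif f u.
Proof. by move=> /nbhs_singleton sf; exact: csmooth_cdif sf _. Qed.

Lemma csn_eq u f g : (\forall w \near u, f w = g w) -> csn u f -> csn u g.
Proof.
move=> fg /csnP[W [oW Wu sf]]; pose Z := W `&` [set w | f w = g w]°.
have oZ : open Z by apply: openI => //; exact: open_interior.
apply: (@csn_open Z) => //; apply: (csmooth_eq oZ) (csmooth_sub _ sf).
  by move=> w [_ /nbhs_singleton].
by move=> w [].
Qed.

Lemma csn2 u f g h : csn u f -> csn u g ->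
  (forall W : set V, open W -> csmooth W f -> csmooth W g -> csmooth W h) ->
  csn u h.
Proof.
move=> /csnP[W [oW Wu sf]] /csnP[Z [oZ Zu sg]] H.
have oI : open (W `&` Z) by exact: openI.
apply: (@csn_open (W `&` Z)) => //; apply: H => //.
  by apply: csmooth_sub sf => w [].
by apply: csmooth_sub sg => w [].
Qed.

Lemma csn_cst u (c : C) : csn u (fun=> c).
Proof. by apply: filterS filterT => w _; exact: csmooth_cst. Qed.

Lemma csnD u f g : csn u f -> csn u g -> csn u (fun w => f w + g w).
Proof. by move=> sf sg; apply: (csn2 sf sg) => W oW s1 s2; exact: csmoothD. Qed.

Lemma csnM u f g : csn u f -> csn u g -> csn u (fun w => f w * g w).
Proof. by move=> sf sg; apply: (csn2 sf sg) => W oW s1 s2; exact: csmoothM. Qed.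

Lemma csnJ u f : csn u f -> csn u (fun w => conjc (f w)).
Proof. by move=> sf; apply: (csn2 sf sf) => W oW s1 _; exact: csmoothJ. Qed.

Lemma csn_cont u f : csn u f ->
  {for u, continuous (fun w => complex.Re (f w))} /\
  {for u, continuous (fun w => complex.Im (f w))}.
Proof.
by move=> /csn_cdif[f1 f2]; split; exact: differentiable_continuous.
Qed.

Lemma csn_neq0 u f : csn u f -> f u != 0 -> \forall w \near u, f w != 0.
Proof.
move=> /csn_cont[c1 c2]; rewrite eq_complex negb_and => /orP[] f0.
  have H : \forall w \near u, complex.Re (f w) != 0.
    exact: c1 _ (open_nbhs_nbhs (conj (@open_neq _ 0) f0)).
  by apply: filterS H => w /= w0; rewrite eq_complex negb_and w0.
have H : \forall w \near u, complex.Im (f w) != 0.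
  exact: c2 _ (open_nbhs_nbhs (conj (@open_neq _ 0) f0)).
by apply: filterS H => w /= w0; rewrite eq_complex negb_and w0 orbT.
Qed.

Lemma csnV u f : csn u f -> f u != 0 -> csn u (fun w => (f w)^-1).
Proof.
move=> sf f0; have n0 := csn_neq0 sf f0; have /csnP[W [oW Wu sW]] := sf.
pose Z := W `&` [set w | f w != 0]°.
have oZ : open Z by apply: openI => //; exact: open_interior.
apply: (@csn_open Z) => //; apply: csmoothV => //.
  by move=> w [_ /nbhs_singleton].
by apply: csmooth_sub sW => w [].
Qed.

Lemma csn_ln u (f : V -> R) : csn u (fun w => (f w)%:C%C) -> f u != 0 ->
  csn u (fun w => (ln `|f w|)%:C%C).
Proof.
move=> sf f0; have f0' : (f u)%:C%C != 0 by rewrite eq_complex /= eqxx andbT.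
have n0 := csn_neq0 sf f0'; have /csnP[W [oW Wu sW]] := sf.
pose Z := W `&` [set w | (f w)%:C%C != 0]°.
have oZ : open Z by apply: openI => //; exact: open_interior.
apply: (@csn_open Z) => //; apply: csmooth_ln => //.
  by move=> w [_ /nbhs_singleton]; rewrite /= eq_complex /= eqxx andbT.
by apply: csmooth_sub sW => w [].
Qed.

End SmoothGerms.

Section SmoothGermsComp.
Variable R : realType.
Local Notation C := R[i].

Lemma csn_wirt m A (f : E R m -> C) u : csn u f -> csn u (wirt A f).
Proof. by move=> sf; apply: (csn2 sf sf) => W oW s1 _; exact: csmooth_wirt. Qed.

Lemma csn_zc m i (u : E R m) : csn u (zc i).
Proof. by apply: (@csn_open _ _ setT) => //; [exact: openT|exact: csmooth_zc]. Qed.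

Lemma csn_map_cont (V : normedModType R) m (G : V -> E R m) u :
  (forall i, csn u (fun w => zc i (G w))) -> {for u, continuous G}.
Proof.
move=> sG; apply: differentiable_continuous; apply: differentiable_E => A.
by case: A => i; have [] := csn_cdif (sG i).
Qed.

Lemma csn_comp (V : normedModType R) m (G : V -> E R m) f u :
  (forall i, csn u (fun w => zc i (G w))) -> csn (G u) f ->
  csn u (fun w => f (G w)).
Proof.
move=> sG /csnP[U [oU UGu sf]]; have cG := csn_map_cont sG.
pose W := [set w | (forall i, csmooth [set w] (fun w => zc i (G w))) /\ U (G w)].
have nG : nbhs u W.
  apply: filterI; first exact: filter_forall.
  exact: (cG _ (open_nbhs_nbhs (conj oU UGu))).
apply: (@csn_open _ _ W°) => //; first exact: open_interior.
apply: (csmooth_comp _ _ _ sf); first exact: open_interior.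
  by move=> w /nbhs_singleton[].
move=> i; apply: csmooth_bigcup => w /nbhs_singleton[+ _] => /(_ i) swi.
by exists [set w].
Qed.

End SmoothGermsComp.

Section ManifoldFunctions.
Variables (R : realType) (n : nat) (M : cmanifold R n).
Local Notation C := R[i].
Local Notation "'sn'" := (@smooth_near R n M) (at level 0).
Implicit Types (a b : chart M) (x y : M) (f g : M -> C).

Lemma dom_near a x : dom a x -> \forall y \near x, dom a y.
Proof. by move=> ax; apply: open_nbhs_nbhs; split => //; exact: dom_open. Qed.

Lemma im_near a x : dom a x -> \forall u \near phi a x, (phi a @` dom a) u.
Proof. by move=> ax; apply: open_nbhs_nbhs; split; [exact: im_open|exists x]. Qed.

Lemma phi_psiK a u : (phi a @` dom a) u -> phi a (psi a u) = u.
Proof. by move=> [x ax <-]; rewrite phiK. Qed.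

Lemma dom_psi a u : (phi a @` dom a) u -> dom a (psi a u).
Proof. by move=> [x ax <-]; rewrite phiK. Qed.

Lemma near_psi a x (P : M -> Prop) : dom a x ->
  (\forall y \near x, P y) -> \forall u \near phi a x, P (psi a u).
Proof.
move=> ax nP; have iu : (phi a @` dom a) (phi a x) by exists x.
have H : psi a z @[z --> phi a x] --> psi a (phi a x) by exact: psi_cont iu.
by move: H; rewrite phiK // => H; exact: H _ nP.
Qed.

Lemma near_phi a x (P : E R n -> Prop) : dom a x ->
  (\forall u \near phi a x, P u) -> \forall y \near x, P (phi a y).
Proof.
move=> ax nP; have H : phi a z @[z --> x] --> phi a x by exact: phi_cont ax.
exact: H _ nP.
Qed.

Lemma open_phi a (U : set M) : open U -> open (phi a @` (U `&` dom a)).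
Proof.
move=> oU; rewrite openE => u [x [Ux ax] <-].
have n1 := near_psi ax (open_nbhs_nbhs (conj oU Ux)).
apply: filterS (filterI n1 (im_near ax)) => w [/= Uw iw].
by exists (psi a w); [split=> //; exact: dom_psi|exact: phi_psiK].
Qed.

(** [smooth_near] quantifies over all charts. One chart at x is enough because transition maps are
    holomorphic, hence smooth. *)
Lemma snP a x f : dom a x -> sn x f <-> csn (phi a x) (fun u => f (psi a u)).
Proof.
move=> ax; split=> [[U [oU Ux sf]]|/csnP[W [oW Wu sf]]].
  by apply: (csn_open _ (sf a)); [exact: open_phi|exists x].
pose U := [set y | dom a y /\ W (phi a y)]; have oU : open U.
  rewrite openE => y [ay Wy]; apply: filterI; first exact: dom_near.
  by apply: (near_phi ay); exact: open_nbhs_nbhs.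
exists U; split => // b; have oUb : open (phi b @` (U `&` dom b)) by exact: open_phi.
have H : csmooth (phi b @` (U `&` dom b)) (fun u => f (psi a (phi a (psi b u)))).
  apply: (csmooth_comp (G := fun u => phi a (psi b u)) oUb _ _ sf).
    by move=> u [y [[_ Wy] dy] <-]; rewrite phiK.
  move=> i; have [sh _] := @phi_holo _ _ M b a i.
  by apply: csmooth_sub sh => u [y [[ay _] dy] <-]; exists y.
apply: csmooth_eq H => // u [y [[ay _] dy] <-].
by rewrite (phiK dy) (phiK ay).
Qed.

Lemma sn_near x f : sn x f -> \forall y \near x, sn y f.
Proof.
move=> [U [oU Ux sf]]; apply: filterS (open_nbhs_nbhs (conj oU Ux)) => y Uy.
by exists U.
Qed.

Lemma smooth_funP (U : set M) f : open U ->
  smooth_fun U f <-> forall x, U x -> sn x f.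
Proof.
move=> oU; split=> [sf x Ux|H a]; first by exists U.
apply: csmooth_bigcup => u [x [Ux ax] <-].
have /(snP _ ax)/csnP[W [oW Wu sf]] := H x Ux; by exists W.
Qed.

Lemma sn_eq x f g : (\forall y \near x, f y = g y) -> sn x f -> sn x g.
Proof.
move=> fg; have [a ax] := dom_cover x; rewrite !(snP _ ax).
by apply: csn_eq; exact: (@near_psi a x (fun y => f y = g y) ax fg).
Qed.

Lemma sn_cst x (c : C) : sn x (fun=> c).
Proof. by have [a ax] := dom_cover x; rewrite (snP _ ax); exact: csn_cst. Qed.

Lemma snD x f g : sn x f -> sn x g -> sn x (fun y => f y + g y).
Proof. by have [a ax] := dom_cover x; rewrite !(snP _ ax); exact: csnD. Qed.

Lemma snM x f g : sn x f -> sn x g -> sn x (fun y => f y * g y).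
Proof. by have [a ax] := dom_cover x; rewrite !(snP _ ax); exact: csnM. Qed.

Lemma snJ x f : sn x f -> sn x (fun y => conjc (f y)).
Proof. by have [a ax] := dom_cover x; rewrite !(snP _ ax); exact: csnJ. Qed.

Lemma snJE x f : sn x (fun y => conjc (f y)) <-> sn x f.
Proof.
split; last exact: snJ.
by move/snJ; apply: sn_eq; apply: filterS filterT => y _; rewrite conjcK.
Qed.

Lemma sn_neq0 x f : sn x f -> f x != 0 -> \forall y \near x, f y != 0.
Proof.
have [a ax] := dom_cover x; rewrite (snP _ ax) => sf f0.
have := csn_neq0 sf; rewrite phiK // => /(_ f0) /(near_phi ax) H.
by apply: filterS (filterI H (dom_near ax)) => y []; move=> + ay; rewrite phiK.
Qed.

Lemma snV x f : sn x f -> f x != 0 -> sn x (fun y => (f y)^-1).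
Proof.
have [a ax] := dom_cover x; rewrite !(snP _ ax) => sf f0.
by apply: csnV => //; rewrite phiK.
Qed.

Lemma sn_ln x (f : M -> R) : sn x (fun y => (f y)%:C%C) -> f x != 0 ->
  sn x (fun y => (ln `|f y|)%:C%C).
Proof.
have [a ax] := dom_cover x; rewrite !(snP _ ax) => sf f0.
by apply: (csn_ln (f := fun u => f (psi a u))) => //; rewrite phiK.
Qed.

Lemma sn_sum x (I : Type) (r : seq I) (P : pred I) (F : I -> M -> C) :
  (forall i, P i -> sn x (F i)) -> sn x (fun y => \sum_(i <- r | P i) F i y).
Proof.
move=> H; have -> : (fun u => \sum_(i <- r | P i) F i u) =
    \sum_(i <- r | P i) F i by apply/funext => w; rewrite fct_sumE.
elim/big_ind : _ => [|f g sf sg|//]; first exact: (sn_cst x 0).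
exact: snD.
Qed.

Lemma sn_prod x (I : Type) (r : seq I) (P : pred I) (F : I -> M -> C) :
  (forall i, P i -> sn x (F i)) -> sn x (fun y => \prod_(i <- r | P i) F i y).
Proof.
move=> H; have -> : (fun u => \prod_(i <- r | P i) F i u) =
    \prod_(i <- r | P i) F i by apply/funext => w; rewrite fct_prodE.
elim/big_ind : _ => [|f g sf sg|//]; first exact: (sn_cst x 1).
exact: snM.
Qed.

Lemma sn_Zc a x A : dom a x -> sn x (fun y => Zc A (phi a y)).
Proof.
move=> ax; rewrite (snP _ ax).
have N : \forall u \near phi a x, Zc A u = Zc A (phi a (psi a u)).
  by apply: filterS (im_near ax) => u iu; rewrite phi_psiK.
apply: (csn_eq N).
by case: A {N} => i; [exact: csn_zc|apply: csnJ; exact: csn_zc].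
Qed.

Lemma sn_zc a x i : dom a x -> sn x (fun y => zc i (phi a y)).
Proof. exact: (@sn_Zc a x (inl i)). Qed.

Lemma sn_comp m x (G : M -> E R m) (f : E R m -> C) :
  (forall i, sn x (fun y => zc i (G y))) -> csn (G x) f -> sn x (fun y => f (G y)).
Proof.
have [a ax] := dom_cover x => sG sf; rewrite (snP _ ax).
apply: (csn_comp (G := fun u => G (psi a u))); last by rewrite phiK.
by move=> i; apply: (snP (fun y => zc i (G y)) ax).1.
Qed.

End ManifoldFunctions.

(** * Tangent vectors and their types *)

Section Tangent.
Variables (R : realType) (n : nat) (M : cmanifold R n).
Local Notation C := R[i].
Local Notation "'sn'" := (@smooth_near R n M) (at level 0).
Implicit Types (a b : chart M) (x y : M) (f g : M -> C) (v w : tvec M).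

Lemma sum_tvecE (I : Type) (r : seq I) (P : pred I) (w : I -> tvec M) f :
  (\sum_(i <- r | P i) w i : tvec M) f = \sum_(i <- r | P i) w i f.
Proof. by rewrite fct_sumE. Qed.

Lemma pdE a A x f : sn x f -> pd a A x f = wirt A (fun u => f (psi a u)) (phi a x).
Proof. by move=> sf; rewrite /pd asboolT. Qed.

Lemma pd_out a A x f : ~ sn x f -> pd a A x f = 0.
Proof. by move=> sf; rewrite /pd asboolF. Qed.

Lemma conjv_pd a A x : dom a x -> conjv (pd a A x) = pd a (flipA A) x.
Proof.
move=> ax; apply/funext => f; rewrite /conjv.
have [sf|sf] := pselect (sn x f); last first.
  by rewrite !pd_out ?rmorph0 // snJE.
rewrite !pdE ?snJE //.
rewrite (@wirtJ _ _ A (fun u => f (psi a u))) ?conjcK //.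
by apply: csn_cdif; apply/(snP _ ax).
Qed.

Lemma tv_out x v f : is_tvec x v -> ~ sn x f -> v f = 0.
Proof.
move=> [a [k [ax ->]]] sf; rewrite sum_tvecE big1 // => A _.
by rewrite -[LHS]/(k A * _) pd_out ?mulr0.
Qed.

Lemma tv_comp x v m (G : M -> E R m) (f : E R m -> C) : is_tvec x v ->
  (forall i, sn x (fun y => zc i (G y))) -> csn (G x) f ->
  v (fun y => f (G y)) = \sum_B wirt B f (G x) * v (fun y => Zc B (G y)).
Proof.
move=> [a [k [ax ->]]] sG sf.
have sGf : sn x (fun y => f (G y)) by exact: sn_comp.
have sZ B : sn x (fun y => Zc B (G y)).
  by case: B => i /=; [exact: sG|apply: snJ].
rewrite sum_tvecE.
under [RHS]eq_bigr do rewrite sum_tvecE mulr_sumr.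
rewrite exchange_big /=; apply: eq_bigr => A _.
rewrite -[LHS]/(k A * _) pdE // (@wirt_comp _ _ _ (fun u => G (psi a u))); last first.
- by rewrite phiK //; exact: csn_cdif.
- by move=> i; apply: csn_cdif; exact: (snP (fun y => zc i (G y)) ax).1.
rewrite mulr_sumr phiK //; apply: eq_bigr => B _.
rewrite -[(k A *: pd a A x) _]/(k A * pd a A x (fun y => Zc B (G y))) pdE //; ring.
Qed.

Lemma tv_eq x v f g : is_tvec x v -> (\forall y \near x, f y = g y) -> v f = v g.
Proof.
move=> [a [k [ax ->]]] fg; rewrite !sum_tvecE; apply: eq_bigr => A _; congr (k A * _).
have gf : \forall y \near x, g y = f y by apply: filterS fg => y ->.
have [sf|sf] := pselect (sn x f); last first.
  by rewrite !pd_out // => sg; apply: sf; exact: sn_eq sg.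
have sg := sn_eq fg sf; rewrite !pdE //; apply: wirt_eq.
exact: (@near_psi _ _ _ a x (fun y => f y = g y) ax fg).
Qed.

(** The chart in [is_tvec] is existential; this passes to any chart at x. For f smooth near x it is
    the chain rule for f = f o psi o phi; for all other f both sides are 0 by the convention in
    [pd]. *)
Lemma tvE a x v : dom a x -> is_tvec x v ->
  v = \sum_A v (fun y => Zc A (phi a y)) *: pd a A x.
Proof.
move=> ax tv; apply/funext => f; rewrite sum_tvecE.
have [sf|sf] := pselect (sn x f); last first.
  rewrite (tv_out tv sf) big1 // => A _.
  by rewrite -[LHS]/(_ * pd a A x f) pd_out ?mulr0.
have N : \forall y \near x, f y = f (psi a (phi a y)).
  by apply: filterS (dom_near ax) => y ay; rewrite phiK.
rewrite (tv_eq tv N) (@tv_comp x v n (phi a) (fun u => f (psi a u))) //.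
- by apply: eq_bigr => A _; rewrite -[RHS]/(_ * pd a A x f) pdE // mulrC.
- by move=> i; exact: sn_zc.
- exact/(snP _ ax).
Qed.

Lemma tv_chart a x (k : 'I_n + 'I_n -> C) : dom a x ->
  is_tvec x (\sum_A k A *: pd a A x).
Proof. by move=> ax; exists a, k. Qed.

Lemma tvD x v w : is_tvec x v -> is_tvec x w -> is_tvec x (v + w).
Proof.
have [a ax] := dom_cover x => tv tw; rewrite (tvE ax tv) (tvE ax tw) -big_split /=.
by under eq_bigr do rewrite -scalerDl; exact: tv_chart.
Qed.

Lemma tvZ x (k : C) v : is_tvec x v -> is_tvec x (k *: v).
Proof.
have [a ax] := dom_cover x => tv; rewrite (tvE ax tv) scaler_sumr.
by under eq_bigr do rewrite scalerA; exact: tv_chart.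
Qed.

Lemma tv0 x : is_tvec x 0.
Proof.
have [a ax] := dom_cover x.
have -> : 0 = \sum_A (0 : C) *: pd a A x by rewrite big1 // => A _; rewrite scale0r.
exact: tv_chart.
Qed.

Lemma tvN x v : is_tvec x v -> is_tvec x (- v).
Proof. by rewrite -scaleN1r; exact: tvZ. Qed.

Lemma tvB x v w : is_tvec x v -> is_tvec x w -> is_tvec x (v - w).
Proof. by move=> tv tw; apply: tvD => //; exact: tvN. Qed.

Lemma tv_sum x (I : Type) (r : seq I) (P : pred I) (w : I -> tvec M) :
  (forall i, P i -> is_tvec x (w i)) -> is_tvec x (\sum_(i <- r | P i) w i).
Proof. by move=> H; elim/big_ind : _ => //; [exact: tv0|exact: tvD]. Qed.

Lemma tv_pd a A x : dom a x -> is_tvec x (pd a A x).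
Proof.
move=> ax; have -> : pd a A x = \sum_B (B == A)%:R *: pd a B x.
  rewrite (bigD1 A) //= eqxx scale1r big1 ?addr0 // => B /negbTE ->.
  by rewrite scale0r.
exact: tv_chart.
Qed.

Lemma conjvD v w : conjv (v + w) = conjv v + conjv w.
Proof. by apply/funext => f; rewrite /conjv -[(v + w) _]/(v _ + w _) rmorphD. Qed.

Lemma conjvZ (k : C) v : conjv (k *: v) = conjc k *: conjv v.
Proof. by apply/funext => f; rewrite /conjv -[(k *: v) _]/(k * v _) rmorphM. Qed.

Lemma conjv0 : conjv (0 : tvec M) = 0.
Proof. by apply/funext => f; rewrite /conjv -[RHS](rmorph0 (@conjc R)). Qed.

Lemma conjvN v : conjv (- v) = - conjv v.
Proof. by rewrite -scaleN1r conjvZ rmorphN1 scaleN1r. Qed.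

Lemma conjvB v w : conjv (v - w) = conjv v - conjv w.
Proof. by rewrite conjvD conjvN. Qed.

Lemma conjv_sum (I : Type) (r : seq I) (P : pred I) (w : I -> tvec M) :
  conjv (\sum_(i <- r | P i) w i) = \sum_(i <- r | P i) conjv (w i).
Proof. by rewrite (big_morph _ conjvD conjv0). Qed.

Lemma conjvK v : conjv (conjv v) = v.
Proof.
apply/funext => f; rewrite /conjv conjcK; congr (v _).
by apply/funext => y; rewrite conjcK.
Qed.

Lemma tvJ x v : is_tvec x v -> is_tvec x (conjv v).
Proof.
have [a ax] := dom_cover x => tv; rewrite (tvE ax tv) conjv_sum.
by apply: tv_sum => A _; rewrite conjvZ conjv_pd //; apply: tvZ; exact: tv_pd.
Qed.

Lemma conjvE v f : conjv v (fun y => conjc (f y)) = conjc (v f).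
Proof.
by rewrite /conjv; congr (conjc (v _)); apply/funext => y; rewrite conjcK.
Qed.

Section Derivation.
Variables (x : M) (v : tvec M).
Hypothesis tv : is_tvec x v.

Lemma tv_mul f g : sn x f -> sn x g ->
  v (fun y => f y * g y) = v f * g x + f x * v g.
Proof.
have [a [k [ax ->]]] := tv => sf sg; rewrite !sum_tvecE mulr_suml mulr_sumr -big_split.
apply: eq_bigr => A _ /=.
rewrite -[(k A *: _) _]/(k A * _) -[(k A *: _) f]/(k A * _) -[(k A *: _) g]/(k A * _).
rewrite !pdE //; last exact: snM.
rewrite (@wirtM _ _ A (fun u => f (psi a u)) (fun u => g (psi a u))) ?phiK //; first ring.
  by apply: csn_cdif; apply/(snP _ ax).
by apply: csn_cdif; apply/(snP _ ax).
Qed.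

Lemma tv_cst (c : C) : v (fun=> c) = 0.
Proof.
have [a [k [ax ->]]] := tv; rewrite sum_tvecE big1 // => A _.
by rewrite -[LHS]/(k A * _) pdE ?wirt_cst ?mulr0 //; exact: sn_cst.
Qed.

(** Valid for every f: if f is not smooth near x, neither is c f for c != 0, and both sides are the
    default value 0. *)
Lemma tv_scale (c : C) f : v (fun y => c * f y) = c * v f.
Proof.
have [sf|sf] := pselect (sn x f).
  by rewrite tv_mul ?tv_cst ?mul0r ?add0r //; exact: sn_cst.
have [->|c0] := eqVneq c 0.
  rewrite mul0r (_ : (fun y => 0 * f y) = fun=> 0) ?tv_cst //.
  by apply/funext => y; rewrite mul0r.
rewrite !(tv_out tv) ?mulr0 // => scf; apply: sf.
apply: (@sn_eq _ _ _ x (fun y => c^-1 * (c * f y))).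
  by apply: filterS filterT => y _; rewrite mulrA mulVf // mul1r.
by apply: snM => //; exact: sn_cst.
Qed.

Lemma tv_inv f : sn x f -> f x != 0 ->
  v (fun y => (f y)^-1) = - (v f) / (f x) ^+ 2.
Proof.
move=> sf f0; have sV := snV sf f0.
have N : \forall y \near x, f y * (f y)^-1 = 1.
  by apply: filterS (sn_neq0 sf f0) => y y0; rewrite divff.
have := tv_eq tv N; rewrite tv_mul // tv_cst => /eqP; rewrite addr_eq0 => /eqP H.
rewrite -[LHS]mul1r -(mulVf f0) -mulrA -[f x * _]opprK -H expr2 invfM; ring.
Qed.

Lemma tv_ln (f : M -> R) : sn x (fun y => (f y)%:C%C) -> f x != 0 ->
  v (fun y => (ln `|f y|)%:C%C) = (f x)^-1%:C%C * v (fun y => (f y)%:C%C).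
Proof.
have [a [k [ax ->]]] := tv => sf f0; rewrite !sum_tvecE mulr_sumr.
apply: eq_bigr => A _.
rewrite -[LHS]/(k A * _) -[(k A *: _) _ in RHS]/(k A * _) !pdE //; last exact: sn_ln.
rewrite (@wirt_ln _ _ A (fun u => f (psi a u))) ?phiK //; first ring.
by apply: csn_cdif; apply: (snP (fun y => (f y)%:C%C) ax).1.
Qed.

End Derivation.

Lemma pd_Zc a A B x : dom a x -> pd a A x (fun y => Zc B (phi a y)) = (A == B)%:R.
Proof.
move=> ax; rewrite pdE; last exact: sn_Zc.
rewrite -[RHS](@wirt_Zc R n A B (phi a x)); apply: wirt_eq.
by apply: filterS (im_near ax) => u iu; rewrite phi_psiK.
Qed.

Lemma tv_eqP a x v w : dom a x -> is_tvec x v -> is_tvec x w ->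
  (forall A, v (fun y => Zc A (phi a y)) = w (fun y => Zc A (phi a y))) -> v = w.
Proof.
by move=> ax tv tw H; rewrite (tvE ax tv) (tvE ax tw); apply: eq_bigr => A _; rewrite H.
Qed.

Lemma tv_ext x v w : is_tvec x v -> is_tvec x w ->
  (forall f, sn x f -> v f = w f) -> v = w.
Proof.
move=> tv tw H; have [a ax] := dom_cover x.
by apply: (tv_eqP ax) => // A; apply: H; exact: sn_Zc.
Qed.

Lemma type10_tv x v : type10 x v -> is_tvec x v.
Proof.
move=> [a [k [ax ->]]]; apply: tv_sum => i _; apply: tvZ; exact: tv_pd.
Qed.

Lemma type10_chart a x v : dom a x -> is_tvec x v ->
  (forall i, v (fun y => conjc (zc i (phi a y))) = 0) ->
  v = \sum_i v (fun y => zc i (phi a y)) *: pd a (inl i) x.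
Proof.
move=> ax tv H; rewrite {1}(tvE ax tv) big_sumType /= [X in _ + X]big1 ?addr0 //.
by move=> i _; rewrite H scale0r.
Qed.

(** A test in one chart; together with [type10_zc], which holds in every chart, it makes the type
    independent of the chart. *)
Lemma type10P a x v : dom a x -> is_tvec x v ->
  (forall i, v (fun y => conjc (zc i (phi a y))) = 0) -> type10 x v.
Proof. by move=> ax tv H; rewrite (type10_chart ax tv H); exists a; eexists. Qed.

(** The derivative of conj f by z^i is the conjugate of that of f by conj z^i, which vanishes by the
    Cauchy-Riemann equation. *)
Lemma type10_holo x v (U : set M) f : type10 x v -> open U -> U x ->
  holo_fun U f -> v (fun y => conjc (f y)) = 0.
Proof.
move=> [a [k [ax ->]]] oU Ux hf.
have sf : sn x f by exists U; split=> // b; have [hs _] := hf b; exact: hs.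
rewrite sum_tvecE big1 // => i _; rewrite -[LHS]/(k i * _) pdE; last exact: snJ.
rewrite (@wirtJ _ _ _ (fun u => f (psi a u))) /=; last first.
  by apply: csn_cdif; apply/(snP _ ax).
have := holo_wirt i (hf a) (ex_intro2 _ _ x (conj Ux ax) erefl).
by rewrite /= => ->; rewrite rmorph0 mulr0.
Qed.

Lemma holo_chart a i : holo_fun (dom a) (fun y => zc i (phi a y)).
Proof. by move=> b; have := @phi_holo _ _ M b a i; rewrite setIC. Qed.

Lemma type10_zc a x v i : dom a x -> type10 x v ->
  v (fun y => conjc (zc i (phi a y))) = 0.
Proof.
move=> ax v10; apply: (type10_holo v10 (dom_open a) ax); exact: holo_chart.
Qed.

Lemma type10E a x v : dom a x -> type10 x v ->
  v = \sum_i v (fun y => zc i (phi a y)) *: pd a (inl i) x.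
Proof.
move=> ax v10; apply: type10_chart => //; first exact: type10_tv.
by move=> i; exact: type10_zc ax v10.
Qed.

Lemma type10_sum x (I : Type) (r : seq I) (P : pred I) (w : I -> tvec M) :
  (forall i, P i -> type10 x (w i)) -> type10 x (\sum_(i <- r | P i) w i).
Proof.
move=> H; have [a ax] := dom_cover x; apply: (type10P ax).
  by apply: tv_sum => i /H/type10_tv.
by move=> j; rewrite sum_tvecE big1 // => i /H/(type10_zc j ax).
Qed.

Lemma type10Z x (k : C) v : type10 x v -> type10 x (k *: v).
Proof.
move=> v10; have [a ax] := dom_cover x; apply: (type10P ax).
  by apply: tvZ; exact: type10_tv.
by move=> j; rewrite -[LHS]/(k * _) (type10_zc j ax) ?mulr0.
Qed.

Lemma type10D x v w : type10 x v -> type10 x w -> type10 x (v + w).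
Proof.
move=> v10 w10; have [a ax] := dom_cover x; apply: (type10P ax).
  by apply: tvD; exact: type10_tv.
by move=> j; rewrite -[LHS]/(v _ + w _) !(type10_zc j ax) ?addr0.
Qed.

Lemma type100 x : type10 x (0 : tvec M).
Proof.
by have [a ax] := dom_cover x; apply: (type10P ax) => //; exact: tv0.
Qed.

Lemma type10B x v w : type10 x v -> type10 x w -> type10 x (v - w).
Proof.
by move=> v10 w10; apply: type10D => //; rewrite -scaleN1r; exact: type10Z.
Qed.

Lemma type10_pd a i x : dom a x -> type10 x (pd a (inl i) x).
Proof.
move=> ax; apply: (type10P ax); first exact: tv_pd.
by move=> j; exact: (@pd_Zc a (inl i) (inr j)).
Qed.

Lemma type01_tv x v : type01 x v -> is_tvec x v.
Proof. by move=> /type10_tv/tvJ; rewrite conjvK. Qed.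

Lemma type01_zc a x v i : dom a x -> type01 x v -> v (fun y => zc i (phi a y)) = 0.
Proof.
move=> ax /(type10_zc i ax); rewrite conjvE => /eqP; rewrite conjc_eq0 => /eqP //.
Qed.

Lemma type01J x v : type10 x v -> type01 x (conjv v).
Proof. by rewrite /type01 conjvK. Qed.

Lemma type01_pd a i x : dom a x -> type01 x (pd a (inr i) x).
Proof. by move=> ax; rewrite /type01 conjv_pd //; exact: type10_pd. Qed.

Lemma type10_01_0 x v : type10 x v -> type01 x v -> v = 0.
Proof.
move=> v10 v01; have [a ax] := dom_cover x.
by rewrite (type10E ax v10) big1 // => i _; rewrite (type01_zc i ax v01) scale0r.
Qed.

(** The chart is picked by choice; [prj10E] shows that every chart at x gives the same vector. *)
Definition prj10 x v : tvec M :=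
  let a := projT1 (cid (dom_cover x)) in
  \sum_i v (fun y => zc i (phi a y)) *: pd a (inl i) x.

Lemma type10_prj x v : type10 x (prj10 x v).
Proof.
rewrite /prj10; case: cid => a /= ax; apply: type10_sum => i _; apply: type10Z.
exact: type10_pd.
Qed.

Lemma type01_prj x v : is_tvec x v -> type01 x (v - prj10 x v).
Proof.
rewrite /prj10; case: cid => a /= ax tv.
have E := tvE ax tv; rewrite big_sumType /= in E.
rewrite [X in X - _]E addrAC subrr add0r /type01 conjv_sum.
apply: type10_sum => i _; rewrite conjvZ; apply: type10Z.
by rewrite conjv_pd //; exact: type10_pd.
Qed.

(** The difference of two decompositions is of both types, hence 0. *)
Lemma prj10_uniq x v w : type10 x v -> type01 x w -> prj10 x (v + w) = v.
Proof.
move=> v10 w01; have tv := tvD (type10_tv v10) (type01_tv w01).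
apply/eqP; rewrite -subr_eq0; apply/eqP.
apply: (@type10_01_0 x); first by apply: type10B => //; exact: type10_prj.
have -> : prj10 x (v + w) - v = w - ((v + w) - prj10 x (v + w)).
  by move: (prj10 _ _) => p; rewrite opprB addrCA; congr (p + _);
     rewrite opprD addrCA subrr addr0.
by rewrite /type01 conjvB; apply: type10B => //; exact: type01_prj.
Qed.

Lemma prj10E a x v : dom a x -> is_tvec x v ->
  prj10 x v = \sum_i v (fun y => zc i (phi a y)) *: pd a (inl i) x.
Proof.
move=> ax tv; rewrite {1}(tvE ax tv) big_sumType /= prj10_uniq //.
  by apply: type10_sum => i _; apply: type10Z; exact: type10_pd.
rewrite /type01 conjv_sum.
by apply: type10_sum => i _; rewrite conjvZ conjv_pd //; apply: type10Z; exact: type10_pd.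
Qed.

End Tangent.

(** * Vector fields and holomorphic maps *)

Section Fields.
Variables (R : realType) (n : nat) (M : cmanifold R n).
Local Notation C := R[i].
Local Notation "'sn'" := (@smooth_near R n M) (at level 0).
Implicit Types (a b : chart M) (x y : M) (f g : M -> C) (v w : tvec M)
  (X Y : vfield M).

Definition svf x X := \forall y \near x, is_tvec y (X y) /\
  forall f, sn y f -> sn y (fun z => X z f).

Lemma smooth_vfP (U : set M) X : open U ->
  smooth_vf U X <-> forall x, U x -> svf x X.
Proof.
move=> oU; split=> [[tX sX] x Ux|H].
  apply: filterS (open_nbhs_nbhs (conj oU Ux)) => y Uy; split; first exact: tX.
  move=> f [V [oV Vy sf]]; exists (U `&` V); split=> //; first exact: openI.
  apply: sX; [exact: openI|by move=> z []|].
  by apply/smooth_funP; [exact: openI|move=> z [_ Vz]; exists V].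
split=> [x /H/nbhs_singleton[]//|V f oV VU sf].
apply/smooth_funP => // x Vx; have /nbhs_singleton[_] := H x (VU _ Vx); apply.
by move/smooth_funP: sf; exact.
Qed.

Lemma svf_near x X : svf x X -> \forall y \near x, svf y X.
Proof. exact: near_join. Qed.

Lemma svf_tv x X : svf x X -> is_tvec x (X x).
Proof. by move=> /nbhs_singleton[]. Qed.

Lemma svf_sn x X f : svf x X -> sn x f -> sn x (fun y => X y f).
Proof. by move=> /nbhs_singleton[_ H] /H. Qed.

Lemma svf_eq x X Y : (\forall y \near x, X y = Y y) -> svf x X -> svf x Y.
Proof.
move=> XY sX; apply: filterS (filterI (near_join XY) sX) => y [XYy [tX sXy]].
split; first by rewrite -(nbhs_singleton XYy).
by move=> f /sXy; apply: sn_eq; apply: filterS XYy => z ->.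
Qed.

Lemma sn_pd a A x f : dom a x -> sn x f -> sn x (fun y => pd a A y f).
Proof.
move=> ax sf; rewrite (snP _ ax).
have N : \forall u \near phi a x,
    wirt A (fun z => f (psi a z)) u = pd a A (psi a u) f.
  have n1 := near_psi ax (sn_near sf).
  by apply: filterS (filterI n1 (im_near ax)) => u [s1 iu]; rewrite pdE // phi_psiK.
apply: (csn_eq N); apply: csn_wirt; exact/(snP _ ax).
Qed.

Lemma svf_frame a x (k : 'I_n + 'I_n -> M -> C) X : dom a x ->
  (forall A, sn x (k A)) ->
  (\forall y \near x, X y = \sum_A k A y *: pd a A y) -> svf x X.
Proof.
move=> ax sk NX.
have sk' : \forall y \near x, forall A, sn y (k A).
  by apply: filter_forall => A; exact: sn_near.
apply: filterS (filterI (filterI (near_join NX) (dom_near ax)) sk').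
move=> y [[NXy ay] sky]; split.
  by rewrite (nbhs_singleton NXy); exact: tv_chart.
move=> f sf; apply: (@sn_eq _ _ _ _ (fun z => \sum_A k A z * pd a A z f)).
  by apply: filterS NXy => z ->; rewrite sum_tvecE.
by apply: sn_sum => A _; apply: snM => //; exact: sn_pd.
Qed.

Lemma svf_pd a A x : dom a x -> svf x (pd a A).
Proof.
move=> ax; apply: (@svf_frame a _ (fun B _ => (B == A)%:R)) => //.
  by move=> B; exact: sn_cst.
apply: filterS filterT => y _; rewrite (bigD1 A) //= eqxx scale1r big1 ?addr0 //.
by move=> B /negbTE ->; rewrite scale0r.
Qed.

Lemma svf_coord a x X : dom a x -> svf x X ->
  \forall y \near x, X y = \sum_A X y (fun z => Zc A (phi a z)) *: pd a A y.
Proof.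
move=> ax sX; apply: filterS (filterI sX (dom_near ax)) => y [[tX _] ay].
exact: tvE.
Qed.

Lemma svf_coord_sn a x X A : dom a x -> svf x X ->
  sn x (fun y => X y (fun z => Zc A (phi a z))).
Proof. by move=> ax sX; apply: svf_sn => //; exact: sn_Zc. Qed.

Lemma svfD x X Y : svf x X -> svf x Y -> svf x (fun y => X y + Y y).
Proof.
move=> sX sY; apply: filterS (filterI sX sY) => y [[tX sXy] [tY sYy]].
split=> [|f sf]; first exact: tvD.
by apply: (@snD _ _ _ y (fun z => X z f) (fun z => Y z f)); [exact: sXy|exact: sYy].
Qed.

Lemma svfZ x f X : sn x f -> svf x X -> svf x (fun y => f y *: X y).
Proof.
move=> sf sX; apply: filterS (filterI (sn_near sf) sX) => y [sfy [tX sXy]].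
split=> [|h sh]; first exact: tvZ.
by apply: (@snM _ _ _ y f (fun z => X z h)) => //; exact: sXy.
Qed.

Lemma svfJ x X : svf x X -> svf x (fun y => conjv (X y)).
Proof.
move=> sX; apply: filterS sX => y [tX sXy]; split=> [|h sh]; first exact: tvJ.
by apply: snJ; apply: sXy; exact: snJ.
Qed.

Lemma svf0 x : svf x (fun=> 0).
Proof.
apply: filterS filterT => y _; split=> [|h sh]; first exact: tv0.
exact: (sn_cst y 0).
Qed.

Lemma svfB x X Y : svf x X -> svf x Y -> svf x (fun y => X y - Y y).
Proof.
move=> sX sY; apply: svfD => //.
have -> : (fun y => - Y y) = (fun y => (-1 : C) *: Y y).
  by apply/funext => y; rewrite scaleN1r.
by apply: svfZ => //; exact: sn_cst.
Qed.

Lemma svf_sum x (I : Type) (r : seq I) (P : pred I) (F : I -> vfield M) :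
  (forall i, P i -> svf x (F i)) -> svf x (fun y => \sum_(i <- r | P i) F i y).
Proof.
move=> H; have -> : (fun y => \sum_(i <- r | P i) F i y) =
    (\sum_(i <- r | P i) F i : vfield M) by rewrite fct_sumE.
elim/big_ind : _ => [|X Y sX sY|//]; first exact: svf0.
exact: svfD.
Qed.

Lemma svf_prj10 x X : svf x X -> svf x (fun y => prj10 y (X y)).
Proof.
move=> sX; have [a ax] := dom_cover x.
pose k (A : 'I_n + 'I_n) y :=
  if A is inl _ then X y (fun z => Zc A (phi a z)) else 0.
apply: (@svf_frame a _ k) => //.
  by case=> i; [exact: svf_coord_sn|exact: sn_cst].
apply: filterS (filterI sX (dom_near ax)) => y [[tX _] ay].
rewrite (prj10E ay tX) big_sumType /= [X in _ = _ + X]big1 ?addr0 // => i _.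
by rewrite scale0r.
Qed.

(** Extension of v with constant coefficients in the chart a, used to apply identities between
    fields to a single vector. *)
Definition vext a v : vfield M :=
  fun y => \sum_A v (fun z => Zc A (phi a z)) *: pd a A y.

Lemma svf_vext a x v : dom a x -> svf x (vext a v).
Proof.
move=> ax; apply: (@svf_frame a _ (fun A _ => v (fun z => Zc A (phi a z)))) => //.
  by move=> A; exact: sn_cst.
exact: filterS filterT.
Qed.

Lemma vextE a x v : dom a x -> is_tvec x v -> vext a v x = v.
Proof. by move=> ax tv; rewrite [RHS](tvE ax tv). Qed.

Lemma vext10 a x y v : dom a x -> dom a y -> type10 x v -> type10 y (vext a v y).
Proof.
move=> ax ay v10; rewrite /vext big_sumType /= [X in _ + X]big1 ?addr0.
  by apply: type10_sum => i _; apply: type10Z; exact: type10_pd.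
by move=> i _; rewrite (type10_zc i ax v10) scale0r.
Qed.

Definition tf10 x X := \forall y \near x, type10 y (X y).

Lemma smooth_vf10P (U : set M) X : open U ->
  smooth_vf10 U X <-> forall x, U x -> svf x X /\ type10 x (X x).
Proof.
move=> oU; split=> [[/(smooth_vfP _ oU) sX tX] x Ux|H].
  by split; [exact: sX|exact: tX].
by split; [apply/smooth_vfP => // x /H[]|move=> x /H[]].
Qed.

End Fields.

(** * Differentials of holomorphic maps *)

Section Push.
Variables (R : realType) (m n : nat) (M : cmanifold R m) (N : cmanifold R n).
Local Notation C := R[i].
Implicit Types (F : M -> N) (x : M) (v w : tvec M) (f : N -> C).

Definition holo_at x F := exists U : set M, [/\ open U, U x & holo_map U F].

Lemma holo_at_cont x F : holo_at x F -> {for x, continuous F}.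
Proof. by move=> [U [oU Ux [cF _]]]; exact: cF. Qed.

Lemma holo_at_coord x F (b : chart N) : holo_at x F -> dom b (F x) ->
  exists V : set M, [/\ open V, V x &
    forall i, holo_fun V (fun y => zc i (phi b (F y)))].
Proof.
move=> [U [oU Ux [cF hF]]] bFx; exists (U `&` F @^-1` dom b); split=> //.
rewrite openE => y [Uy by_]; apply: filterI; first exact: open_nbhs_nbhs.
exact: (cF y Uy _ (dom_near by_)).
Qed.

Lemma holo_near_sn n' (M' : cmanifold R n') (x : M') (U : set M') (f : M' -> C) :
  open U -> U x -> holo_fun U f -> smooth_near x f.
Proof. by move=> oU Ux hf; exists U; split=> // b; have [hs _] := hf b; exact: hs. Qed.

Lemma sn_holo_at x F f : holo_at x F -> smooth_near (F x) f ->
  smooth_near x (fun y => f (F y)).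
Proof.
move=> hF; have [b bFx] := dom_cover (F x).
have [V [oV Vx hV]] := holo_at_coord hF bFx => sf.
have NF : \forall y \near x, f (psi b (phi b (F y))) = f (F y).
  have cF := holo_at_cont hF.
  have H : \forall y \near x, dom b (F y) by exact: cF (dom_near bFx).
  by apply: filterS H => y by_; rewrite phiK.
apply: (sn_eq NF).
apply: (@sn_comp _ _ _ n x (fun y => phi b (F y)) (fun u => f (psi b u))).
  by move=> i; exact: holo_near_sn (hV i).
exact/(snP _ bFx).
Qed.

Lemma pushE F x v f : smooth_near (F x) f -> push F x v f = v (fun y => f (F y)).
Proof. by move=> sf; rewrite /push asboolT. Qed.

Lemma push_out F x v f : ~ smooth_near (F x) f -> push F x v f = 0.
Proof. by move=> sf; rewrite /push asboolF. Qed.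

Lemma push_chart F x v (b : chart N) : holo_at x F -> is_tvec x v -> dom b (F x) ->
  push F x v = \sum_B v (fun y => Zc B (phi b (F y))) *: pd b B (F x).
Proof.
move=> hF tv bFx; apply/funext => f; rewrite sum_tvecE.
have [sf|sf] := pselect (smooth_near (F x) f); last first.
  rewrite push_out // big1 // => B _.
  by rewrite -[LHS]/(_ * pd b B (F x) f) pd_out ?mulr0.
have [V [oV Vx hV]] := holo_at_coord hF bFx.
have NF : \forall y \near x, f (F y) = f (psi b (phi b (F y))).
  have cF := holo_at_cont hF.
  have H : \forall y \near x, dom b (F y) by exact: cF (dom_near bFx).
  by apply: filterS H => y by_; rewrite phiK.
rewrite pushE // (tv_eq tv NF).
rewrite (@tv_comp _ _ _ x v n (fun y => phi b (F y)) (fun u => f (psi b u))) //.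
- by apply: eq_bigr => B _; rewrite -[RHS]/(_ * pd b B (F x) f) pdE // mulrC.
- by move=> i; exact: holo_near_sn (hV i).
- exact/(snP _ bFx).
Qed.

Lemma push_tv F x v : holo_at x F -> is_tvec x v -> is_tvec (F x) (push F x v).
Proof.
move=> hF tv; have [b bFx] := dom_cover (F x).
by rewrite (push_chart hF tv bFx); exact: tv_chart.
Qed.

Lemma push10 F x v : holo_at x F -> type10 x v -> type10 (F x) (push F x v).
Proof.
move=> hF v10; have tv := type10_tv v10; have [b bFx] := dom_cover (F x).
apply: (type10P bFx); first exact: push_tv.
move=> i; have [V [oV Vx hV]] := holo_at_coord hF bFx.
rewrite pushE; last by apply: snJ; exact: sn_zc.
exact: type10_holo v10 oV Vx (hV i).
Qed.

Lemma pushD F x v w : push F x (v + w) = push F x v + push F x w.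
Proof.
apply/funext => f; rewrite -[RHS]/(push F x v f + push F x w f) /push.
by case: asboolP => _ //; rewrite addr0.
Qed.

Lemma pushZ F x (k : C) v : push F x (k *: v) = k *: push F x v.
Proof.
apply/funext => f; rewrite -[RHS]/(k * push F x v f) /push.
by case: asboolP => _ //; rewrite mulr0.
Qed.

Lemma push0 F x : push F x 0 = 0.
Proof. by apply/funext => f; rewrite /push; case: asboolP. Qed.

Lemma pushN F x v : push F x (- v) = - push F x v.
Proof. by rewrite -scaleN1r pushZ scaleN1r. Qed.

Lemma pushB F x v w : push F x (v - w) = push F x v - push F x w.
Proof. by rewrite pushD pushN. Qed.

Lemma push_sum F x (I : Type) (r : seq I) (P : pred I) (w : I -> tvec M) :
  push F x (\sum_(i <- r | P i) w i) = \sum_(i <- r | P i) push F x (w i).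
Proof. by rewrite (big_morph _ (pushD F x) (push0 F x)). Qed.

Lemma push_conjv F x v : push F x (conjv v) = conjv (push F x v).
Proof.
apply/funext => f; rewrite /conjv; have [sf|sf] := pselect (smooth_near (F x) f).
  by rewrite !pushE //; exact: snJ.
by rewrite !push_out ?rmorph0 // snJE.
Qed.

Lemma push_eq F G x v : is_tvec x v -> (\forall y \near x, F y = G y) ->
  push F x v = push G x v.
Proof.
move=> tv FG; apply/funext => f; have FGx := nbhs_singleton FG.
have [sf|sf] := pselect (smooth_near (F x) f).
  rewrite !pushE -?FGx //; apply: (tv_eq tv).
  by apply: filterS FG => y ->.
by rewrite !push_out // -FGx.
Qed.

End Push.

Section PushComp.
Variables (R : realType) (m n p : nat).
Variables (M : cmanifold R m) (N : cmanifold R n) (Q : cmanifold R p).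

Lemma push_comp (F : M -> N) (G : N -> Q) x v : holo_at (F x) G ->
  push G (F x) (push F x v) = push (fun y => G (F y)) x v.
Proof.
move=> hG; apply/funext => f; have [sf|sf] := pselect (smooth_near (G (F x)) f).
  by rewrite !pushE //; exact: sn_holo_at.
by rewrite !push_out.
Qed.

Lemma push_id x (v : tvec M) : is_tvec x v -> push (fun y => y) x v = v.
Proof.
move=> tv; apply/funext => f; have [sf|sf] := pselect (smooth_near x f).
  by rewrite pushE.
by rewrite push_out // (tv_out tv).
Qed.

End PushComp.

(** * Connections and Kähler metrics *)

Section Connections.
Variables (R : realType) (n : nat) (M : cmanifold R n).
Local Notation C := R[i].
Local Notation "'sn'" := (@smooth_near R n M) (at level 0).
Implicit Types (x y p q : M) (f : M -> C) (v w : tvec M) (X Y Z : vfield M).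

Lemma nbhsI (p : M) (P Q : set M) : nbhs p P -> nbhs p Q -> nbhs p (P `&` Q).
Proof. exact: filterI. Qed.

Lemma near_open (p : M) (P : set M) : nbhs p P ->
  exists U : set M, [/\ open U, U p & U `<=` P].
Proof. by rewrite nbhsE => -[U [oU Up] UP]; exists U. Qed.

Lemma svf_open2 p X Y : svf p X -> svf p Y ->
  exists U : set M, [/\ open U, U p, smooth_vf U X & smooth_vf U Y].
Proof.
move=> sX sY; have [U [oU Up UP]] := near_open (nbhsI (svf_near sX) (svf_near sY)).
by exists U; split=> //; apply/(smooth_vfP _ oU) => q /UP[].
Qed.

(* The indicator of U is smooth on U; feeding it to the axioms of a connection
   as the function f shows that the connection is local. *)
Definition ind (U : set M) (q : M) : C := if `[< U q >] then 1 else 0.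

Lemma indT (U : set M) q : U q -> ind U q = 1.
Proof. by move=> Uq; rewrite /ind asboolT. Qed.

Lemma indF (U : set M) q : ~ U q -> ind U q = 0.
Proof. by move=> Uq; rewrite /ind asboolF. Qed.

Lemma ind_smooth (U : set M) : open U -> smooth_fun U (ind U).
Proof.
move=> oU; apply/smooth_funP => // q Uq.
apply: (@sn_eq _ _ _ q (fun=> 1)); last exact: sn_cst.
by apply: filterS (open_nbhs_nbhs (conj oU Uq)) => z /indT ->.
Qed.

Lemma tv_ind (U : set M) q v : open U -> U q -> is_tvec q v -> v (ind U) = 0.
Proof.
move=> oU Uq tv; rewrite -(tv_cst tv 1); apply: (tv_eq tv).
by apply: filterS (open_nbhs_nbhs (conj oU Uq)) => z /indT ->.
Qed.

Variable D : vfield M -> vfield M -> vfield M.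
Hypothesis cD : is_connection (fun v w : tvec M => v + w)
              (fun (k : C) (v : tvec M) => k *: v) (@smooth_vf R n M) D.

Lemma cn_localX (U : set M) X X' Y p : open U -> smooth_vf U X -> smooth_vf U X' ->
  smooth_vf U Y -> (forall q, U q -> X q = X' q) -> U p -> D X Y p = D X' Y p.
Proof.
move=> oU sX sX' sY XX' Up; have si := ind_smooth oU.
have [_ /(_ p Up)[_ e1 _ _]] := cD oU sX sX' sY sY si.
have [_ /(_ p Up)[_ e2 _ _]] := cD oU sX' sX sY sY si.
rewrite (indT Up) scale1r in e1; rewrite (indT Up) scale1r in e2.
(* Cut off by [ind U], the two fields become equal as total functions. *)
rewrite -e1 -e2; congr (D _ _ _); apply/funext => q.
by have [Uq|Uq] := pselect (U q); [rewrite XX'|rewrite !indF // !scale0r].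
Qed.

Lemma cn_localY (U : set M) X Y Y' p : open U -> smooth_vf U X ->
  smooth_vf U Y -> smooth_vf U Y' -> (forall q, U q -> Y q = Y' q) -> U p ->
  D X Y p = D X Y' p.
Proof.
move=> oU sX sY sY' YY' Up; have si := ind_smooth oU.
have tX : is_tvec p (X p) by have [+ _] := sX; exact.
have [_ /(_ p Up)[_ _ _ e1]] := cD oU sX sX sY sY' si.
have [_ /(_ p Up)[_ _ _ e2]] := cD oU sX sX sY' sY si.
rewrite (indT Up) (tv_ind oU Up tX) scale1r scale0r add0r in e1.
rewrite (indT Up) (tv_ind oU Up tX) scale1r scale0r add0r in e2.
rewrite -e1 -e2; congr (D _ _ _); apply/funext => q.
by have [Uq|Uq] := pselect (U q); [rewrite YY'|rewrite !indF // !scale0r].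
Qed.

Lemma cn_eq p X X' Y Y' : svf p X -> svf p Y ->
  (\forall q \near p, X q = X' q) -> (\forall q \near p, Y q = Y' q) ->
  D X Y p = D X' Y' p.
Proof.
move=> sX sY eX eY; have sX' := svf_eq eX sX; have sY' := svf_eq eY sY.
have N := nbhsI (nbhsI (nbhsI (svf_near sX) (svf_near sX'))
  (nbhsI (svf_near sY) (svf_near sY'))) (nbhsI eX eY).
have [U [oU Up UP]] := near_open N.
have S Z : (forall q, U q -> svf q Z) -> smooth_vf U Z by move/(smooth_vfP _ oU).
have uX : smooth_vf U X by apply: S => q /UP[[[]]].
have uX' : smooth_vf U X' by apply: S => q /UP[[[]]].
have uY : smooth_vf U Y by apply: S => q /UP[[_ []]].
have uY' : smooth_vf U Y' by apply: S => q /UP[[_ []]].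
rewrite (cn_localX oU uX uX' uY _ Up); last by move=> q /UP[_ []].
by apply: (cn_localY oU uX' uY uY' _ Up) => q /UP[_ []].
Qed.

Lemma cn_svf p X Y : svf p X -> svf p Y -> svf p (D X Y).
Proof.
move=> sX sY; have [U [oU Up uX uY]] := svf_open2 sX sY.
have [sD _] := cD oU uX uX uY uY (ind_smooth oU).
by move/(smooth_vfP _ oU): sD; exact.
Qed.

Lemma cn_tv p X Y : svf p X -> svf p Y -> is_tvec p (D X Y p).
Proof. by move=> sX sY; apply: svf_tv; exact: cn_svf. Qed.

Lemma cnDl p X X' Y : svf p X -> svf p X' -> svf p Y ->
  D (fun q => X q + X' q) Y p = D X Y p + D X' Y p.
Proof.
move=> sX sX' sY.
have [U [oU Up UP]] :=
  near_open (nbhsI (nbhsI (svf_near sX) (svf_near sX')) (svf_near sY)).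
have uX : smooth_vf U X by apply/(smooth_vfP _ oU) => q /UP[[]].
have uX' : smooth_vf U X' by apply/(smooth_vfP _ oU) => q /UP[[]].
have uY : smooth_vf U Y by apply/(smooth_vfP _ oU) => q /UP[].
by have [_ /(_ p Up)[-> _ _ _]] := cD oU uX uX' uY uY (ind_smooth oU).
Qed.

Lemma cnDr p X Y Y' : svf p X -> svf p Y -> svf p Y' ->
  D X (fun q => Y q + Y' q) p = D X Y p + D X Y' p.
Proof.
move=> sX sY sY'.
have [U [oU Up UP]] :=
  near_open (nbhsI (nbhsI (svf_near sX) (svf_near sY)) (svf_near sY')).
have uX : smooth_vf U X by apply/(smooth_vfP _ oU) => q /UP[[]].
have uY : smooth_vf U Y by apply/(smooth_vfP _ oU) => q /UP[[]].
have uY' : smooth_vf U Y' by apply/(smooth_vfP _ oU) => q /UP[].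
by have [_ /(_ p Up)[_ _ -> _]] := cD oU uX uX uY uY' (ind_smooth oU).
Qed.

Lemma cnZ p f X Y : sn p f -> svf p X -> svf p Y ->
  D (fun q => f q *: X q) Y p = f p *: D X Y p /\
  D X (fun q => f q *: Y q) p = X p f *: Y p + f p *: D X Y p.
Proof.
move=> sf sX sY.
have [U [oU Up UP]] :=
  near_open (nbhsI (nbhsI (svf_near sX) (svf_near sY)) (sn_near sf)).
have uX : smooth_vf U X by apply/(smooth_vfP _ oU) => q /UP[[]].
have uY : smooth_vf U Y by apply/(smooth_vfP _ oU) => q /UP[[]].
have uf : smooth_fun U f by apply/(smooth_funP _ oU) => q /UP[].
by have [_ /(_ p Up)[_ -> _ ->]] := cD oU uX uX uY uY uf.
Qed.

Lemma cn0l p Y : svf p Y -> D (fun=> 0) Y p = 0.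
Proof.
move=> sY; have [E _] := cnZ (sn_cst p 0) (svf0 p) sY.
rewrite [RHS]scale0r in E; apply: etrans E; congr (D _ _ _).
by apply/funext => q; rewrite scale0r.
Qed.

Lemma cn0r p X : svf p X -> D X (fun=> 0) p = 0.
Proof.
move=> sX; have [_ E] := cnZ (sn_cst p 0) sX (svf0 p).
rewrite [in RHS]scaler0 [in RHS]scale0r [RHS]addr0 in E.
apply: etrans E; congr (D _ _ _).
by apply/funext => q; rewrite scaler0.
Qed.

Lemma cn_suml p (I : Type) (r : seq I) (k : I -> M -> C) (F : I -> vfield M) Y :
  (forall i, sn p (k i)) -> (forall i, svf p (F i)) -> svf p Y ->
  D (fun q => \sum_(i <- r) k i q *: F i q) Y p = \sum_(i <- r) k i p *: D (F i) Y p.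
Proof.
move=> sk sF sY; elim: r => [|i r IH].
  rewrite big_nil -[RHS](cn0l sY); congr (D _ _ _).
  by apply/funext => q; rewrite big_nil.
rewrite big_cons -IH; have [<- _] := cnZ (sk i) (sF i) sY; rewrite -cnDl //.
- by congr (D _ _ _); apply/funext => q; rewrite big_cons.
- exact: svfZ.
- by apply: svf_sum => j _; exact: svfZ.
Qed.

Lemma cn_sumr p (I : Type) (r : seq I) (k : I -> M -> C) (F : I -> vfield M) X :
  (forall i, sn p (k i)) -> (forall i, svf p (F i)) -> svf p X ->
  D X (fun q => \sum_(i <- r) k i q *: F i q) p =
  \sum_(i <- r) (X p (k i) *: F i p + k i p *: D X (F i) p).
Proof.
move=> sk sF sX; elim: r => [|i r IH].
  rewrite big_nil -[RHS](cn0r sX); congr (D _ _ _).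
  by apply/funext => q; rewrite big_nil.
rewrite big_cons -IH; have [_ <-] := cnZ (sk i) sX (sF i); rewrite -cnDr //.
- by congr (D _ _ _); apply/funext => q; rewrite big_cons.
- exact: svfZ.
- by apply: svf_sum => j _; exact: svfZ.
Qed.

End Connections.

(** * Koszul's formula *)

Section Koszul.
Variables (R : realType) (n : nat) (M : cmanifold R n).
Local Notation C := R[i].
Local Notation "'sn'" := (@smooth_near R n M) (at level 0).
Implicit Types (x y p q : M) (f : M -> C) (v w : tvec M) (X Y Z : vfield M).
Variable g : tensor2 M.
Hypothesis hb : bilinear_sym g.

Lemma g_sym x v w : is_tvec x v -> is_tvec x w -> g x v w = g x w v.
Proof. by move=> tv tw; have [_] := hb 0 tv tv tw. Qed.

Lemma gDl x v v' w : is_tvec x v -> is_tvec x v' -> is_tvec x w ->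
  g x (v + v') w = g x v w + g x v' w.
Proof. by move=> tv tv' tw; have [+ _] := hb 1 tv tv' tw; rewrite scale1r mul1r. Qed.

Lemma g0l x w : is_tvec x w -> g x 0 w = 0.
Proof.
(* With the coefficient -1 and both vectors 0, linearity reads g(0, w) = - g(0, w) + g(0, w). *)
move=> tw; have [+ _] := hb (-1) (tv0 x) (tv0 x) tw.
by rewrite scaler0 addr0 mulN1r addNr.
Qed.

Lemma gZl x k v w : is_tvec x v -> is_tvec x w -> g x (k *: v) w = k * g x v w.
Proof.
move=> tv tw; have [+ _] := hb k tv (tv0 x) tw.
by rewrite addr0 g0l // addr0.
Qed.

Lemma gBl x v v' w : is_tvec x v -> is_tvec x v' -> is_tvec x w ->
  g x (v - v') w = g x v w - g x v' w.
Proof.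
move=> tv tv' tw; rewrite gDl //; last exact: tvN.
by rewrite -scaleN1r gZl // mulN1r.
Qed.

Lemma gDr x v w w' : is_tvec x v -> is_tvec x w -> is_tvec x w' ->
  g x v (w + w') = g x v w + g x v w'.
Proof.
by move=> tv tw tw'; rewrite g_sym ?gDl // ?(g_sym tv) //; exact: tvD.
Qed.

Lemma gZr x k v w : is_tvec x v -> is_tvec x w -> g x v (k *: w) = k * g x v w.
Proof. by move=> tv tw; rewrite g_sym ?gZl // ?(g_sym tv) //; exact: tvZ. Qed.

Lemma gBr x v w w' : is_tvec x v -> is_tvec x w -> is_tvec x w' ->
  g x v (w - w') = g x v w - g x v w'.
Proof.
by move=> tv tw tw'; rewrite g_sym ?gBl // ?(g_sym tv) //; exact: tvB.
Qed.

Lemma g0r x v : is_tvec x v -> g x v 0 = 0.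
Proof. by move=> tv; rewrite g_sym ?g0l //; exact: tv0. Qed.

Lemma g_suml x (I : Type) (r : seq I) (F : I -> tvec M) w :
  (forall i, is_tvec x (F i)) -> is_tvec x w ->
  g x (\sum_(i <- r) F i) w = \sum_(i <- r) g x (F i) w.
Proof.
move=> tF tw; elim: r => [|i r IH]; first by rewrite !big_nil g0l.
by rewrite !big_cons gDl ?IH //; apply: tv_sum.
Qed.

Lemma g_sumr x (I : Type) (r : seq I) (F : I -> tvec M) w :
  (forall i, is_tvec x (F i)) -> is_tvec x w ->
  g x w (\sum_(i <- r) F i) = \sum_(i <- r) g x w (F i).
Proof.
move=> tF tw; rewrite g_sym ?g_suml //; last by apply: tv_sum.
by apply: eq_bigr => i _; rewrite g_sym.
Qed.

Variable D : vfield M -> vfield M -> vfield M.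
Hypothesis hD : levi_civita g D.
Let cD := lc_conn hD.

(* The commutator of X and Y as operators need not vanish on functions which
   are not smooth, hence is not a tangent vector in the sense of [tvec]. *)
Definition tors X Y : vfield M := fun p => D X Y p - D Y X p.

Lemma tors_tv p X Y : svf p X -> svf p Y -> is_tvec p (tors X Y p).
Proof. by move=> sX sY; apply: tvB; exact: (cn_tv cD). Qed.

Lemma torsE p X Y f : svf p X -> svf p Y -> sn p f ->
  tors X Y p f = X p (fun q => Y q f) - Y p (fun q => X q f).
Proof.
move=> sX sY sf; have [U [oU Up uX uY]] := svf_open2 sX sY.
exact: (lc_torsion hD oU uX uY Up sf).
Qed.

Lemma lcM p X Y Z : svf p X -> svf p Y -> svf p Z ->
  X p (fun q => g q (Y q) (Z q)) = g p (D X Y p) (Z p) + g p (Y p) (D X Z p).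
Proof.
move=> sX sY sZ.
have [U [oU Up UP]] :=
  near_open (nbhsI (nbhsI (svf_near sX) (svf_near sY)) (svf_near sZ)).
have uX : smooth_vf U X by apply/(smooth_vfP _ oU) => q /UP[[]].
have uY : smooth_vf U Y by apply/(smooth_vfP _ oU) => q /UP[[]].
have uZ : smooth_vf U Z by apply/(smooth_vfP _ oU) => q /UP[].
exact: (lc_metric hD oU uX uY uZ Up).
Qed.

Definition koszul X Y Z p : C :=
  X p (fun q => g q (Y q) (Z q)) + Y p (fun q => g q (Z q) (X q))
  - Z p (fun q => g q (X q) (Y q)) + g p (tors X Y p) (Z p)
  - g p (tors Y Z p) (X p) + g p (tors Z X p) (Y p).

(** With [tors] unfolded, this is algebra from metric compatibility and symmetry. Torsion-freeness
    enters only through [torsE], which identifies [tors] with the bracket. *)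
Lemma koszulE p X Y Z : svf p X -> svf p Y -> svf p Z ->
  2%:R * g p (D X Y p) (Z p) = koszul X Y Z p.
Proof.
move=> sX sY sZ; rewrite /koszul !lcM // /tors.
have tX := svf_tv sX; have tY := svf_tv sY; have tZ := svf_tv sZ.
have t1 := cn_tv cD sX sY; have t2 := cn_tv cD sY sX.
have t3 := cn_tv cD sX sZ; have t4 := cn_tv cD sZ sX.
have t5 := cn_tv cD sY sZ; have t6 := cn_tv cD sZ sY.
rewrite !gBl // (g_sym tY t3) (g_sym tZ t2) (g_sym tX t6).
by move: (g p _ _) (g p _ _) (g p _ _) (g p _ _) (g p _ _) (g p _ _) => *; ring.
Qed.

(** A tangent vector is determined by its values on the coordinates, and coordinate fields send
    coordinates to constants. *)
Lemma tors_pd a A B p : dom a p -> tors (pd a A) (pd a B) p = 0.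
Proof.
move=> ap; apply: (tv_eqP ap); [|exact: tv0|].
  by apply: tors_tv; exact: svf_pd.
move=> E; rewrite torsE; [|exact: svf_pd|exact: svf_pd|exact: sn_Zc].
have H A' B' : pd a A' p (fun q => pd a B' q (fun y => Zc E (phi a y))) = 0.
  rewrite -[RHS](tv_cst (tv_pd A' ap) (B' == E)%:R).
  apply: (tv_eq (tv_pd _ ap)).
  by apply: filterS (dom_near ap) => y ay; rewrite pd_Zc.
by rewrite !H subrr.
Qed.

Lemma koszul_pd a A B E p : dom a p ->
  2%:R * g p (D (pd a A) (pd a B) p) (pd a E p) =
  pd a A p (fun q => g q (pd a B q) (pd a E q))
  + pd a B p (fun q => g q (pd a E q) (pd a A q))
  - pd a E p (fun q => g q (pd a A q) (pd a B q)).
Proof.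
move=> ap; rewrite koszulE; [|exact: svf_pd..].
by rewrite /koszul !tors_pd // !g0l ?subr0 ?addr0 //; exact: tv_pd.
Qed.

End Koszul.

(** * The Levi-Civita connection of a Kähler metric *)

Section Kahler.
Variables (R : realType) (n : nat) (M : cmanifold R n).
Local Notation C := R[i].
Local Notation "'sn'" := (@smooth_near R n M) (at level 0).
Implicit Types (x y p q : M) (f : M -> C) (v w : tvec M) (X Y Z : vfield M).
Variable g : tensor2 M.
Hypothesis kg : pseudo_kahler g.
Let hb := pk_bilin kg.

Lemma g_conj x v w : is_tvec x v -> is_tvec x w ->
  g x (conjv v) (conjv w) = conjc (g x v w).
Proof. exact: pk_real. Qed.

Lemma g_1010 x v w : type10 x v -> type10 x w -> g x v w = 0.
Proof. exact: pk_herm. Qed.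

Lemma g_0101 x v w : type01 x v -> type01 x w -> g x v w = 0.
Proof.
move=> v01 w01; have tv := type01_tv v01; have tw := type01_tv w01.
by rewrite -[LHS]conjcK -g_conj // g_1010 // conjc0.
Qed.

Lemma sn_g x X Y : svf x X -> svf x Y -> sn x (fun y => g y (X y) (Y y)).
Proof.
move=> sX sY; have [U [oU Ux uX uY]] := svf_open2 sX sY.
by exists U; split=> //; exact: (pk_smooth kg).
Qed.

Lemma g_eq_fields p v w : is_tvec p v -> is_tvec p w ->
  (forall Z, svf p Z -> g p v (Z p) = g p w (Z p)) -> v = w.
Proof.
move=> tv tw H; apply/eqP; rewrite -subr_eq0; apply/eqP.
apply: (pk_nondeg kg (tvB tv tw)) => u tu; have [a ap] := dom_cover p.
have := H _ (svf_vext u ap); rewrite vextE // => e.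
by rewrite (gBl hb) // e subrr.
Qed.

(** The (0,1) part of v is orthogonal to (0,1) vectors by type and to (1,0) vectors by hypothesis,
    hence 0 by nondegeneracy. *)
Lemma type10_orth a x v : dom a x -> is_tvec x v ->
  (forall k, g x v (pd a (inl k) x) = 0) -> type10 x v.
Proof.
move=> ax tv H; set v1 := prj10 x v.
have v10 : type10 x v1 by exact: type10_prj.
have v01 : type01 x (v - v1) by exact: type01_prj.
have tv1 := type10_tv v10.
suff -> : v = v1 by [].
apply/eqP; rewrite -subr_eq0; apply/eqP; apply: (pk_nondeg kg (type01_tv v01)).
move=> w tw; have w10 := type10_prj x w; have w01 := type01_prj tw.
have -> : w = prj10 x w + (w - prj10 x w) by rewrite addrC subrK.
rewrite (gDr hb (type01_tv v01) (type10_tv w10) (type01_tv w01)).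
rewrite (g_0101 v01 w01) addr0 (gBl hb tv tv1 (type10_tv w10)) (g_1010 v10 w10).
rewrite subr0 (type10E ax w10) (g_sumr hb) //.
  rewrite big1 // => k _; rewrite (gZr hb) ?H ?mulr0 //; exact: tv_pd.
by move=> k; apply: tvZ; exact: tv_pd.
Qed.

Variable D : vfield M -> vfield M -> vfield M.
Hypothesis hD : levi_civita g D.
Let cD := lc_conn hD.
Let G a A B : M -> C := fun y => g y (pd a A y) (pd a B y).

Lemma G_sym a A B E p : dom a p -> pd a E p (G a A B) = pd a E p (G a B A).
Proof.
move=> ap; apply: (tv_eq (tv_pd _ ap)).
apply: filterS (dom_near ap) => y ay.
by rewrite /G (g_sym hb) //; exact: tv_pd.
Qed.

Lemma G_1010 a i j E p : dom a p -> pd a E p (G a (inl i) (inl j)) = 0.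
Proof.
move=> ap; rewrite -(tv_cst (tv_pd E ap) 0); apply: (tv_eq (tv_pd _ ap)).
apply: filterS (dom_near ap) => y ay.
by apply: g_1010; exact: type10_pd.
Qed.

Lemma G_0101 a i j E p : dom a p -> pd a E p (G a (inr i) (inr j)) = 0.
Proof.
move=> ap; rewrite -(tv_cst (tv_pd E ap) 0); apply: (tv_eq (tv_pd _ ap)).
apply: filterS (dom_near ap) => y ay.
by apply: g_0101; exact: type01_pd.
Qed.

Lemma iC_neq0 : iC R != 0.
Proof. by rewrite eq_complex /= eqxx oner_eq0. Qed.

Lemma fund_formE a A B E p : dom a p -> pd a E p (fund_form g a A B) =
  (if A is inl _ then iC R else - iC R) * pd a E p (G a A B).
Proof. by move=> ap; exact: (tv_scale (tv_pd E ap) _ (G a A B)). Qed.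

Lemma add3_eq (x y z x' y' z' : C) : x + y + z = 0 ->
  x = x' -> y = y' -> z = z' -> x' + y' + z' = 0.
Proof. by move=> + <- <- <-. Qed.

(** Closedness of the fundamental form on two unbarred indices and a barred one: the term with g_ij
    vanishes, and the factors i and - i attached to the two types turn the remaining sum into a
    difference. *)
Lemma G_closed1 a i j k p : dom a p ->
  pd a (inl i) p (G a (inl j) (inr k)) = pd a (inl j) p (G a (inl i) (inr k)).
Proof.
move=> ap; have := add3_eq (pk_closed kg (inl i) (inl j) (inr k) ap)
  (fund_formE _ _ _ ap) (fund_formE _ _ _ ap) (fund_formE _ _ _ ap).
rewrite (G_1010 i j _ ap) mulr0 addr0.
rewrite (G_sym (inr k) (inl i) _ ap) mulNr => /eqP; rewrite subr_eq0 => /eqP.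
exact: (mulfI iC_neq0).
Qed.

Lemma G_closed2 a i j k p : dom a p ->
  pd a (inr i) p (G a (inr j) (inl k)) = pd a (inr j) p (G a (inr i) (inl k)).
Proof.
move=> ap; have := add3_eq (pk_closed kg (inr i) (inr j) (inl k) ap)
  (fund_formE _ _ _ ap) (fund_formE _ _ _ ap) (fund_formE _ _ _ ap).
rewrite (G_0101 i j _ ap) mulr0 addr0.
rewrite (G_sym (inl k) (inr i) _ ap) mulNr addrC => /eqP; rewrite subr_eq0 => /eqP e.
exact: esym (mulfI iC_neq0 e).
Qed.

Lemma koszul_G a A B E p : dom a p ->
  2%:R * g p (D (pd a A) (pd a B) p) (pd a E p) =
  pd a A p (G a B E) + pd a B p (G a E A) - pd a E p (G a A B).
Proof. exact: (koszul_pd hb hD). Qed.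

(** By [type10_orth] the Koszul expression against d_k must vanish. If A is unbarred, each term
    differentiates some g_ij = 0; if A is barred, the two surviving terms cancel by [G_closed1]. *)
Lemma D_pd_10 a A j p : dom a p -> type10 p (D (pd a A) (pd a (inl j)) p).
Proof.
move=> ap; have sp B : svf p (pd a B) by exact: svf_pd.
apply: (type10_orth ap); first exact: (cn_tv cD).
move=> k; apply: (mulfI (two_neq0 R)); rewrite mulr0 koszul_G //.
case: A => i; first by rewrite !G_1010 // !addr0 subr0.
rewrite G_1010 // add0r (G_closed1 j k i ap) (G_sym (inl j) (inr i) _ ap).
exact: subrr.
Qed.

(** The vector is of type (1,0), so only its pairings with barred coordinate vectors matter; these
    cancel by [G_closed2]. *)
Lemma D_pdbar a i j p : dom a p -> D (pd a (inr i)) (pd a (inl j)) p = 0.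
Proof.
move=> ap; have sp B : svf p (pd a B) by exact: svf_pd.
have v10 := D_pd_10 (inr i) j ap; set v := D _ _ p in v10 *.
apply: (pk_nondeg kg (type10_tv v10)) => w tw.
rewrite (tvE ap tw) big_sumType (gDr hb (type10_tv v10)); last 2 first.
- by apply: tv_sum => k _; apply: tvZ; exact: tv_pd.
- by apply: tv_sum => k _; apply: tvZ; exact: tv_pd.
rewrite g_1010 //; last first.
  by apply: type10_sum => k _; apply: type10Z; exact: type10_pd.
rewrite add0r (g_sumr hb) //; [|by move=> k; apply: tvZ; exact: tv_pd|exact: type10_tv].
rewrite big1 // => k _; rewrite (gZr hb _ (type10_tv v10) (tv_pd _ ap)).
suff -> : g p v (pd a (inr k) p) = 0 by rewrite mulr0.
apply: (mulfI (two_neq0 R)); rewrite mulr0 /v koszul_G // G_0101 // addr0.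
by rewrite (G_sym (inl j) (inr k) _ ap) (G_closed2 i k j ap) subrr.
Qed.

Lemma D_expandl a X Y p : dom a p -> svf p X -> svf p Y ->
  D X Y p = \sum_A X p (fun y => Zc A (phi a y)) *: D (pd a A) Y p.
Proof.
move=> ap sX sY.
rewrite -(cn_suml cD _ (fun A => svf_coord_sn A ap sX) (fun A => svf_pd A ap) sY).
apply: (cn_eq cD sX sY) => //; first exact: svf_coord.
exact: filterS filterT.
Qed.

Lemma tf10_coord a Y p : dom a p -> tf10 p Y ->
  \forall y \near p, Y y = \sum_i Y y (fun z => zc i (phi a z)) *: pd a (inl i) y.
Proof.
move=> ap tY; apply: filterS (filterI tY (dom_near ap)) => y [Yy ay].
exact: type10E.
Qed.

Lemma D_expandr a X Y p : dom a p -> svf p X -> svf p Y -> tf10 p Y ->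
  D X Y p = \sum_i (X p (fun y => Y y (fun z => zc i (phi a z))) *: pd a (inl i) p +
                    Y p (fun z => zc i (phi a z)) *: D X (pd a (inl i)) p).
Proof.
move=> ap sX sY tY.
rewrite -(cn_sumr cD _ (fun i => svf_coord_sn (inl i) ap sY)
   (fun i => svf_pd (inl i) ap) sX).
apply: (cn_eq cD sX sY) => //; first exact: filterS filterT.
exact: tf10_coord.
Qed.

(** Parallelism of the complex structure: in the frame d_i, differentiating coefficients preserves
    the type, and [D_pd_10] treats the frame itself. *)
Lemma D_10 X Y p : svf p X -> svf p Y -> tf10 p Y -> type10 p (D X Y p).
Proof.
move=> sX sY tY; have [a ap] := dom_cover p; rewrite (D_expandr ap sX sY tY).
apply: type10_sum => i _; apply: type10D; apply: type10Z; first exact: type10_pd.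
rewrite (D_expandl ap sX (svf_pd _ ap)); apply: type10_sum => A _; apply: type10Z.
exact: D_pd_10.
Qed.

(** The (0,1) part of the Levi-Civita connection is the dbar operator, since the mixed derivatives
    of the coordinate frame vanish by [D_pdbar]. *)
Lemma D_bar_holo a X Y p : dom a p -> svf p X -> svf p Y -> tf10 p Y ->
  type01 p (X p) -> (forall i, X p (fun y => Y y (fun z => zc i (phi a z))) = 0) ->
  D X Y p = 0.
Proof.
move=> ap sX sY tY X01 XY; rewrite (D_expandr ap sX sY tY) big1 // => i _.
rewrite XY scale0r add0r (D_expandl ap sX (svf_pd _ ap)) big_sumType /=.
rewrite !big1 ?addr0 ?scaler0 // => k _; first by rewrite D_pdbar // scaler0.
by rewrite (type01_zc k ap X01) scale0r.
Qed.

Lemma tors_conj X Y p : svf p X -> svf p Y ->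
  tors D (fun q => conjv (X q)) (fun q => conjv (Y q)) p = conjv (tors D X Y p).
Proof.
move=> sX sY; have sX' := svfJ sX; have sY' := svfJ sY.
apply: (@tv_ext _ _ _ p); [exact: (tors_tv hD)|by apply: tvJ; exact: (tors_tv hD)|].
move=> f sf; rewrite (torsE hD) // [RHS]/conjv (torsE hD) //; last exact: snJ.
by rewrite rmorphB /= -!conjvE.
Qed.

Lemma koszul_conj X Y Z p : svf p X -> svf p Y -> svf p Z ->
  koszul g D (fun q => conjv (X q)) (fun q => conjv (Y q)) (fun q => conjv (Z q)) p =
  conjc (koszul g D X Y Z p).
Proof.
move=> sX sY sZ; rewrite /koszul !tors_conj //.
have tX := svf_tv sX; have tY := svf_tv sY; have tZ := svf_tv sZ.
rewrite !g_conj //; [|exact: (tors_tv hD)..].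
have H X' Y' Z' : svf p X' -> svf p Y' -> svf p Z' ->
    conjv (X' p) (fun q => g q (conjv (Y' q)) (conjv (Z' q))) =
    conjc (X' p (fun q => g q (Y' q) (Z' q))).
  move=> s1 s2 s3; rewrite -conjvE; apply: (tv_eq (tvJ (svf_tv s1))).
  by apply: filterS (filterI s2 s3) => q [[t2 _] [t3 _]]; rewrite g_conj.
rewrite (H X Y Z) // (H Y Z X) // (H Z X Y) //.
by rewrite rmorphD rmorphB rmorphD rmorphB rmorphD.
Qed.

(** Reality of D is not an axiom of [levi_civita]; it holds because Koszul's formula expresses D by
    g and brackets, which commute with conjugation. *)
Lemma D_conj X Y p : svf p X -> svf p Y ->
  D (fun q => conjv (X q)) (fun q => conjv (Y q)) p = conjv (D X Y p).
Proof.
move=> sX sY; have sX' := svfJ sX; have sY' := svfJ sY.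
apply: (@g_eq_fields p); [exact: (cn_tv cD)|by apply: tvJ; exact: (cn_tv cD)|].
move=> Z sZ; apply: (mulfI (two_neq0 R)); rewrite (koszulE hb hD) //.
have -> : Z = (fun q => conjv (conjv (Z q))) by apply/funext => q; rewrite conjvK.
have sZ' := svfJ sZ; rewrite koszul_conj // -(koszulE hb hD) //.
rewrite g_conj ?rmorphM ?rmorph_nat //; first exact: (cn_tv cD).
exact: svf_tv sZ'.
Qed.

End Kahler.

#[local] Arguments wirt : simpl never.

(** * The action and the fundamental vector field *)

Section Slices.
Variable R : realType.
Local Notation C := R[i].
Variables (V W : normedModType R) (l : {linear V -> W}) (c : W).
Hypothesis cl : continuous l.

Lemma derive_affine (f : W -> R) u v : differentiable f (l u + c) ->
  differentiable (fun z => f (l z + c)) u /\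
  'D_v (fun z => f (l z + c)) u = 'D_(l v) f (l u + c).
Proof.
set G := fun v => l v + c => df.
have dl : differentiable l u by exact: linear_differentiable.
have dG : differentiable G u.
  exact: (@differentiableD _ _ _ l (cst c) u dl (differentiable_cst _ _)).
have DG : 'd G u = l :> (V -> W).
  have dc : differentiable (cst c : V -> W) u by exact: differentiable_cst.
  rewrite -[G]/((l : V -> W) + cst c) (diffD dl dc) diff_lin //.
  by rewrite diff_cst; apply/funext => w; rewrite -[LHS]/(_ + 0) addr0.
have dfG : differentiable (f \o G) u by exact: differentiable_comp.
split=> //; rewrite (deriveE _ df) -[fun w => f (l w + c)]/(f \o G) (deriveE _ dfG).
by rewrite (diff_comp dG df) /comp DG.
Qed.

Lemma csmooth_affine (U : set W) (f : W -> C) (U' : set V) :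
  open U' -> (forall v, U' v -> U (l v + c)) -> csmooth U f ->
  csmooth U' (fun v => f (l v + c)).
Proof.
move=> oU' sU sf k; have [f1 f2] := sf k; clear sf.
have H (h : W -> R) : ndiff k U h -> ndiff k U' (fun v => h (l v + c)).
  elim: k h {f1 f2} => // k IH h [dh dvh]; split => [u Uu|v].
    by have [] := derive_affine u (dh _ (sU _ Uu)).
  apply: (ndiff_open_eq oU' _ (IH _ (dvh (l v)))) => u Uu.
  by have [_ ->] := derive_affine v (dh _ (sU _ Uu)).
by split; [exact: (H (fun w => complex.Re (f w)))|exact: (H (fun w => complex.Im (f w)))].
Qed.

Lemma cderiv_affine (f : W -> C) u v : cdif f (l u + c) ->
  cderiv v (fun z => f (l z + c)) u = cderiv (l v) f (l u + c).
Proof.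
move=> [f1 f2]; apply: complex_eqP => /=.
  by have [_ ->] := derive_affine v f1.
by have [_ ->] := derive_affine v f2.
Qed.

(** Restricts the jointly holomorphic action to slices with b or x fixed, which are affine maps into
    the product. *)
Lemma holo_affine (J : V -> V) (J' : W -> W) (U : set W) (f : W -> C) (U' : set V) :
  open U' -> (forall v, U' v -> U (l v + c)) -> (forall v, l (J v) = J' (l v)) ->
  holo J' U f -> holo J U' (fun v => f (l v + c)).
Proof.
move=> oU' sU lJ [sf hf]; split; first exact: csmooth_affine sf.
move=> u v Uu; have df := csmooth_cdif sf (sU _ Uu).
by rewrite !cderiv_affine // lJ hf //; exact: sU.
Qed.

End Slices.

Section Inj.
Variables (R : realType) (V W : normedModType R).

Definition injl (v : V) : V * W := (v, 0).
Definition injr (w : W) : V * W := (0, w).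

Lemma injl_linear : linear injl.
Proof. by move=> a u v; rewrite /injl -[RHS]/(_ , _) /= scaler0 addr0. Qed.
Lemma injr_linear : linear injr.
Proof. by move=> a u v; rewrite /injr -[RHS]/(_ , _) /= scaler0 addr0. Qed.

HB.instance Definition _ :=
  GRing.isLinear.Build R V (V * W)%type *:%R injl injl_linear.
HB.instance Definition _ :=
  GRing.isLinear.Build R W (V * W)%type *:%R injr injr_linear.

Lemma injl_continuous : continuous injl.
Proof. by move=> v; apply: cvg_pair; [exact: cvg_id|exact: cvg_cst]. Qed.
Lemma injr_continuous : continuous injr.
Proof. by move=> v; apply: cvg_pair; [exact: cvg_cst|exact: cvg_id]. Qed.

End Inj.

Section Action.
Variables (R : realType) (n : nat) (P : proj_kahler R n).
Local Notation C := R[i].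
Local Notation tM := (tot P).

Definition ofC (z : C) : E R 1 := (const_mx (complex.Re z), const_mx (complex.Im z)).

Lemma ofCK z : toC (ofC z) = z.
Proof. by rewrite /toC /zc /= !mxE; case: z. Qed.

Lemma toCK (b : E R 1) : ofC (toC b) = b.
Proof.
case: b => b1 b2; rewrite /ofC /toC /zc /=.
have H (m : 'rV[R]_1) : const_mx (m ord0 ord0) = m.
  by apply/rowP => j; rewrite mxE [j]ord1.
by rewrite !H.
Qed.

Lemma toC_one : toC (oneE R) = 1.
Proof. by rewrite /toC /zc /= !mxE. Qed.

Lemma act_for (b : E R 1) (x : tM) : toC b != 0 ->
  {for x, continuous (act (toC b))} /\
  {for b, continuous (fun b : E R 1 => act (toC b) x)}.
Proof.
move=> b0; have H : {for (b, x), continuous (fun q : E R 1 * tM => act (toC q.1) q.2)}.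
  exact: act_cont.
split.
  have F : (fun y : tM => (b, y)) @ x --> (b, x).
    exact: (@cvg_pair _ _ _ (nbhs x) (nbhs b) (nbhs x) _ _ _ (fun=> b) (fun y => y)
      (cvg_cst b) cvg_id).
  exact: (cvg_comp _ _ F H).
have F : (fun b' : E R 1 => (b', x)) @ b --> (b, x).
  exact: (@cvg_pair _ _ _ (nbhs b) (nbhs b) (nbhs x) _ _ _ (fun y => y) (fun=> x)
    cvg_id (cvg_cst x)).
exact: (cvg_comp _ _ F H).
Qed.

Lemma act_continuous (b : C) (x : tM) : b != 0 -> {for x, continuous (act b)}.
Proof. by move=> b0; have := @act_for (ofC b) x; rewrite ofCK => /(_ b0)[]. Qed.

Lemma holo_map_act (b : C) : b != 0 -> holo_map setT (@act R n P b).
Proof.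
move=> b0; split; first by move=> x _; exact: act_continuous.
move=> a' i a; set U := setT `&` _; have oU : open U.
  rewrite /U setTI openE => x ax; exact: (act_continuous b0) (dom_near ax).
have oW : open (phi a @` (U `&` dom a)) by exact: open_phi.
have Ei (u : E R n.+1) : injr (E R 1) u + (ofC b, 0) = (ofC b, u).
  by rewrite -[LHS]/(_, _) /= add0r addr0.
have := @holo_affine R (E R n.+1) (E R 1 * E R n.+1)%type
  (@injr R (E R 1) (E R n.+1)) (ofC b, 0) (@injr_continuous _ _ _)
  (@JE R n.+1) _ _ _ _ oW _ _ (act_holo a a' i).
set h := (h in _ -> _ -> holo _ _ h).
have -> : h = (fun u => zc i (phi a' (act b (psi a u)))).
  by apply/funext => u; rewrite /h Ei ofCK.
apply.
  move=> u [x [[_ Ux] ax] <-]; rewrite Ei; split; rewrite /= ?ofCK ?phiK //.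
  by exists x.
by move=> v; rewrite /injr /JE /= oppr0.
Qed.

Lemma holo_at_act (b : C) (x : tM) : b != 0 -> holo_at x (@act R n P b).
Proof. by move=> b0; exists setT; split=> //; [exact: openT|exact: holo_map_act]. Qed.

Lemma holo_at_proj (x : tM) : holo_at x (@Defs.proj R n P).
Proof. by exists setT; split=> //; [exact: openT|exact: proj_holo]. Qed.

Lemma near_neq0 (b : E R 1) : toC b != 0 -> \forall b' \near b, toC b' != 0.
Proof. by move=> b0; apply: (csn_neq0 (csn_zc ord0 b)). Qed.

Lemma orbit_holo (x : tM) (b : E R 1) (a : chart tM) : toC b != 0 ->
  dom a (act (toC b) x) -> exists W : set (E R 1), [/\ open W, W b &
    forall i, holo (@JE R 1) W (fun b' => zc i (phi a (act (toC b') x)))].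
Proof.
move=> b0 ab; have [a' a'x] := dom_cover x.
pose W := [set b' : E R 1 | toC b' != 0 /\ dom a (act (toC b') x)].
have oW : open W.
  rewrite openE => b' [b'0 ab']; apply: filterI; first exact: near_neq0.
  have [_ cb'] := act_for x b'0; exact: cb' _ (dom_near ab').
exists W; split=> // i.
have Ei (b' : E R 1) : injl (E R n.+1) b' + (0, phi a' x) = (b', phi a' x).
  by rewrite -[LHS]/(_, _) /= add0r addr0.
have := @holo_affine R (E R 1) (E R 1 * E R n.+1)%type
  (@injl R (E R 1) (E R n.+1)) (0, phi a' x) (@injl_continuous _ _ _)
  (@JE R 1) _ _ _ _ oW _ _ (act_holo a' a i).
set h := (h in _ -> _ -> holo _ _ h).
have -> : h = (fun b' => zc i (phi a (act (toC b') x))).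
  by apply/funext => u; rewrite /h Ei phiK.
apply.
  by move=> u [u0 au]; rewrite Ei; split; rewrite /= ?phiK //; exists x.
by move=> v; rewrite /injl /JE /= oppr0.
Qed.

Lemma act_neq0 (b : E R 1) (x : tM) f : toC b != 0 ->
  smooth_near (act (toC b) x) f -> csn b (fun b' => f (act (toC b') x)).
Proof.
move=> b0 sf; have [a ab] := dom_cover (act (toC b) x).
have [W [oW Wb hW]] := orbit_holo b0 ab.
have N : \forall b' \near b, f (psi a (phi a (act (toC b') x))) = f (act (toC b') x).
  have [_ cb] := act_for x b0.
  have H : \forall b' \near b, dom a (act (toC b') x) by exact: cb _ (dom_near ab).
  by apply: filterS H => b' ab'; rewrite phiK.
apply: (csn_eq N).
apply: (@csn_comp _ _ _ (fun b' => phi a (act (toC b') x)) (fun u => f (psi a u))).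
  by move=> i; have [sh _] := hW i; exact: csn_open sh Wb.
exact/(snP _ ab).
Qed.

(** [fundE] normalizes H on holomorphic functions only. By the chain rule both sides are of type
    (1,0), since the orbit map is holomorphic, so their values on holomorphic coordinates decide. *)
Lemma fund_smoothE (x : tM) f : smooth_near x f ->
  fund x f = (Defs.cst P)%:C%C * wirt (inl ord0) (fun b : E R 1 => f (act (toC b) x)) (oneE R).
Proof.
move=> sf; have [a ax] := dom_cover x.
have one0 : toC (oneE R) != 0 by rewrite toC_one oner_eq0.
have a1 : dom a (act (toC (oneE R)) x) by rewrite toC_one act1.
have [W [oW W1 hW]] := orbit_holo one0 a1.
have [[_ f10] _] := fund_holo P.
have N : \forall b' \near (oneE R),
    f (act (toC b') x) = f (psi a (phi a (act (toC b') x))).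
  have [_ cb] := act_for x one0.
  have H : \forall b' \near oneE R, dom a (act (toC b') x) by exact: cb _ (dom_near a1).
  by apply: filterS H => b' ab'; rewrite phiK.
have sz i : csn (oneE R) (fun b' => zc i (phi a (act (toC b') x))).
  by have [sh _] := hW i; exact: csn_open sh W1.
rewrite (wirt_eq _ N) (@wirt_comp _ _ _ (fun b' => phi a (act (toC b') x))
  (fun u => f (psi a u))); last 2 first.
- by move=> i; exact: csn_cdif.
- by apply: csn_cdif; apply/(snP _ a1); rewrite toC_one act1.
have Z i : wirt (inl ord0) (fun b' : E R 1 => Zc (inr i) (phi a (act (toC b') x)))
    (oneE R) = 0.
  rewrite (@wirtJ _ _ (inl ord0) (fun b' => zc i (phi a (act (toC b') x)))).
    by rewrite (holo_wirt ord0 (hW i) W1) rmorph0.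
  exact: csn_cdif.
rewrite big_sumType /= [X in _ + X]big1 ?addr0; last by move=> i _; rewrite Z mulr0.
rewrite [in LHS](type10E ax (f10 x I)) sum_tvecE mulr_sumr.
apply: eq_bigr => i _; rewrite -[LHS]/(_ * pd a (inl i) x f) pdE // fundE.
  by rewrite toC_one act1 -mulrA [X in _ * X = _]mulrC.
exists (dom a); split=> //; first exact: dom_open.
exact: holo_chart.
Qed.

End Action.

(** * The Kähler potential *)

Section Potential.
Variables (R : realType) (n : nat) (P : proj_kahler R n).
Local Notation C := R[i].
Local Notation tM := (tot P).
Local Notation H := (@fund R n P).
Local Notation G := (@tmet R n P).
Local Notation cc := ((Defs.cst P)%:C%C).
Local Notation tD := (@tD R n P).
Local Notation sn := (@smooth_near R n.+1 (tot P)).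
Implicit Types (x p : tM) (f : tM -> C) (v w : tvec tM) (X Y : vfield tM).

Let kt := tmet_kahler P.
Let lt := tD_lc P.
Let hb := pk_bilin kt.
Let cD := lc_conn lt.

Lemma cc_neq0 : cc != 0.
Proof. by rewrite eq_complex /= eqxx andbT cst_neq0. Qed.

Lemma conjc_cc : conjc cc = cc.
Proof. by rewrite conjc_real. Qed.

Lemma svf_fund x : svf x H.
Proof.
by have [[sf _] _] := fund_holo P; move/(smooth_vfP _ (@openT tM)): sf; exact.
Qed.

Lemma fund10 x : type10 x (H x).
Proof. by have [[_ f10] _] := fund_holo P; exact: f10. Qed.

Lemma tf10_fund x : tf10 x H.
Proof. by apply: filterS filterT => y _; exact: fund10. Qed.

Definition fundbar : vfield tM := fun x => conjv (H x).

Lemma svf_fundbar x : svf x fundbar.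
Proof. exact: svfJ (svf_fund x). Qed.

Lemma fundbar01 x : type01 x (fundbar x).
Proof. by apply: type01J; exact: fund10. Qed.

Definition Nf x : C := G x (H x) (fundbar x).

Lemma Nf_neq0 x : Nf x != 0.
Proof. exact: fund_neq0. Qed.

Lemma D_fund p X : svf p X -> tf10 p X -> tD X H p = cc *: X p.
Proof.
move=> sX tX; have [U [oU Up UP]] := near_open (nbhsI (svf_near sX) tX).
apply: (tD_fund (U := U)) => //; apply/(smooth_vf10P _ oU) => q /UP[sq tq].
by split.
Qed.

(** H is a holomorphic field, so (0,1) vectors annihilate its components and [D_bar_holo]
    applies. *)
Lemma D_bar_fund p X : svf p X -> type01 p (X p) -> tD X H p = 0.
Proof.
move=> sX X01; have [a ap] := dom_cover p.
apply: (D_bar_holo kt lt ap sX (svf_fund p) (tf10_fund p) X01) => i.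
have hz : holo_fun (dom a) (fun y => H y (fun z => zc i (phi a z))).
  have [_ hf] := fund_holo P; apply: hf => //; first exact: dom_open.
  exact: holo_chart.
have := type10_holo X01 (dom_open a) ap hz.
by rewrite conjvE => /eqP; rewrite conjc_eq0 => /eqP.
Qed.

Lemma D_fundbar10 p X : svf p X -> type10 p (X p) -> tD X fundbar p = 0.
Proof.
move=> sX X10; have -> : X = (fun q => conjv (conjv (X q))).
  by apply/funext => q; rewrite conjvK.
rewrite (D_conj kt lt (svfJ sX) (svf_fund p)) D_bar_fund ?conjv0 //.
  exact: svfJ.
exact: type01J.
Qed.

Lemma D_fundbar01 p X : svf p X -> (\forall q \near p, type01 q (X q)) ->
  tD X fundbar p = cc *: X p.
Proof.
move=> sX X01; have -> : X = (fun q => conjv (conjv (X q))).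
  by apply/funext => q; rewrite conjvK.
rewrite (D_conj kt lt (svfJ sX) (svf_fund p)) D_fund //; last exact: svfJ.
by rewrite conjvZ conjc_cc.
Qed.

Lemma D_fundbar p X : svf p X -> tD X fundbar p = cc *: (X p - prj10 p (X p)).
Proof.
move=> sX; pose X1 := fun q => prj10 q (X q); pose X2 := fun q => X q - prj10 q (X q).
have s1 : svf p X1 by exact: svf_prj10.
have s2 : svf p X2 by exact: svfB.
have e : X = (fun q => X1 q + X2 q).
  by apply/funext => q; rewrite /X1 /X2 addrC subrK.
rewrite [in LHS]e (cnDl cD s1 s2 (svf_fundbar p)) D_fundbar10 //; last exact: type10_prj.
rewrite add0r D_fundbar01 //.
by apply: filterS sX => q [tX _]; exact: type01_prj.
Qed.

Lemma sn_Nf x : sn x Nf.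
Proof. exact: (sn_g kt (svf_fund x) (svf_fundbar x)). Qed.

Lemma fund_tv x : is_tvec x (H x).
Proof. exact: type10_tv (fund10 x). Qed.

Lemma fundbar_tv x : is_tvec x (fundbar x).
Proof. exact: tvJ (fund_tv x). Qed.

Lemma conjc_Nf x : conjc (Nf x) = Nf x.
Proof.
rewrite /Nf -(g_conj kt (fund_tv x) (fundbar_tv x)) /fundbar conjvK.
by rewrite (g_sym hb) //; [exact: fundbar_tv|exact: fund_tv].
Qed.

(** Metric compatibility: D_v H = c v, and D_v conj H vanishes because v is of type (1,0). *)
Lemma tv_Nf x v : type10 x v -> v Nf = cc * G x v (fundbar x).
Proof.
move=> v10; have tv := type10_tv v10; have [a ax] := dom_cover x.
have sX := svf_vext v ax; have e := vextE ax tv.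
have tX : tf10 x (vext a v).
  by apply: filterS (dom_near ax) => y ay; exact: (vext10 ax).
have := lcM lt sX (svf_fund x) (svf_fundbar x).
rewrite e => ->; rewrite D_fund // D_fundbar10 ?e //.
by rewrite (gZl hb) // ?(g0r hb) ?addr0 //; [exact: fund_tv|exact: fundbar_tv].
Qed.

Lemma fund_Nf x : H x Nf = cc * Nf x.
Proof. exact: tv_Nf (fund10 x). Qed.

Lemma wirtV m A (h : E R m -> C) u : csn u h -> h u != 0 ->
  wirt A (fun z => (h z)^-1) u = - wirt A h u / (h u) ^+ 2.
Proof.
move=> sh h0; have sV := csnV sh h0.
have N : \forall z \near u, h z * (h z)^-1 = 1.
  by apply: filterS (csn_neq0 sh h0) => y y0; rewrite divff.
have := wirt_eq A N; rewrite wirtM ?wirt_cst; [|exact: csn_cdif..].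
move/eqP; rewrite addr_eq0 => /eqP e.
rewrite -[LHS]mul1r -(mulVf h0) -mulrA -[h u * _]opprK -e expr2 invfM.
by move: (wirt A h u) (h u)^-1 => *; ring.
Qed.

(* The scaling law for N only follows from the infinitesimal data: this
   quotient has vanishing derivatives, hence is constant on the half plane
   Re b > 0; every b in C^* is a product of elements of it. *)
Definition hquot x (b : E R 1) : C :=
  Nf (act (toC b) x) * ((toC b)^-1 * (conjc (toC b))^-1).

Lemma csn_hquot x b : toC b != 0 -> csn b (hquot x).
Proof.
move=> b0; apply: csnM; first by apply: act_neq0 => //; exact: sn_Nf.
by apply: csnM; apply: csnV; rewrite ?conjc_eq0 //; try apply: csnJ; exact: csn_zc.
Qed.

Lemma hquot_real x b : conjc (hquot x b) = hquot x b.
Proof.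
by rewrite /hquot !rmorphM /= conjc_Nf !conjc_inv conjcK [X in _ * X = _]mulrC.
Qed.

Lemma wirt_orbit x (b : E R 1) f : toC b != 0 -> sn (act (toC b) x) f ->
  cc * wirt (inl ord0) (fun b' : E R 1 => f (act (toC b') x)) b =
  (toC b)^-1 * H (act (toC b) x) f.
Proof.
move=> b0 sf; set y := act (toC b) x; set be := (toC b)^-1.
(* m(b') = b' / b moves the base point of the derivative to 1, where [fund_smoothE] applies; m is
   holomorphic with derivative 1 / b. *)
pose m (b' : E R 1) : E R 1 := ofC (toC b' * be).
have mb : m b = oneE R by rewrite /m /be divff // -toC_one toCK.
have N : \forall b' \near b, f (act (toC b') x) = f (act (toC (m b')) y).
  apply: filterS (near_neq0 b0) => b' b'0; rewrite /m ofCK /y -actM //.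
    by rewrite /be -mulrA mulVf // mulr1.
  by rewrite mulf_neq0 // invr_neq0.
have sz : csn b (fun b' : E R 1 => toC b' * be).
  by apply: csnM; [exact: csn_zc|exact: csn_cst].
have Ez i : (fun b' => zc i (m b')) = (fun b' : E R 1 => toC b' * be).
  by apply/funext => b'; rewrite (ord1 i) -[LHS]/(toC _) ofCK.
have dz i : cdif (fun b' => zc i (m b')) b by rewrite Ez; exact: csn_cdif.
have one0 : toC (oneE R) != 0 by rewrite toC_one oner_eq0.
have sf1 : sn (act (toC (oneE R)) y) f by rewrite toC_one act1.
rewrite (wirt_eq _ N) (@wirt_comp _ _ _ m (fun b' : E R 1 => f (act (toC b') y)) b) //.
  rewrite big_sumType !big_ord1 /=.
  have e1 : wirt (inl ord0) (fun b' => zc ord0 (m b')) b = be.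
    rewrite Ez wirtM ?wirt_cst; [|exact: cdif_zc|exact: cdif_cst].
    have -> : wirt (inl ord0) (@toC R) b = 1 by exact: (@wirt_Zc R 1 (inl ord0) (inl ord0)).
    by rewrite mul1r mulr0 addr0.
  have e2 : wirt (inl ord0) (fun b' => conjc (zc ord0 (m b'))) b = 0.
    rewrite (@wirtJ _ _ (inl ord0) (fun b' => zc ord0 (m b'))) // Ez.
    rewrite wirtM ?wirt_cst; [|exact: cdif_zc|exact: cdif_cst].
    have -> : wirt (flipA (inl ord0)) (@toC R) b = 0.
      exact: (@wirt_Zc R 1 (inr ord0) (inl ord0)).
    by rewrite mul0r mulr0 addr0 rmorph0.
  rewrite [X in _ * (_ * X + _)]e1 [X in _ * (_ + _ * X)]e2 mulr0 addr0 mb mulrA.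
  by rewrite -fund_smoothE // mulrC.
by apply: csn_cdif; rewrite mb; exact: act_neq0.
Qed.

(** By [wirt_orbit] and [fund_Nf] the function N(b x) of b satisfies b dN/db = N, so the quotient by
    b conj b has derivative 0 in b. Being real, it also has derivative 0 in conj b. *)
Lemma wirt_hquot x b A : toC b != 0 -> wirt A (hquot x) b = 0.
Proof.
move=> b0; have sq := csn_hquot x b0.
suff e : wirt (inl ord0) (hquot x) b = 0.
  case: A => i; rewrite (ord1 i) //.
  have -> : hquot x = (fun b' => conjc (hquot x b')).
    by apply/funext => b'; rewrite hquot_real.
  by rewrite wirtJ ?e ?rmorph0 //; exact: csn_cdif.
have s1 : csn b (fun b' : E R 1 => Nf (act (toC b') x)).
  by apply: act_neq0 => //; exact: sn_Nf.
have s2 : csn b (fun b' : E R 1 => (toC b')^-1) by apply: csnV => //; exact: csn_zc.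
have sJ : csn b (fun b' : E R 1 => conjc (toC b')) by apply: csnJ; exact: csn_zc.
have s3 : csn b (fun b' : E R 1 => (conjc (toC b'))^-1).
  by apply: csnV => //; rewrite conjc_eq0.
rewrite /hquot wirtM; [|exact: csn_cdif|by apply: csn_cdif; exact: csnM].
rewrite wirtM; [|exact: csn_cdif..].
rewrite !wirtV ?conjc_eq0 //; last exact: csn_zc.
have -> : wirt (inl ord0) (@toC R) b = 1 by exact: (@wirt_Zc R 1 (inl ord0) (inl ord0)).
have -> : wirt (inl ord0) (fun b' : E R 1 => conjc (toC b')) b = 0.
  exact: (@wirt_Zc R 1 (inl ord0) (inr ord0)).
apply: (mulfI cc_neq0); rewrite mulr0 mulrDr mulrA wirt_orbit //; last exact: sn_Nf.
rewrite fund_Nf oppr0 mul0r mulr0 addr0.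
move: (Nf _) (conjc (toC b))^-1 cc => N z k; move: (toC b) b0 => be b0.
by field.
Qed.

(** The segment from 1 to b avoids 0, so the mean value theorem applies to the real and imaginary
    parts along it; at 1 the quotient is N(x). *)
Lemma hquot_const x (b : E R 1) : 0 < complex.Re (toC b) -> hquot x b = Nf x.
Proof.
move=> b0; have h1 : hquot x (oneE R) = Nf x.
  by rewrite /hquot toC_one act1 conjc1 invr1 !mulr1.
rewrite -h1; pose dw : E R 1 := b - oneE R.
pose l (t : R) : E R 1 := t *: dw.
have ll : linear l by move=> a u v; rewrite /l scalerDl scalerA.
pose lL := GRing.isLinear.Build R R (E R 1) *:%R l ll.
pose L : {linear R -> E R 1} := HB.pack l lL.
have cL : continuous L by exact: scalel_continuous.
have pos (t : R) : 0 <= t <= 1 -> toC (L t + oneE R) != 0.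
  move=> /andP[t0 t1]; rewrite eq_complex negb_and; apply/orP; left.
  rewrite gt_eqF //= !mxE; move: b0; rewrite /toC /zc /=.
  set r := b.1 ord0 ord0 => r0.
  have -> : t * (r + - 1) + 1 = t * r + (1 - t) by ring.
  have [->|tn0] := eqVneq t 0; first by rewrite mul0r add0r subr0 ltr01.
  by rewrite ltr_pwDl ?subr_ge0 // mulr_gt0 // lt_neqAle eq_sym tn0.
have key (h : E R 1 -> R) :
    (forall b', toC b' != 0 -> differentiable h b' /\ 'D_dw h b' = 0) ->
    h b = h (oneE R).
  move=> Hh; have D (t : R) : 0 <= t <= 1 ->
      differentiable (fun t => h (L t + oneE R)) t /\
      'D_1 (fun t => h (L t + oneE R)) t = 0.
    move=> t01; have [dh Dh] := Hh _ (pos t t01).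
    have [d1 ->] := derive_affine (l := L) cL 1 dh; split=> //.
    by rewrite -[L 1]/(1 *: dw) scale1r.
  have [] := @MVT_segment R (fun t => h (L t + oneE R)) (fun=> 0) 0 1 ler01.
  - move=> t; rewrite in_itv /= => /andP[t0 t1].
    have t01 : 0 <= t <= 1 by rewrite !ltW.
    have [d1 D1] := D t t01; rewrite -D1.
    by apply: derivableP; exact: diff_derivable.
  - apply: derivable_within_continuous => t; rewrite in_itv /= => t01.
    by have [d1 _] := D t t01; exact: diff_derivable.
  move=> t _; rewrite mul0r => /eqP; rewrite subr_eq0 => /eqP.
  by rewrite -[L 1]/(1 *: dw) -[L 0]/(0 *: dw) scale1r scale0r add0r /dw subrK.
have cd b' : toC b' != 0 -> cderiv dw (hquot x) b' = 0.
  move=> b'0; rewrite wirt_cderiv; last exact: csn_cdif (csn_hquot _ b'0).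
  by rewrite big1 // => A _; rewrite wirt_hquot ?mul0r.
apply: complex_eqP.
  apply: (key (fun b' => complex.Re (hquot x b'))) => b' b'0; split.
    by have [] := csn_cdif (csn_hquot x b'0).
  by have := congr1 (@complex.Re R) (cd b' b'0).
apply: (key (fun b' => complex.Im (hquot x b'))) => b' b'0; split.
  by have [] := csn_cdif (csn_hquot x b'0).
by have := congr1 (@complex.Im R) (cd b' b'0).
Qed.

Lemma Nf_act (b : C) x : b != 0 -> Nf (act b x) = b * conjc b * Nf x.
Proof.
pose S (b : C) := b != 0 /\ forall x, Nf (act b x) = b * conjc b * Nf x.
have Spos b' : 0 < complex.Re b' -> S b'.
  move=> b0; have bn0 : b' != 0.
    by apply: contraTneq b0 => ->; rewrite /= ltxx.
  split=> // y; rewrite -[Nf y in RHS](@hquot_const y (ofC b')) ?ofCK //.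
  rewrite /hquot ofCK; have : conjc b' != 0 by rewrite conjc_eq0.
  by move: (Nf _) (conjc b') => N z z0; field; rewrite z0.
have SM b1 b2 : S b1 -> S b2 -> S (b1 * b2).
  move=> [n1 S1] [n2 S2]; split; first exact: mulf_neq0.
  by move=> y; rewrite actM // S1 S2 rmorphM /=; ring.
have Si : S (iC R).
  (* i = (1 + i)(1 + i) / 2 has all its factors in the half plane, and -1 = i^2 follows; multiplying
     by these two brings every nonzero b into it. *)
  have -> : iC R = Complex 1 1 * (Complex 1 1 * (2^-1)%:C%C).
    by apply/eqP; rewrite eq_complex /=; apply/andP; split; apply/eqP; field.
  apply: (SM); first exact: Spos.
  apply: (SM); first exact: Spos.
  by apply: Spos; rewrite /= invr_gt0 ltr0n.
have Sm1 : S (-1) by rewrite -iC_sqr; exact: SM.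
move=> b0; suff [_] : S b by apply.
have [rp|rn|r0] := ltgtP 0 (complex.Re b).
- exact: Spos.
- rewrite -[b]opprK -mulN1r; apply: (SM) => //; apply: Spos.
  by rewrite ReN oppr_gt0.
- have I0 : complex.Im b != 0.
    by apply: contraNneq b0 => i0; rewrite eq_complex -r0 i0 !eqxx.
  have -> : b = iC R * (complex.Im b)%:C%C.
    apply/eqP; rewrite eq_complex /= -r0; apply/andP.
    by split; apply/eqP; ring.
  apply: (SM) => //; have [ip|ineg|i0] := ltgtP 0 (complex.Im b).
  + exact: Spos.
  + rewrite -[X in S X]opprK -mulN1r; apply: (SM) => //; apply: Spos.
    by rewrite ReN /= oppr_gt0.
  + by rewrite -i0 eqxx in I0.
Qed.

(** N is real, so the real part taken in [kpot] loses nothing. *)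
Lemma kpotE x : (kpot x)%:C%C = Nf x / cc ^+ 2.
Proof.
rewrite /kpot rmorphM fmorphV rmorphXn /=; congr (_ / _).
have := conjc_Nf x; rewrite /Nf /fundbar; case: (G _ _ _) => a b [] /eqP.
rewrite -subr_eq0 -opprD oppr_eq0 -mulr2n mulrn_eq0 /= => /eqP ->.
by [].
Qed.

Lemma kpot_neq0 x : kpot x != 0.
Proof.
have := Nf_neq0 x; apply: contraNneq => k0.
have := kpotE x; rewrite k0 => /esym/eqP; rewrite mulf_eq0 invr_eq0.
by rewrite expf_eq0 /= (negbTE cc_neq0) orbF.
Qed.

Lemma sn_kpot x : sn x (fun y => (kpot y)%:C%C).
Proof.
have -> : (fun y => (kpot y)%:C%C) = (fun y => Nf y * (cc ^+ 2)^-1).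
  by apply/funext => y; rewrite kpotE.
by apply: snM; [exact: sn_Nf|exact: sn_cst].
Qed.

Lemma kpot_act (b : C) x : b != 0 ->
  (kpot (act b x))%:C%C = b * conjc b * (kpot x)%:C%C.
Proof. by move=> b0; rewrite !kpotE Nf_act // mulrA. Qed.

Lemma sn_logk x : sn x (@logk R n P).
Proof. exact: sn_ln (sn_kpot x) (kpot_neq0 x). Qed.

Lemma tv_logk x v : is_tvec x v -> v (@logk R n P) = v Nf / Nf x.
Proof.
move=> tv; rewrite (tv_ln tv (sn_kpot x) (kpot_neq0 x)) fmorphV /=.
have -> : (fun y => (kpot y)%:C%C) = (fun y => (cc ^+ 2)^-1 * Nf y).
  by apply/funext => y; rewrite kpotE mulrC.
rewrite (tv_scale tv) kpotE; move: (v Nf) (Nf x) (Nf_neq0 x) cc cc_neq0.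
by move=> a N N0 k k0; field; rewrite ?N0 ?k0.
Qed.

(** H is invariant because the acting group is commutative. *)
Lemma push_act_fund (b : C) x : b != 0 -> push (act b) x (H x) = H (act b x).
Proof.
move=> b0; have hA := holo_at_act x b0.
apply: (@tv_ext _ _ _ (act b x)).
- by apply: push_tv => //; exact: fund_tv.
- exact: fund_tv.
move=> f sf; rewrite pushE // !fund_smoothE //; last exact: sn_holo_at.
congr (_ * _); apply: wirt_eq.
have one0 : toC (oneE R) != 0 by rewrite toC_one oner_eq0.
by apply: filterS (near_neq0 one0) => b' b'0; rewrite -!actM // mulrC.
Qed.

End Potential.

(** * Horizontal lifts *)

Section Horizontal.
Variables (R : realType) (n : nat) (P : proj_kahler R n).
Local Notation C := R[i].
Local Notation tM := (tot P).
Local Notation M := (base P).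
Local Notation pr := (@Defs.proj R n P).
Local Notation H := (@fund R n P).
Local Notation Hb := (@fundbar R n P).
Local Notation G := (@tmet R n P).
Implicit Types (x z : tM) (p q : M) (v w : tvec tM).

Let kt := tmet_kahler P.
Let hb := pk_bilin kt.

Lemma pr_act (b : C) x : b != 0 -> pr (act b x) = pr x.
Proof. by move=> b0; apply/esym/proj_fib; exists b. Qed.

Lemma act_inj (b b' : C) z : b != 0 -> b' != 0 -> act b z = act b' z -> b = b'.
Proof.
move=> b0 b'0 e; apply/eqP; rewrite -[b]mulr1 -subr_eq0 mulr1 subr_eq0; apply/eqP.
have i0 : b'^-1 * b != 0 by rewrite mulf_neq0 // invr_neq0.
have e1 : act (b'^-1 * b) z = z.
  by rewrite actM ?invr_neq0 // e -actM ?invr_neq0 // mulVf // act1.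
have := act_free i0 e1 => /(congr1 (fun t => b' * t)).
by rewrite mulrA mulfV // mul1r mulr1.
Qed.

Lemma hol_section_at (U : set M) (s : M -> tM) q : hol_section U s -> U q ->
  holo_at q s.
Proof. by move=> [oU hs _] Uq; exists U. Qed.

Lemma near_pr x (Q : M -> Prop) : (\forall q \near pr x, Q q) ->
  \forall z \near x, Q (pr z).
Proof. by move=> nQ; have c := holo_at_cont (holo_at_proj x); exact: c _ nQ. Qed.

Lemma open_pr (U : set M) : open U -> open (pr @^-1` U).
Proof.
move=> oU; rewrite openE => x Ux; apply: near_pr.
exact: open_nbhs_nbhs (conj oU Ux).
Qed.

Lemma ycoordP (U : set M) s x : hol_section U s -> U (pr x) ->
  ycoord s x != 0 /\ x = act (ycoord s x) (s (pr x)).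
Proof.
move=> [oU hs ps] Ux; rewrite /ycoord; set S := [set b | _].
have : S (xget 0 S).
  by apply: xgetPex; apply/proj_fib; rewrite ps.
by [].
Qed.

Lemma ycoordE (U : set M) s x (b : C) : hol_section U s -> U (pr x) -> b != 0 ->
  x = act b (s (pr x)) -> ycoord s x = b.
Proof.
move=> hs Ux b0 e; have [y0 e'] := ycoordP hs Ux.
by apply: (@act_inj _ _ (s (pr x))) => //; rewrite -e -e'.
Qed.

(** As the action is free, the coordinate provided by [proj_triv] coincides with the choice-based
    [ycoord], which thereby inherits holomorphy. *)
Lemma triv p : exists U s, [/\ hol_section U s, U p &
  holo_fun (pr @^-1` U) (@ycoord R n P s)].
Proof.
have [U [s [y [[oU Up hs ps] hy xy]]]] := @proj_triv R n P p.
have hS : hol_section U s by split.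
exists U, s; split=> // a; apply: holo_eq (hy a).
  by apply: open_phi; exact: open_pr.
move=> u [x [Ux ax] <-]; rewrite phiK //; have [y0 e] := xy _ Ux.
by rewrite (ycoordE hS Ux y0 e).
Qed.

(** For an arbitrary holomorphic section s, the fibre coordinate is y0 / (y0 o s o pi), where y0
    belongs to a trivializing section; both factors are holomorphic. *)
Lemma ycoord_sn_holo (U : set M) s x : hol_section U s -> U (pr x) ->
  smooth_near x (ycoord s) /\
  forall v, type10 x v -> v (fun z => conjc (ycoord s z)) = 0.
Proof.
move=> hs Ux; have [U0 [s0 [hs0 U0x hy0]]] := triv (pr x).
have [oU _ ps] := hs; have [oU0 _ ps0] := hs0.
pose y0 := ycoord s0; pose y1 z := y0 (s (pr z)).
have N : \forall z \near x, ycoord s z = y0 z * (y1 z)^-1.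
  have n1 : \forall z \near x, U (pr z) /\ U0 (pr z).
    by apply: (near_pr (Q := fun q => U q /\ U0 q)); apply: filterI;
      exact: open_nbhs_nbhs.
  apply: filterS n1 => z [Uz U0z]; apply: (ycoordE hs Uz).
    apply: mulf_neq0; first by have [] := ycoordP hs0 U0z.
    by rewrite invr_neq0 //; apply: proj1 (ycoordP hs0 _); rewrite ps.
  have [z0 e] := ycoordP hs0 U0z.
  have U1 : U0 (pr (s (pr z))) by rewrite ps.
  have [z1 e1] := ycoordP hs0 U1; rewrite ps // in e1.
  rewrite [X in _ = act _ X]e1 /y0 /y1 -actM ?mulf_neq0 ?invr_neq0 //.
  by rewrite -mulrA mulVf // mulr1.
have oV := open_pr oU0.
have s_y0 z : U0 (pr z) -> smooth_near z y0.
  by move=> U0z; exact: holo_near_sn oV U0z hy0.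
have hsx := hol_section_at hs Ux.
have s_y1' : smooth_near (pr x) (fun q => y0 (s q)).
  by apply: (sn_holo_at hsx (f := y0)); apply: s_y0; rewrite ps.
have s_y1 : smooth_near x y1 by exact: (sn_holo_at (holo_at_proj x) s_y1').
have y10 : y1 x != 0 by apply: proj1 (ycoordP hs0 _); rewrite ps.
split.
  apply: (@sn_eq _ _ _ x (fun z => y0 z * (y1 z)^-1)).
    by apply: filterS N => z ->.
  by apply: snM; [exact: s_y0|exact: snV].
move=> v v10; have tv := type10_tv v10.
have N' : \forall z \near x, conjc (ycoord s z) = conjc (y0 z) * (conjc (y1 z))^-1.
  by apply: filterS N => z ->; rewrite rmorphM /= conjc_inv.
rewrite (tv_eq tv N') (tv_mul tv) //; last 2 first.
- by apply: snJ; exact: s_y0.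
- by apply: snV; rewrite ?conjc_eq0 //; exact: snJ.
rewrite (type10_holo v10 oV U0x hy0) mul0r add0r (tv_inv tv) //; last 2 first.
- exact: snJ.
- by rewrite conjc_eq0.
have -> : v (fun z => conjc (y1 z)) = 0; last by rewrite oppr0 mul0r mulr0.
have w10 := push10 hsx (push10 (holo_at_proj x) v10).
have := type10_holo w10 oV _ hy0; rewrite /= ps // => /(_ U0x).
rewrite pushE; last by apply: snJ; apply: s_y0; rewrite ps.
by rewrite pushE //; exact: snJ.
Qed.

Definition ksec (s : M -> tM) : M -> C := fun q => (kpot (s q))%:C%C.

Lemma ksec_neq0 s q : ksec s q != 0.
Proof. by rewrite eq_complex /= eqxx andbT kpot_neq0. Qed.

Lemma sn_ksec (U : set M) s q : hol_section U s -> U q -> smooth_near q (ksec s).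
Proof.
move=> hs Uq; have hq := hol_section_at hs Uq.
by apply: (sn_holo_at hq (f := fun x => (kpot x)%:C%C)); exact: sn_kpot.
Qed.

(** K = y conj y (K o s o pi), and a (1,0) vector annihilates conj y. *)
Lemma tv_logk_split (U : set M) s x v : hol_section U s -> U (pr x) ->
  type10 x v ->
  v (@logk R n P) = v (ycoord s) / ycoord s x + v (fun z => ksec s (pr z)) / ksec s (pr x).
Proof.
move=> hs Ux v10; have tv := type10_tv v10.
have [sy hy] := ycoord_sn_holo hs Ux; have [oU _ ps] := hs.
have [y0 e] := ycoordP hs Ux.
have sk : smooth_near x (fun z => ksec s (pr z)).
  by apply: (sn_holo_at (holo_at_proj x) (f := ksec s)); exact: sn_ksec hs Ux.
rewrite (tv_ln tv (sn_kpot x) (kpot_neq0 x)).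
have N : \forall z \near x,
    (kpot z)%:C%C = ycoord s z * conjc (ycoord s z) * ksec s (pr z).
  have n1 : \forall z \near x, U (pr z).
    by apply: near_pr; exact: open_nbhs_nbhs.
  apply: filterS n1 => z Uz; have [z0 ez] := ycoordP hs Uz.
  by rewrite {1}ez kpot_act.
rewrite (tv_eq tv N) fmorphV /= (nbhs_singleton N).
rewrite (tv_mul tv) //; last by apply: snM => //; exact: snJ.
rewrite (tv_mul tv) //; last exact: snJ.
rewrite (hy v v10) mulr0 addr0; have := ksec_neq0 s (pr x).
have : conjc (ycoord s x) != 0 by rewrite conjc_eq0.
move: (v _) (v _) (conjc (ycoord s x)) (ycoord s x) y0 (ksec s (pr x)).
by move=> a b c d d0 k c0 k0; field; rewrite ?c0 ?d0 ?k0.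
Qed.

(** A description of omega without coordinates. The sum in [omega] keeps y fixed; this changes K o s
    by a constant factor only, so the sum is the derivative of log|K o s| along the projection of
    v. *)
Lemma omegaE (U : set M) s (a : chart M) x v : hol_section U s -> U (pr x) ->
  dom a (pr x) -> type10 x v -> omega s a x v = v (@logk R n P).
Proof.
move=> hs Ux ax v10; rewrite (tv_logk_split hs Ux v10) /omega mulrC.
congr (_ + _); have tv := type10_tv v10.
have [y0 e] := ycoordP hs Ux; set y := ycoord s x in y0 e *.
pose phi' q := (ln `|kpot (act y (s q))|)%:C%C : C.
have kE q : (kpot (act y (s q)))%:C%C = y * conjc y * ksec s q by rewrite kpot_act.
have sk : smooth_near (pr x) (fun q => (kpot (act y (s q)))%:C%C).
  have -> : (fun q => (kpot (act y (s q)))%:C%C) = (fun q => y * conjc y * ksec s q).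
    by apply/funext => q; rewrite kE.
  by apply: snM; [exact: sn_cst|exact: sn_ksec hs Ux].
have sphi : smooth_near (pr x) phi'
  by exact: (sn_ln (f := fun q => kpot (act y (s q))) sk (kpot_neq0 _)).
have -> : \sum_i wirt (inl i) (fun u => logk (act y (s (psi a u)))) (phi a (pr x)) *
    v (fun x' => zc i (phi a (pr x'))) = push pr x v phi'.
  rewrite (type10E ax (push10 (holo_at_proj x) v10)) sum_tvecE.
  apply: eq_bigr => i _.
  rewrite -[RHS]/(_ * pd a (inl i) (pr x) phi') pdE // mulrC.
  by rewrite pushE //; exact: sn_zc.
rewrite pushE // (@tv_ln _ _ _ _ _ tv (fun z => kpot (act y (s (pr z))))); last 2 first.
- exact: (sn_holo_at (holo_at_proj x) sk).
- exact: kpot_neq0.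
have -> : (fun z => (kpot (act y (s (pr z))))%:C%C) =
    (fun z => y * conjc y * ksec s (pr z)) by apply/funext => z; rewrite kE.
rewrite (tv_scale tv) fmorphV /= kE; have := ksec_neq0 s (pr x).
have : conjc y != 0 by rewrite conjc_eq0.
move: (v _) (conjc y) (y) y0 (ksec s (pr x)).
by move=> a' b c c0 k b0 k0; field; rewrite ?c0 ?b0 ?k0.
Qed.

Definition hz x v := type10 x v /\ G x v (Hb x) = 0.

Lemma horP x v : horizontal10 x v <-> hz x v.
Proof.
split=> [[v10 om]|[v10 gv]]; split=> //; have tv := type10_tv v10.
  have [U [s [hs Ux _]]] := triv (pr x); have [a ax] := dom_cover (pr x).
  have := om U s a hs Ux ax; rewrite (omegaE hs Ux ax v10) (tv_logk tv) (tv_Nf v10).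
  move/eqP; rewrite mulf_eq0 invr_eq0 (negbTE (Nf_neq0 x)) orbF mulf_eq0.
  by rewrite (negbTE (cc_neq0 P)) => /eqP.
move=> U s a hs Ux ax; rewrite (omegaE hs Ux ax v10) (tv_logk tv) (tv_Nf v10) gv.
by rewrite mulr0 mul0r.
Qed.

Lemma push_pr_fund x : push pr x (H x) = 0.
Proof.
have tH := fund_tv x.
apply: (@tv_ext _ _ _ (pr x)); [exact: push_tv (holo_at_proj x) tH|exact: tv0|].
move=> f sf; rewrite pushE // fund_smoothE; last exact: (sn_holo_at (holo_at_proj x) sf).
have one0 : toC (oneE R) != 0 by rewrite toC_one oner_eq0.
have N : \forall b \near oneE R, f (pr (act (toC b) x)) = f (pr x).
  by apply: filterS (near_neq0 one0) => b b0; rewrite pr_act.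
by rewrite (wirt_eq _ N) wirt_cst mulr0.
Qed.

(** A section carries w to some point of the fibre and the action carries it on to x; the H
    component is then subtracted, which is possible as N != 0. *)
Lemma lift_ex x (w : tvec M) : type10 (pr x) w ->
  exists v, hz x v /\ push pr x v = w.
Proof.
move=> w10; have tw := type10_tv w10; have [U [s [hs Ux _]]] := triv (pr x).
have [oU _ ps] := hs; have [y0 e] := ycoordP hs Ux; set b := ycoord s x in y0 e.
pose v0 := push (act b) (s (pr x)) (push s (pr x) w).
have hsx := hol_section_at hs Ux.
have v0_10 : type10 x v0.
  by rewrite {1}e; apply: push10; [exact: holo_at_act|exact: push10].
have pv0 : push pr x v0 = w.
  have h1 : holo_at (act b (s (pr x))) pr by exact: holo_at_proj.
  rewrite {1}e /v0 (push_comp _ h1).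
  have -> : (fun y => pr (act b y)) = pr by apply/funext => y; rewrite pr_act.
  rewrite push_comp; last exact: holo_at_proj.
  rewrite -[RHS](push_id tw); apply: push_eq => //.
  by apply: filterS (open_nbhs_nbhs (conj oU Ux)) => q Uq; rewrite ps.
pose k := G x v0 (Hb x) / Nf x.
have t0 := type10_tv v0_10; have tH := fund_tv x; have tHb := fundbar_tv x.
exists (v0 - k *: H x); split; last first.
  by rewrite pushB pushZ push_pr_fund scaler0 subr0.
split; first by apply: type10B => //; apply: type10Z; exact: fund10.
rewrite (gBl hb) //; last exact: tvZ.
by rewrite (gZl hb) // -[G x (H x) (Hb x)]/(Nf x) /k mulrVK ?subrr // unitfE Nf_neq0.
Qed.

(** * A smooth frame of horizontal lifts *)

Section Frame.
Variables (a : chart tM) (b : chart M).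

(* The matrix of the n + 1 linear forms g(., conj H) and dz^i o d pi on T^{1,0}.
   Its inverse exhibits horizontal lifts as smooth fields. *)
Definition hmat (y : tM) : 'M[C]_(n.+1) :=
  \matrix_(j, k) if unlift ord0 k is Some i
    then pd a (inl j) y (fun z => zc i (phi b (pr z)))
    else G y (pd a (inl j) y) (Hb y).

Lemma hmatE y v : dom a y -> type10 y v ->
  (\row_j v (fun z => zc j (phi a z))) *m hmat y =
  \row_k if unlift ord0 k is Some i then v (fun z => zc i (phi b (pr z)))
         else G y v (Hb y).
Proof.
move=> ay v10; apply/rowP => k; rewrite !mxE.
have e := type10E ay v10.
case Ek : (unlift ord0 k) => [i|].
  rewrite [in RHS]e sum_tvecE; apply: eq_bigr => j _.
  by rewrite !mxE Ek.
rewrite [in RHS]e (g_suml hb); [|by move=> j; apply: tvZ; exact: tv_pd|exact: fundbar_tv].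
apply: eq_bigr => j _; rewrite !mxE Ek (gZl hb) //; [exact: tv_pd|exact: fundbar_tv].
Qed.

(** The n + 1 forms send H / N and the horizontal lifts of the coordinate vectors to the standard
    basis, which yields a left inverse. *)
Lemma hmat_unit y : dom a y -> dom b (pr y) -> hmat y \in unitmx.
Proof.
move=> ay by_.
have ex (k : 'I_n.+1) : exists v, type10 y v /\
    \row_k' (if unlift ord0 k' is Some i then v (fun z => zc i (phi b (pr z)))
         else G y v (Hb y)) = delta_mx (ord0 : 'I_1) k.
  have pe v : type10 y v -> forall i,
      v (fun z => zc i (phi b (pr z))) = push pr y v (fun q => zc i (phi b q)).
    by move=> v10 i; rewrite pushE //; exact: sn_zc.
  case: (unliftP ord0 k) => [i ->|->].
    have [v [[v10 gv] pv]] := lift_ex (type10_pd i by_).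
    exists v; split=> //; apply/rowP => k'; rewrite !mxE eqxx /=.
    case: unliftP => [i' ->|->]; last by rewrite gv (negbTE (neq_lift _ _)).
    rewrite pe // pv (@pd_Zc _ _ _ b (inl i) (inl i')) //.
    by rewrite (inj_eq (@lift_inj _ _)) eq_sym.
  have v10 : type10 y ((Nf y)^-1 *: H y) by apply: type10Z; exact: fund10.
  exists ((Nf y)^-1 *: H y); split=> //; apply/rowP => k'; rewrite !mxE eqxx /=.
  case: unliftP => [i' ->|->].
    by rewrite pe // pushZ push_pr_fund scaler0 eq_sym (negbTE (neq_lift _ _)).
  rewrite (gZl hb) ?eqxx; [|exact: fund_tv|exact: fundbar_tv].
  by rewrite mulVf // Nf_neq0.
pose V k := projT1 (cid (ex k)).
have VP k := projT2 (cid (ex k)).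
pose A : 'M[C]_(n.+1) := \matrix_(k, j) V k (fun z => zc j (phi a z)).
have AB : A *m hmat y = 1%:M.
  apply/row_matrixP => k; have [v10 e] := VP k.
  rewrite row_mul; have -> : row k A = \row_j V k (fun z => zc j (phi a z)).
    by apply/rowP => j; rewrite !mxE.
  by rewrite (hmatE ay v10) e row1.
by have [] := mulmx1_unit AB.
Qed.

Lemma hmat_inj y v : dom a y -> dom b (pr y) -> type10 y v ->
  G y v (Hb y) = 0 -> push pr y v = 0 -> v = 0.
Proof.
move=> ay by_ v10 gv pv; have := hmatE ay v10; set r := (r in _ = r -> _).
have -> : r = 0.
  apply/rowP => k; rewrite !mxE; case: unliftP => [i _|_] //.
  have := congr1 (fun t => t (fun q => zc i (phi b q))) pv.
  by rewrite pushE //; exact: sn_zc.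
move/(congr1 (mulmx^~ (invmx (hmat y)))); rewrite mul0mx mulmxK; last exact: hmat_unit.
move=> e; rewrite (type10E ay v10) big1 // => j _.
by have := congr1 (fun t : 'rV_n.+1 => t ord0 j) e; rewrite !mxE => ->; rewrite scale0r.
Qed.

Lemma sn_det m (A : tM -> 'M[C]_m) x : (forall i j, smooth_near x (fun y => A y i j)) ->
  smooth_near x (fun y => \det (A y)).
Proof.
move=> sA; apply: sn_sum => s _; apply: snM; first exact: sn_cst.
by apply: sn_prod.
Qed.

(** Cramer's rule: the entries are cofactors divided by the determinant. *)
Lemma sn_invmx m (A : tM -> 'M[C]_m) x : (forall i j, smooth_near x (fun y => A y i j)) ->
  (\forall y \near x, A y \in unitmx) ->
  forall i j, smooth_near x (fun y => invmx (A y) i j).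
Proof.
move=> sA uA i j; apply: (@sn_eq _ _ _ x (fun y => (\det (A y))^-1 * \adj (A y) i j)).
  by apply: filterS uA => y uy; rewrite /invmx uy [RHS]mxE.
have dA : \det (A x) != 0 by have := nbhs_singleton uA; rewrite unitmxE unitfE.
apply: snM; first by apply: snV => //; exact: sn_det.
have -> : (fun y => \adj (A y) i j) =
  (fun y => (-1) ^+ (j + i) * \det (row' j (col' i (A y)))).
  by apply/funext => y; rewrite mxE.
apply: snM; first exact: sn_cst.
apply: sn_det => i' j'.
have -> : (fun y => row' j (col' i (A y)) i' j') = (fun y => A y (lift j i') (lift i j')).
  by apply/funext => y; rewrite !mxE.
exact: sA.
Qed.

(** Index 0 belongs to g(., conj H), so row [lift ord0 i] of the inverse gives the vector on which
    dz^i o d pi is 1 and the other n forms vanish. *)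
Definition hl (i : 'I_n) : vfield tM :=
  fun y => \sum_j invmx (hmat y) (lift ord0 i) j *: pd a (inl j) y.

Lemma hlP i y : dom a y -> dom b (pr y) ->
  hz y (hl i y) /\ push pr y (hl i y) = pd b (inl i) (pr y).
Proof.
move=> ay by_.
have v10 : type10 y (hl i y).
  by apply: type10_sum => j _; apply: type10Z; exact: type10_pd.
have := hmatE ay v10.
have -> : \row_j hl i y (fun z => zc j (phi a z)) = row (lift ord0 i) (invmx (hmat y)).
  apply/rowP => j; rewrite !mxE /hl sum_tvecE (bigD1 j) //= big1 ?addr0.
    rewrite -[LHS]/(_ * pd a (inl j) y (fun z => Zc (inl j) (phi a z))).
    by rewrite pd_Zc // eqxx mulr1.
  move=> k kj; rewrite -[LHS]/(_ * pd a (inl k) y (fun z => Zc (inl j) (phi a z))).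
  rewrite pd_Zc //; have -> : (inl k == inl j :> 'I_n.+1 + 'I_n.+1) = (k == j) by [].
  by rewrite (negbTE kj) mulr0.
rewrite -row_mul mulVmx; last exact: hmat_unit.
rewrite row1 => e; have ek k := congr1 (fun t : 'rV_n.+1 => t ord0 k) e.
split; first split=> //.
  have := ek ord0; rewrite !mxE eqxx /= unlift_none => <-.
  by rewrite ?(negbTE (neq_lift _ _)).
have p10 := push10 (holo_at_proj y) v10.
have ti := tv_pd (inl i) by_.
apply: (tv_eqP by_ (type10_tv p10) ti); case=> j /=; last first.
  by rewrite (type10_zc j by_ p10) (type10_zc j by_ (type10_pd i by_)).
have := ek (lift ord0 j); rewrite !mxE eqxx /= liftK => e1.
rewrite pushE; last exact: sn_zc.
rewrite -e1 (@pd_Zc _ _ _ b (inl i) (inl j)) //.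
by rewrite (inj_eq (@lift_inj _ _)) eq_sym.
Qed.

Lemma svf_hl i x : dom a x -> dom b (pr x) -> svf x (hl i).
Proof.
move=> ax bx; apply: svf_sum => j _; apply: svfZ; last exact: svf_pd.
apply: (sn_invmx (A := hmat)).
  move=> j' k.
  have -> : (fun y => hmat y j' k) = (fun y => if unlift ord0 k is Some i
    then pd a (inl j') y (fun z => zc i (phi b (pr z)))
    else G y (pd a (inl j') y) (Hb y)) by apply/funext => y; rewrite mxE.
  case: unlift => [i'|].
    apply: sn_pd => //.
    by apply: (sn_holo_at (holo_at_proj x) (f := fun q => zc i' (phi b q))); exact: sn_zc.
  by apply: (sn_g kt); [exact: svf_pd|exact: svf_fundbar].
apply: filterS (filterI (dom_near ax) (near_pr (Q := dom b) (dom_near bx))) => y [ay by_].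
exact: hmat_unit.
Qed.

End Frame.

Lemma hz_inj x v w : hz x v -> hz x w -> push pr x v = push pr x w -> v = w.
Proof.
move=> [v10 gv] [w10 gw] e; apply/eqP; rewrite -subr_eq0; apply/eqP.
have [a ax] := dom_cover x; have [b bx] := dom_cover (pr x).
apply: (@hmat_inj a b x) => //; first exact: type10B.
  rewrite (gBl hb) ?gv ?gw ?subrr //; try exact: type10_tv; exact: fundbar_tv.
by rewrite pushB e subrr.
Qed.

Lemma vertical10 x v : type10 x v -> push pr x v = 0 ->
  v = (G x v (Hb x) / Nf x) *: H x.
Proof.
move=> v10 pv; set k := _ / _; apply/eqP; rewrite -subr_eq0; apply/eqP.
have [a ax] := dom_cover x; have [b bx] := dom_cover (pr x).
have k10 : type10 x (k *: H x) by apply: type10Z; exact: fund10.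
apply: (@hmat_inj a b x) => //; first exact: type10B.
  rewrite (gBl hb) ?(gZl hb); try exact: type10_tv; try exact: fundbar_tv;
    try exact: fund_tv.
  by rewrite -[G x (H x) (Hb x)]/(Nf x) /k mulrVK ?subrr // unitfE Nf_neq0.
by rewrite pushB pushZ push_pr_fund pv scaler0 subr0.
Qed.

Lemma hzZ x (k : C) v : hz x v -> hz x (k *: v).
Proof.
move=> [v10 gv]; split; first exact: type10Z.
by rewrite (gZl hb) ?gv ?mulr0 //; [exact: type10_tv|exact: fundbar_tv].
Qed.

Lemma hzD x v w : hz x v -> hz x w -> hz x (v + w).
Proof.
move=> [v10 gv] [w10 gw]; split; first exact: type10D.
by rewrite (gDl hb) ?gv ?gw ?addr0 //; try exact: type10_tv; exact: fundbar_tv.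
Qed.

Lemma hz0 x : hz x 0.
Proof. by split; [exact: type100|rewrite (g0l hb) //; exact: fundbar_tv]. Qed.

Lemma hz_sum x (I : Type) (r : seq I) (F : I -> tvec tM) :
  (forall i, hz x (F i)) -> hz x (\sum_(i <- r) F i).
Proof. by move=> hF; elim/big_ind : _ => //; [exact: hz0|exact: hzD]. Qed.

Definition hor x v := exists v1 v2, [/\ hz x v1, hz x v2 & v = v1 + conjv v2].

Lemma horizontalP x v : horizontal x v <-> hor x v.
Proof.
by split=> -[v1 [v2 [h1 h2 e]]]; exists v1, v2; split=> //; exact/horP.
Qed.

Lemma hor_tv x v : hor x v -> is_tvec x v.
Proof.
move=> [v1 [v2 [[h1 _] [h2 _] ->]]]; apply: tvD; first exact: type10_tv.
by apply: tvJ; exact: type10_tv.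
Qed.

Lemma hor_inj x v w : hor x v -> hor x w -> push pr x v = push pr x w -> v = w.
Proof.
move=> [v1 [v2 [h1 h2 ->]]] [w1 [w2 [k1 k2 ->]]]; rewrite !pushD !push_conjv => e.
have P10 u : hz x u -> type10 (pr x) (push pr x u).
  by move=> [u10 _]; exact: push10 (holo_at_proj x) u10.
have e1 : push pr x v1 = push pr x w1.
  have := congr1 (prj10 (pr x)) e.
  by rewrite !prj10_uniq //; try exact: P10; apply: type01J; exact: P10.
have e2 : push pr x v2 = push pr x w2.
  by move: e; rewrite e1 => /addrI/(congr1 (@conjv _ _ _)); rewrite !conjvK.
by rewrite (hz_inj h1 k1 e1) (hz_inj h2 k2 e2).
Qed.

Lemma hor_ex x (w : tvec M) : is_tvec (pr x) w -> exists v, hor x v /\ push pr x v = w.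
Proof.
move=> tw; have [v1 [h1 e1]] := lift_ex (type10_prj (pr x) w).
have [v2 [h2 e2]] := lift_ex (type01_prj tw).
exists (v1 + conjv v2); split; first by exists v1, v2.
by rewrite pushD push_conjv e1 e2 conjvK addrC subrK.
Qed.

Lemma hliftP (X : vfield M) x : is_tvec (pr x) (X (pr x)) ->
  hor x (hlift X x) /\ push pr x (hlift X x) = X (pr x).
Proof.
move=> tX; have [v [hv pv]] := hor_ex tX.
have : [set v | horizontal x v /\ push pr x v = X (pr x)] (hlift X x).
  by apply: xgetPex; exists v; split=> //; exact/horizontalP.
by move=> [/horizontalP].
Qed.

Lemma hliftE (X : vfield M) x v : hor x v -> push pr x v = X (pr x) -> hlift X x = v.
Proof.
move=> hv pv; have tX : is_tvec (pr x) (X (pr x)).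
  by rewrite -pv; apply: push_tv; [exact: holo_at_proj|exact: hor_tv].
by have [h1 p1] := hliftP tX; apply: (hor_inj h1 hv); rewrite p1.
Qed.

Lemma hz_hor x v : hz x v -> hor x v.
Proof. by move=> h; exists v, 0; split=> //; [exact: hz0|rewrite conjv0 addr0]. Qed.

Lemma horJ x v : hor x v -> hor x (conjv v).
Proof.
by move=> [v1 [v2 [h1 h2 ->]]]; exists v2, v1; split=> //; rewrite conjvD conjvK addrC.
Qed.

Lemma hlift10 (X : vfield M) x : type10 (pr x) (X (pr x)) -> hz x (hlift X x).
Proof.
move=> X10; have [v [hv pv]] := lift_ex X10.
by rewrite (hliftE (hz_hor hv) pv).
Qed.

Lemma hliftJ (X : vfield M) x : is_tvec (pr x) (X (pr x)) ->
  hlift (fun q => conjv (X q)) x = conjv (hlift X x).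
Proof.
move=> tX; have [h1 p1] := hliftP tX.
by apply: hliftE; [exact: horJ|rewrite push_conjv p1].
Qed.

(** [hlift] is a pointwise choice. Uniqueness of horizontal lifts identifies it near x with a smooth
    combination of the fields [hl] and their conjugates. *)
Lemma svf_hlift (X : vfield M) x : svf (pr x) X -> svf x (hlift X).
Proof.
move=> sX; have [a ax] := dom_cover x; have [b bx] := dom_cover (pr x).
pose k (A : 'I_n + 'I_n) y := X (pr y) (fun q => Zc A (phi b q)).
have sk A : smooth_near x (k A).
  apply: (sn_holo_at (holo_at_proj x) (f := fun q => X q (fun q' => Zc A (phi b q')))).
  exact: svf_coord_sn.
apply: (@svf_eq _ _ _ _ (fun y => \sum_i k (inl i) y *: hl a b i y +
    conjv (\sum_i conjc (k (inr i) y) *: hl a b i y))); last first.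
  apply: svfD; first by apply: svf_sum => i _; apply: svfZ => //; exact: svf_hl.
  apply: svfJ; apply: svf_sum => i _; apply: svfZ; first exact: snJ.
  exact: svf_hl.
have nX : \forall y \near x, is_tvec (pr y) (X (pr y)).
  apply: (near_pr (Q := fun q => is_tvec q (X q))).
  by apply: filterS sX => q [].
apply: filterS (filterI (filterI (dom_near ax) (near_pr (Q := dom b) (dom_near bx))) nX).
move=> y [[ay by_] tX]; apply/esym/hliftE.
  eexists; eexists; split; last by reflexivity.
    by apply: hz_sum => i; apply: hzZ; have [] := hlP i ay by_.
  by apply: hz_sum => i; apply: hzZ; have [] := hlP i ay by_.
rewrite pushD push_conjv !push_sum conjv_sum [RHS](tvE by_ tX) big_sumType /=.
congr (_ + _); apply: eq_bigr => i _; rewrite pushZ; have [_ ->] := hlP i ay by_ => //.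
by rewrite conjvZ conjcK conjv_pd.
Qed.

End Horizontal.

(** * Comparison of the two Levi-Civita connections *)

Section Isometry.
Variables (R : realType) (n : nat) (P : proj_kahler R n).
Local Notation C := R[i].
Local Notation tM := (tot P).
Local Notation M := (base P).
Local Notation pr := (@Defs.proj R n P).
Local Notation H := (@fund R n P).
Local Notation Hb := (@fundbar R n P).
Local Notation G := (@tmet R n P).
Local Notation cc := ((Defs.cst P)%:C%C).
Local Notation tD := (@tD R n P).
Implicit Types (x z : tM) (p q : M) (v w : tvec tM) (X Y Z : vfield M).

Let kt := tmet_kahler P.
Let lt := tD_lc P.
Let hb := pk_bilin kt.
Let cD := lc_conn lt.

Lemma hlift_pr X x f : is_tvec (pr x) (X (pr x)) -> smooth_near (pr x) f ->
  hlift X x (fun z => f (pr z)) = X (pr x) f.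
Proof.
move=> tX sf; have [_ e] := hliftP tX.
by rewrite -(@pushE _ _ _ _ _ pr x (hlift X x) f sf) e.
Qed.

Lemma vertical x v : is_tvec x v -> push pr x v = 0 ->
  exists al be, v = al *: H x + be *: Hb x.
Proof.
move=> tv pv; have v1 := type10_prj x v; have v2 := type01_prj tv.
have e : push pr x (prj10 x v) + push pr x (v - prj10 x v) = 0.
  by rewrite -pushD addrC subrK.
have h1 : push pr x (prj10 x v) = 0.
  have := congr1 (prj10 (pr x)) e.
  rewrite prj10_uniq; last 2 first.
  - exact: push10 (holo_at_proj x) v1.
  - by rewrite /type01 -push_conjv; exact: push10 (holo_at_proj x) v2.
  move=> ->; have t0 : type01 (pr x) (0 : tvec M).
    by rewrite /type01 conjv0; exact: type100.
  by have := prj10_uniq (type100 (pr x)) t0; rewrite addr0.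
have h2 : push pr x (conjv (v - prj10 x v)) = 0.
  by rewrite push_conjv; move: e; rewrite h1 add0r => ->; rewrite conjv0.
have e1 := vertical10 v1 h1; have e2 := vertical10 v2 h2.
eexists; exists (conjc (G x (conjv (v - prj10 x v)) (Hb x) / Nf x)).
rewrite -[LHS](subrK (prj10 x v)) addrC {1}e1; congr (_ + _).
by rewrite -[LHS]conjvK {1}e2 conjvZ.
Qed.

Lemma decomp x v : is_tvec x v ->
  exists h al be, [/\ hor x h, push pr x h = push pr x v &
    v = h + (al *: H x + be *: Hb x)].
Proof.
move=> tv; have [h [hh ph]] := hor_ex (push_tv (holo_at_proj x) tv).
have th := hor_tv hh.
have [|al [be e]] := @vertical x (v - h) (tvB tv th); first by rewrite pushB ph subrr.
by exists h, al, be; split=> //; rewrite -e addrC subrK.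
Qed.

Lemma G_H_hor x v : hor x v -> G x (H x) v = 0 /\ G x (Hb x) v = 0.
Proof.
move=> [v1 [v2 [[h1 g1] [h2 g2] ->]]]; have tH := fund_tv x; have tHb := fundbar_tv x.
have t1 := type10_tv h1; have t2 := tvJ (type10_tv h2).
rewrite !(gDr hb) //; split.
  rewrite (g_1010 kt (fund10 x) h1) add0r; have := g_conj kt (type10_tv h2) tHb.
  by rewrite g2 conjc0 /fundbar conjvK (g_sym hb t2 tH).
rewrite (g_sym hb tHb t1) g1 add0r.
by apply: (g_0101 kt); [exact: fundbar01|exact: type01J].
Qed.

Lemma tv_hor_Nf x v : hor x v -> v (@Nf R n P) = 0.
Proof.
move=> [v1 [v2 [h1 h2 ->]]].
have e1 u : hz x u -> u (@Nf R n P) = 0.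
  by move=> [u10 gu]; rewrite (tv_Nf u10) gu mulr0.
rewrite -[LHS]/(v1 _ + conjv v2 _) e1 // add0r.
have -> : (@Nf R n P) = (fun y => conjc (Nf y)).
  by apply/funext => y; rewrite conjc_Nf.
by rewrite conjvE e1 // conjc0.
Qed.

Lemma hz_logk x v : hz x v -> v (@logk R n P) = 0.
Proof.
move=> hv; have [v10 _] := hv.
by rewrite (tv_logk (type10_tv v10)) (tv_hor_Nf (hz_hor hv)) mul0r.
Qed.

(** Up to the sign of K, a local Kähler potential of g. *)
Definition lks (s : M -> tM) : M -> C := fun q => logk (s q).

Lemma sn_lks (U : set M) s q : hol_section U s -> U q -> smooth_near q (lks s).
Proof.
move=> hs Uq; have hq := hol_section_at hs Uq.
by apply: (sn_holo_at hq (f := @logk R n P)); exact: sn_logk.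
Qed.

(** A horizontal v annihilates log|K|, whose derivative splits by [tv_logk_split] into v(y) / y and
    the derivative of log|K o s| along the projection. *)
Lemma hz_ycoord (U : set M) s x v : hol_section U s -> U (pr x) -> hz x v ->
  v (ycoord s) = - (ycoord s x * push pr x v (lks s)).
Proof.
move=> hs Ux hv; have [v10 _] := hv.
have [y0 _] := ycoordP hs Ux; have k0 := ksec_neq0 s (pr x).
have tp := push_tv (holo_at_proj x) (type10_tv v10).
have sk := sn_ksec hs Ux.
have := tv_logk_split hs Ux v10; rewrite (hz_logk hv).
rewrite (@tv_ln _ _ _ _ _ tp (fun q => kpot (s q))) //; last exact: kpot_neq0.
rewrite -/(ksec s) pushE // fmorphV /= -[(kpot _)%:C%C]/(ksec s (pr x)).
move: (v _) (v _) (ycoord s x) y0 (ksec s (pr x)) k0 => b a y y0 k k0 e.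
have -> : a = (a / y + b / k) * y - b / k * y by field; rewrite ?y0 ?k0.
by rewrite -e; ring.
Qed.

Lemma fund_ycoord (U : set M) s x : hol_section U s -> U (pr x) ->
  H x (ycoord s) = cc * ycoord s x.
Proof.
move=> hs Ux; have [sy _] := ycoord_sn_holo hs Ux.
rewrite (fund_smoothE sy); congr (_ * _).
have [y0 e] := ycoordP hs Ux.
have one0 : toC (oneE R) != 0 by rewrite toC_one oner_eq0.
have N : \forall b \near oneE R, ycoord s (act (toC b) x) = toC b * ycoord s x.
  apply: filterS (near_neq0 one0) => b b0; apply: (ycoordE hs).
  - by rewrite pr_act.
  - exact: mulf_neq0.
  - by rewrite pr_act // actM // -e.
rewrite (wirt_eq _ N) wirtM; [|exact: cdif_zc|exact: cdif_cst].
have -> : wirt (inl ord0) (@toC R) (oneE R) = 1.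
  exact: (@wirt_Zc R 1 (inl ord0) (inl ord0)).
by rewrite wirt_cst mul1r mulr0 addr0.
Qed.

(** Lifts are pi-related to the fields that they lift, hence so are the brackets. *)
Lemma push_tors x X Y f : svf (pr x) X -> svf (pr x) Y -> smooth_near (pr x) f ->
  push pr x (tors tD (hlift X) (hlift Y) x) f =
  X (pr x) (fun q => Y q f) - Y (pr x) (fun q => X q f).
Proof.
move=> sX sY sf; have sX' := svf_hlift sX; have sY' := svf_hlift sY.
have sfx := sn_holo_at (holo_at_proj x) sf.
rewrite pushE // (torsE lt) //.
have Hh X' Y' : svf (pr x) X' -> svf (pr x) Y' ->
    hlift X' x (fun z1 => hlift Y' z1 (fun z => f (pr z))) = X' (pr x) (fun q => Y' q f).
  move=> s1 s2.
  have N : \forall z1 \near x, hlift Y' z1 (fun z => f (pr z)) = Y' (pr z1) f.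
    have n2 : \forall z1 \near x, is_tvec (pr z1) (Y' (pr z1)) /\ smooth_near (pr z1) f.
      apply: (near_pr (Q := fun q => is_tvec q (Y' q) /\ smooth_near q f)).
      by apply: filterS (filterI s2 (sn_near sf)) => q [[t2 _] sq].
    by apply: filterS n2 => z1 [t2 sq]; exact: hlift_pr.
  rewrite (tv_eq (svf_tv (svf_hlift s1)) N).
  exact: (hlift_pr (f := fun q => Y' q f) (svf_tv s1) (svf_sn s2 sf)).
by rewrite !Hh.
Qed.

(** * The curvature computation on lifts of coordinate fields *)

Section Coordinates.
Variable b : chart M.
Let L A : vfield tM := hlift (pd b A).

Lemma svf_L A x : dom b (pr x) -> svf x (L A).
Proof. by move=> bx; apply: svf_hlift; exact: svf_pd. Qed.

Lemma L_hz i x : dom b (pr x) -> hz x (L (inl i) x).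
Proof. by move=> bx; apply: hlift10; exact: type10_pd. Qed.

Lemma L_conj A x : dom b (pr x) -> conjv (L A x) = L (flipA A) x.
Proof.
move=> bx; rewrite -hliftJ; last exact: tv_pd.
have tp := tv_pd (flipA A) bx.
have [h1 p1] := hliftP tp; apply: hliftE => //.
by rewrite p1 conjv_pd.
Qed.

Lemma L_push A x : dom b (pr x) -> push pr x (L A x) = pd b A (pr x).
Proof. by move=> bx; have [_] := hliftP (tv_pd A bx). Qed.

Variable D : vfield M -> vfield M -> vfield M.
Variable g : tensor2 M.
Hypothesis hD : levi_civita g D.

Lemma push_tors_pd A B x : dom b (pr x) -> push pr x (tors tD (L A) (L B) x) = 0.
Proof.
move=> bx; rewrite -(tors_pd hD A B bx).
have sA := svf_pd A bx; have sB := svf_pd B bx.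
apply: (@tv_ext _ _ _ (pr x)).
- apply: push_tv (holo_at_proj x) _; apply: (tors_tv lt); exact: svf_L.
- exact: (tors_tv hD).
- by move=> f sf; rewrite push_tors // (torsE hD).
Qed.

Lemma iso_pd (U : set M) s x i j : hol_section U s -> U (pr x) -> dom b (pr x) ->
  G x (L (inl i) x) (L (inr j) x) =
  (kpot x)%:C%C * pd b (inl i) (pr x) (fun q => pd b (inr j) q (lks s)).
Proof.
move=> hs Ux bx; have [oU _ _] := hs.
set h := fun q => pd b (inr j) q (lks s).
have sX := svf_L (inl i) bx; have sZ := svf_L (inr j) bx.
set X := L (inl i) in sX *; set Z := L (inr j) in sZ *.
have nb : \forall z \near x, dom b (pr z) by exact: near_pr (dom_near bx).
have nU : \forall z \near x, U (pr z) by exact: near_pr (open_nbhs_nbhs (conj oU Ux)).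
have tX : tf10 x X by apply: filterS nb => z bz; have [] := L_hz i bz.
have X10 := nbhs_singleton tX.
have tvX := type10_tv X10; have tvZ' := svf_tv sZ.
have ZE z : dom b (pr z) -> conjv (L (inl j) z) = Z z by move=> bz; rewrite L_conj.
have Zhor z : dom b (pr z) -> hor z (Z z).
  by move=> bz; rewrite -ZE //; apply: horJ; apply: hz_hor; exact: L_hz.
have [sy hy] := ycoord_sn_holo hs Ux.
have syJ := snJ sy.
have [y0 _] := ycoordP hs Ux.
have sl := sn_lks hs Ux.
have sh : smooth_near (pr x) h by exact: sn_pd.
(* [0 = X g(H, Z) = c g(X, Z) + g(H, D_X Z)] *)
have e0 : cc * G x (X x) (Z x) + G x (H x) (tD X Z x) = 0.
  have := lcM lt sX (svf_fund x) sZ; rewrite D_fund // (gZl hb) // => <-.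
  have N : \forall z \near x, G z (H z) (Z z) = 0.
    by apply: filterS nb => z bz; have [] := G_H_hor (Zhor z bz).
  by rewrite (tv_eq tvX N) (tv_cst tvX).
(* [X, Z] is vertical, and its component along conj H is read off by applying
   it to the conjugate of the fibre coordinate. *)
pose T := tors tD X Z x.
have tT : is_tvec x T by exact: (tors_tv lt).
(* D_Z X is again of type (1,0), hence orthogonal to H, so only the bracket contributes. *)
have eT : G x (H x) (tD X Z x) = G x (H x) T.
  have t1 := cn_tv cD sX sZ; have t2 := cn_tv cD sZ sX.
  have d10 := D_10 kt lt sZ sX tX.
  rewrite /T /tors (gBr hb) //; last exact: fund_tv.
  by rewrite (g_1010 kt (fund10 x) d10) subr0.
have [al [be eT']] := vertical tT (push_tors_pd _ _ bx).
have gT : G x (H x) T = be * Nf x.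
  have tH := fund_tv x; have tHb := fundbar_tv x.
  rewrite eT' (gDr hb) //; [|exact: tvZ..].
  by rewrite !(gZr hb) // (g_1010 kt (fund10 x) (fund10 x)) mulr0 add0r.
have T1 : T (fun z => conjc (ycoord s z)) = be * (cc * conjc (ycoord s x)).
  rewrite eT' -[LHS]/(al * H x _ + be * Hb x _) (hy _ (fund10 x)) mulr0 add0r.
  by rewrite /fundbar conjvE (fund_ycoord hs Ux) rmorphM /= conjc_cc.
(* X annihilates conj y by type, so only X(Z(conj y)) is left, and Z(conj y) is known from
   [hz_ycoord]. *)
have T2 : T (fun z => conjc (ycoord s z)) = - (conjc (ycoord s x) * pd b (inl i) (pr x) h).
  rewrite /T (torsE lt) //.
  have N1 : \forall z \near x, X z (fun z' => conjc (ycoord s z')) = 0.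
    apply: filterS (filterI nU tX) => z [Uz Xz].
    by have [_ ->] := ycoord_sn_holo hs Uz.
  rewrite (tv_eq tvZ' N1) (tv_cst tvZ') subr0.
  have N2 : \forall z \near x, Z z (fun z' => conjc (ycoord s z')) =
      -1 * (conjc (ycoord s z) * h (pr z)).
    apply: filterS (filterI nU nb) => z [Uz bz]; rewrite -ZE // conjvE.
    rewrite (hz_ycoord hs Uz (L_hz j bz)) L_push // rmorphN rmorphM mulN1r /=.
    congr (- (_ * _)); rewrite -conjvE conjv_pd //; congr (pd _ _ _ _).
    by apply/funext => q; rewrite conjc_real.
  rewrite (tv_eq tvX N2) (tv_scale tvX) mulN1r; congr (- _).
  rewrite (tv_mul tvX) //; last exact: sn_holo_at (holo_at_proj x) sh.
  rewrite (hy _ X10) mul0r add0r; congr (_ * _).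
  exact: (hlift_pr (f := h) (tv_pd _ bx) sh).
have Y0 : conjc (ycoord s x) != 0 by rewrite conjc_eq0.
move: e0; rewrite eT gT kpotE => /eqP; rewrite addr_eq0 => /eqP e0.
have bE : cc * be = - pd b (inl i) (pr x) h.
  apply: (mulfI Y0); rewrite mulrN -T2 T1; ring.
have c0 := cc_neq0 P; apply: (mulfI c0); rewrite e0.
have -> : be = - pd b (inl i) (pr x) h / cc by rewrite -bE mulrC mulKf.
by move: (Nf x) (pd _ _ _ _) (cc) c0 => N t k k0; field; rewrite ?k0.
Qed.

End Coordinates.

Definition ak x : C := (`|kpot x|)%:C%C.

Lemma kpot_sg (b : C) x : b != 0 -> Num.sg (kpot (act b x)) = Num.sg (kpot x).
Proof.
move=> b0; have := kpot_act x b0.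
have -> : b * conjc b = (complex.Re b ^+ 2 + complex.Im b ^+ 2)%:C%C.
  clear; case: b => b1 b2; rewrite /conjc; apply/eqP; rewrite eq_complex /=.
  by apply/andP; split; apply/eqP; ring.
rewrite -rmorphM => /complexI ->; rewrite sgrM gtr0_sg ?mul1r //.
have: (complex.Re b != 0) || (complex.Im b != 0).
  by move: b0; rewrite eq_complex negb_and.
by move=> /orP[] h; [apply: ltr_pwDl|apply: ltr_wpDl];
  rewrite ?sqr_ge0 // exprn_even_gt0.
Qed.

Lemma ak_neq0 x : ak x != 0.
Proof. by rewrite eq_complex /= eqxx andbT normr_eq0 kpot_neq0. Qed.

(** K is continuous and nowhere 0, so its sign is locally constant and |K| is smooth with K. *)
Lemma ak_near x : \forall z \near x, ak z = (Num.sg (kpot x))%:C%C * (kpot z)%:C%C.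
Proof.
have [a ax] := dom_cover x.
have sk := sn_kpot x; rewrite (snP _ ax) in sk.
have [ck _] := csn_cont sk; have k0 := kpot_neq0 x.
pose sg := Num.sg (kpot x).
have pos : 0 < sg * kpot x by rewrite -normrEsg normr_gt0.
have cm : {for phi a x, continuous (fun u => sg * kpot (psi a u))}.
  by apply: continuousM; [exact: cst_continuous|exact: ck].
have N : \forall u \near phi a x, 0 < sg * kpot (psi a u).
  have := cm; rewrite /prop_for /continuous_at phiK // => cm'.
  exact: (cm' _ (open_nbhs_nbhs (conj (@open_gt _ 0) pos))).
apply: filterS (filterI (near_phi ax N) (dom_near ax)) => z [].
move=> + az; rewrite phiK // => pz; rewrite /ak -rmorphM; congr (_%:C%C).
have sg1 : `|sg| = 1 by rewrite /sg normr_sg k0.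
by rewrite -[LHS]mul1r -sg1 -normrM gtr0_norm.
Qed.

(** * Transfer of the metric and of its Levi-Civita connection to the base *)

Variable g : tensor2 M.
Hypothesis hg : induced_metric g.
Let gb : bilinear_sym g := proj1 hg.
Variable D : vfield M -> vfield M -> vfield M.
Hypothesis hD : levi_civita g D.
Let cDM := lc_conn hD.

Lemma g_types (b : chart M) p i j : dom b p ->
  g p (pd b (inl i) p) (pd b (inl j) p) = 0 /\
  g p (pd b (inr i) p) (pd b (inr j) p) = 0.
Proof.
move=> bp; have [U [s [hs Up _]]] := triv p.
by have [_ /(_ b U s p hs Up bp i j)[_ e1 e2]] := hg.
Qed.

(** The sign in [induced_metric] meets the factor K of [iso_pd] here: K = sign(K) |K|, and the sign
    is the same at x and at the point of s over [pr x]. *)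
Lemma g_pd (b : chart M) x i j : dom b (pr x) ->
  G x (hlift (pd b (inl i)) x) (hlift (pd b (inr j)) x) =
  ak x * g (pr x) (pd b (inl i) (pr x)) (pd b (inr j) (pr x)).
Proof.
move=> bx; have [U [s [hs Ux _]]] := triv (pr x).
rewrite (iso_pd hD i j hs Ux bx) /ak.
have [_ /(_ b U s (pr x) hs Ux bx i j)[-> _ _]] := hg.
have [y0 e] := ycoordP hs Ux.
have -> : Num.sg (kpot (s (pr x))) = Num.sg (kpot x) by rewrite [in RHS]e kpot_sg.
rewrite mulrA -rmorphM mulrC normrEsg mulrAC -expr2 sqr_sg kpot_neq0 mul1r mulrC.
congr (_ * _); have [oU _ _] := hs.
have sl : smooth_near (pr x) (lks s) by exact: sn_lks hs Ux.
rewrite pdE; last exact: sn_pd.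
apply: wirt_eq; have N := near_psi bx (sn_near sl).
by apply: filterS (filterI N (im_near bx)) => u [su iu]; rewrite (pdE _ _ su) (phi_psiK iu).
Qed.

Lemma hz_expand (b : chart M) x v : dom b (pr x) -> hz x v ->
  v = \sum_i push pr x v (fun q => zc i (phi b q)) *: hlift (pd b (inl i)) x.
Proof.
move=> bx hv; have [v10 _] := hv; apply: (@hz_inj _ _ P x) => //.
  by apply: hz_sum => i; apply: hzZ; exact: L_hz.
rewrite push_sum {1}(type10E bx (push10 (holo_at_proj x) v10)).
by apply: eq_bigr => i _; rewrite pushZ L_push.
Qed.

Lemma iso_hz x v w : hz x v -> hz x w ->
  G x v (conjv w) = ak x * g (pr x) (push pr x v) (conjv (push pr x w)).
Proof.
move=> hv hw; have [b bx] := dom_cover (pr x).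
rewrite {1}(hz_expand bx hv) {1}(hz_expand bx hw).
have [v10 _] := hv; have [w10 _] := hw.
rewrite {2}(type10E bx (push10 (holo_at_proj x) v10)).
rewrite {2}(type10E bx (push10 (holo_at_proj x) w10)) !conjv_sum.
have tL A : is_tvec x (hlift (pd b A) x) by apply: svf_tv; exact: svf_L.
have tp A : is_tvec (pr x) (pd b A (pr x)) by exact: tv_pd.
have tw1 k j : is_tvec x (conjv (k *: hlift (pd b (inl j)) x)).
  by apply: tvJ; apply: tvZ.
have tw2 k j : is_tvec (pr x) (conjv (k *: pd b (inl j) (pr x))).
  by apply: tvJ; apply: tvZ.
rewrite (g_suml hb); [|by move=> i; exact: tvZ|by apply: tv_sum].
rewrite (g_suml gb); [|by move=> i; exact: tvZ|by apply: tv_sum].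
rewrite mulr_sumr; apply: eq_bigr => i _.
rewrite (g_sumr hb) //; last exact: tvZ.
rewrite (g_sumr gb) //; last exact: tvZ.
rewrite mulr_sumr; apply: eq_bigr => j _.
rewrite !conjvZ conjv_pd // (L_conj (inl j) bx).
rewrite (gZl hb) ?(gZl gb) //; [|exact: tvZ..].
rewrite (gZr hb) // (gZr gb) // g_pd //.
by move: (ak x) (g _ _ _) => a t; ring.
Qed.

Lemma g_span0 p (I : finType) (c d : I -> C) (u : I -> tvec M) :
  (forall i, is_tvec p (u i)) -> (forall i j, g p (u i) (u j) = 0) ->
  g p (\sum_i c i *: u i) (\sum_i d i *: u i) = 0.
Proof.
move=> tu gu; rewrite (g_suml gb); last 2 first.
- by move=> i; exact: tvZ.
- by apply: tv_sum => i _; exact: tvZ.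
rewrite big1 // => i _; rewrite (g_sumr gb); [|by move=> j; exact: tvZ|exact: tvZ].
rewrite big1 // => j _; rewrite (gZl gb _ (tu i) (tvZ _ (tu j))).
by rewrite (gZr gb _ (tu i) (tu j)) gu !mulr0.
Qed.

Lemma g_1010M p (v w : tvec M) : type10 p v -> type10 p w -> g p v w = 0.
Proof.
move=> v10 w10; have [b bp] := dom_cover p.
rewrite (type10E bp v10) (type10E bp w10); apply: g_span0 => [i|i j].
  exact: tv_pd.
exact: proj1 (g_types i j bp).
Qed.

Lemma g_0101M p (v w : tvec M) : type10 p v -> type10 p w ->
  g p (conjv v) (conjv w) = 0.
Proof.
move=> v10 w10; have [b bp] := dom_cover p.
have e u : type10 p u -> conjv u =
    \sum_i conjc (u (fun q => zc i (phi b q))) *: pd b (inr i) p.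
  move=> u10; rewrite {1}(type10E bp u10) conjv_sum; apply: eq_bigr => i _.
  by rewrite conjvZ conjv_pd.
rewrite (e _ v10) (e _ w10); apply: g_span0 => [i|i j]; first exact: tv_pd.
exact: proj2 (g_types i j bp).
Qed.

Lemma iso x v w : hor x v -> hor x w ->
  G x v w = ak x * g (pr x) (push pr x v) (push pr x w).
Proof.
move=> [v1 [v2 [h1 h2 ->]]] [w1 [w2 [k1 k2 ->]]].
have T u : hz x u -> [/\ type10 x u, is_tvec x u, is_tvec x (conjv u),
    type10 (pr x) (push pr x u) & is_tvec (pr x) (push pr x u)].
  move=> [u10 _]; split=> //; first exact: type10_tv.
  - by apply: tvJ; exact: type10_tv.
  - exact: push10 (holo_at_proj x) u10.
  - exact: push_tv (holo_at_proj x) (type10_tv u10).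
have [a1 a2 a3 a4 a5] := T _ h1; have [b1 b2 b3 b4 b5] := T _ h2.
have [c1 c2 c3 c4 c5] := T _ k1; have [d1 d2 d3 d4 d5] := T _ k2.
rewrite !pushD !push_conjv.
rewrite (gDl hb) ?(gDr hb) //; last exact: tvD.
rewrite (gDl gb) ?(gDr gb) //; try exact: tvJ; last by apply: tvD => //; exact: tvJ.
rewrite (g_1010 kt a1 c1) (g_0101 kt (type01J b1) (type01J d1)).
rewrite (g_1010M a4 c4) (g_0101M b4 d4).
rewrite (iso_hz h1 k2) (g_sym hb b3 c2) (iso_hz k1 h2) (g_sym gb c5 (tvJ b5)).
by move: (ak x) (g _ _ _) (g _ _ _) => a t t'; ring.
Qed.

(** f is recovered from f o pi by composing with y s, the holomorphic section through x. *)
Lemma sn_descend x f : smooth_near x (fun z => f (pr z)) -> smooth_near (pr x) f.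
Proof.
move=> sf; have [U [s [hs Ux _]]] := triv (pr x); have [oU _ ps] := hs.
have [y0 e] := ycoordP hs Ux; set y := ycoord s x in y0 e.
have hsx := hol_section_at hs Ux.
rewrite {1}e in sf.
have s1 := sn_holo_at (holo_at_act (s (pr x)) y0) sf.
have s2 := sn_holo_at hsx s1.
apply: sn_eq s2; apply: filterS (open_nbhs_nbhs (conj oU Ux)) => q Uq.
by rewrite pr_act // ps.
Qed.

Lemma sn_ak x : smooth_near x ak.
Proof.
apply: (@sn_eq _ _ _ x (fun z => (Num.sg (kpot x))%:C%C * (kpot z)%:C%C)).
  by apply: filterS (ak_near x) => z ->.
by apply: snM; [exact: sn_cst|exact: sn_kpot].
Qed.

Lemma hor_ak x v : hor x v -> v ak = 0.
Proof.
move=> hv; have tv := hor_tv hv; rewrite (tv_eq tv (ak_near x)) (tv_scale tv).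
have -> : (fun z => (kpot z)%:C%C) = (fun z => (cc ^+ 2)^-1 * Nf z).
  by apply/funext => z; rewrite kpotE mulrC.
by rewrite (tv_scale tv) (tv_hor_Nf hv) !mulr0.
Qed.

Lemma near_tvec x X : svf (pr x) X -> \forall z \near x, is_tvec (pr z) (X (pr z)).
Proof.
move=> sX; apply: (near_pr (Q := fun q => is_tvec q (X q))).
by apply: filterS sX => q [].
Qed.

Lemma iso_lift_near x X Y : svf (pr x) X -> svf (pr x) Y ->
  \forall z \near x, G z (hlift X z) (hlift Y z) = ak z * g (pr z) (X (pr z)) (Y (pr z)).
Proof.
move=> sX sY; apply: filterS (filterI (near_tvec sX) (near_tvec sY)) => z [tX tY].
have [hX pX] := hliftP tX; have [hY pY] := hliftP tY.
by rewrite iso // pX pY.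
Qed.

(** [induced_metric] does not state smoothness; it descends from the smooth function g~(X~, Y~) /
    |K|. *)
Lemma sn_gM x X Y : svf (pr x) X -> svf (pr x) Y ->
  smooth_near (pr x) (fun q => g q (X q) (Y q)).
Proof.
move=> sX sY; apply: sn_descend.
apply: (@sn_eq _ _ _ x (fun z => (ak z)^-1 * G z (hlift X z) (hlift Y z))).
  apply: filterS (iso_lift_near sX sY) => z ->.
  by rewrite mulKf // ak_neq0.
apply: snM; first by apply: snV; [exact: sn_ak|exact: ak_neq0].
by apply: (sn_g kt); exact: svf_hlift.
Qed.

(** In the Leibniz rule for |K| g(Y, Z) o pi, the term with X~ |K| vanishes. *)
Lemma lift_g x X Y Z : svf (pr x) X -> svf (pr x) Y -> svf (pr x) Z ->
  hlift X x (fun z => G z (hlift Y z) (hlift Z z)) =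
  ak x * X (pr x) (fun q => g q (Y q) (Z q)).
Proof.
move=> sX sY sZ; have tX := svf_tv sX; have [hX pX] := hliftP tX.
have tv := hor_tv hX; have sg := sn_gM sY sZ.
rewrite (tv_eq tv (iso_lift_near sY sZ)) (tv_mul tv (sn_ak x)); last first.
  exact: (sn_holo_at (holo_at_proj x) sg).
rewrite (hor_ak hX) mul0r add0r; congr (_ * _).
exact: (hlift_pr (f := fun q => g q (Y q) (Z q)) tX sg).
Qed.

(** Extends [iso] to an arbitrary first argument, as brackets and derivatives of lifts require: the
    vertical part of v is orthogonal to w. *)
Lemma G_hor_push x v w : is_tvec x v -> hor x w ->
  G x v w = ak x * g (pr x) (push pr x v) (push pr x w).
Proof.
move=> tv hw; have [h [al [be [hh ph e]]]] := decomp tv.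
have tH := fund_tv x; have tHb := fundbar_tv x; have tw := hor_tv hw.
have [g1 g2] := G_H_hor hw.
rewrite -ph -iso // [in LHS]e (gDl hb) //; [|exact: hor_tv|by apply: tvD; exact: tvZ].
by rewrite (gDl hb) ?(gZl hb) // ?g1 ?g2 ?mulr0 ?addr0 //; exact: tvZ.
Qed.

Lemma tors_lift x X Y : svf (pr x) X -> svf (pr x) Y ->
  push pr x (tors tD (hlift X) (hlift Y) x) = tors D X Y (pr x).
Proof.
move=> sX sY; have sX' := svf_hlift sX; have sY' := svf_hlift sY.
apply: (@tv_ext _ _ _ (pr x)).
- by apply: push_tv (holo_at_proj x) _; exact: (tors_tv lt).
- exact: (tors_tv hD).
- by move=> f sf; rewrite push_tors // (torsE hD).
Qed.

(** All six terms acquire the same factor |K|: derivatives by [lift_g], brackets because only their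
    projections to M matter. *)
Lemma koszul_lift x X Y Z : svf (pr x) X -> svf (pr x) Y -> svf (pr x) Z ->
  koszul G tD (hlift X) (hlift Y) (hlift Z) x = ak x * koszul g D X Y Z (pr x).
Proof.
move=> sX sY sZ.
have Hh W : svf (pr x) W -> hor x (hlift W x) /\ push pr x (hlift W x) = W (pr x).
  by move=> sW; exact: hliftP (svf_tv sW).
have tT X' Y' : svf (pr x) X' -> svf (pr x) Y' ->
    is_tvec x (tors tD (hlift X') (hlift Y') x).
  by move=> s1 s2; apply: (tors_tv lt); exact: svf_hlift.
rewrite /koszul !lift_g // !G_hor_push; try by [exact: tT|exact: (proj1 (Hh _ _))].
rewrite !tors_lift // !(proj2 (Hh _ _)) //.
by move: (ak x) (g _ _ _) (g _ _ _) (g _ _ _) (X _ _) (Y _ _) (Z _ _) => *; ring.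
Qed.

(** Nondegeneracy comes from g~: the horizontal lift of v - w is orthogonal to every tangent vector
    t, because the pairing is |K| times that of v - w with the projection of t. *)
Lemma g_nondeg p (v w : tvec M) : is_tvec p v -> is_tvec p w ->
  (forall Z, svf p Z -> g p v (Z p) = g p w (Z p)) -> v = w.
Proof.
move=> tv tw e; apply/eqP; rewrite -subr_eq0; apply/eqP; set u := v - w.
have [U [s [hs Up _]]] := triv p; have [_ _ ps] := hs.
have pE := ps _ Up; set x := s p in pE; rewrite -pE in tv tw e.
have tu : is_tvec (pr x) u by exact: tvB.
have [h [hh ph]] := hor_ex tu.
suff h0 : h = 0 by rewrite -ph h0 push0.
apply: (pk_nondeg kt (hor_tv hh)) => t tt.
rewrite (g_sym hb (hor_tv hh) tt) (G_hor_push tt hh) ph.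
have [b bx] := dom_cover (pr x).
have tp := push_tv (holo_at_proj x) tt.
have := e _ (svf_vext (push pr x t) bx); rewrite vextE // => e'.
by rewrite (g_sym gb) // /u (gBl gb) // e' subrr mulr0.
Qed.

Lemma D_lift x X Y : svf (pr x) X -> svf (pr x) Y ->
  push pr x (tD (hlift X) (hlift Y) x) = D X Y (pr x).
Proof.
move=> sX sY; have sX' := svf_hlift sX; have sY' := svf_hlift sY.
have tW := cn_tv cD sX' sY'.
apply: (@g_nondeg (pr x)).
- exact: push_tv (holo_at_proj x) tW.
- exact: (cn_tv cDM).
move=> Z sZ; have [hZ pZ] := hliftP (svf_tv sZ).
apply: (mulfI (ak_neq0 x)); rewrite -pZ -(G_hor_push tW hZ) pZ.
apply: (mulfI (two_neq0 R)); rewrite (koszulE hb lt) //; last exact: svf_hlift.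
rewrite koszul_lift // -(koszulE gb hD) //.
by move: (ak x) (g _ _ _) => a t; ring.
Qed.

(** Differentiating g~(Y~, conj H) = 0 along X~ leaves - g~(Y~, D_X~ conj H), where D_X~ conj H is c
    times the (0,1) part of X~. The explicit value serves to compare the vertical coefficients along
    an orbit. *)
Lemma D_lift_vert x X Y : svf (pr x) X -> svf (pr x) Y -> tf10 (pr x) Y ->
  G x (tD (hlift X) (hlift Y) x) (Hb x) = - cc * (ak x * g (pr x) (Y (pr x)) (X (pr x))).
Proof.
move=> sX sY tY; have sX' := svf_hlift sX; have sY' := svf_hlift sY.
have tW := cn_tv cD sX' sY'.
have nY : \forall z \near x, hz z (hlift Y z).
  have n1 : \forall z \near x, type10 (pr z) (Y (pr z)).
    exact: (near_pr (Q := fun q => type10 q (Y q))).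
  by apply: filterS n1 => z; exact: hlift10.
have hY := nbhs_singleton nY; have [Y10 _] := hY.
have [hX pX] := hliftP (svf_tv sX); have [hY' pY] := hliftP (svf_tv sY).
have tX' := svf_tv sX'; have tY' := svf_tv sY'.
have := lcM lt sX' sY' (svf_fundbar x).
have N : \forall z \near x, G z (hlift Y z) (Hb z) = 0 by apply: filterS nY => z [].
rewrite (tv_eq tX' N) (tv_cst tX') D_fundbar // => /esym/eqP; rewrite addr_eq0 => /eqP ->.
have p10 := type10_prj x (hlift X x).
rewrite (gZr hb) //; last by apply: tvB => //; exact: type10_tv.
rewrite (gBr hb) //; last exact: type10_tv.
by rewrite (g_1010 kt Y10 p10) subr0 iso // pX pY mulNr.
Qed.

(** Proved upstairs by [D_10] and pushed forward by the holomorphic projection, instead of first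
    showing that g is pseudo-Kähler. *)
Lemma D_M10 p X Y : svf p X -> svf p Y -> tf10 p Y -> type10 p (D X Y p).
Proof.
move=> sX sY tY; have [U [s [hs Up _]]] := triv p; have [_ _ ps] := hs.
have pE := ps _ Up; set x := s p in pE; rewrite -pE in sX sY tY *.
rewrite -(D_lift sX sY); apply: push10 (holo_at_proj x) _.
apply: (D_10 kt lt (svf_hlift sX) (svf_hlift sY)).
have n1 : \forall z \near x, type10 (pr z) (Y (pr z)).
  exact: (near_pr (Q := fun q => type10 q (Y q))).
by apply: filterS n1 => z /(@hlift10 _ _ P Y)[].
Qed.

End Isometry.

(** * The bundle H and the projected connection *)

Section Classes.
Variables (R : realType) (n : nat) (P : proj_kahler R n).
Local Notation C := R[i].
Local Notation tM := (tot P).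
Local Notation M := (base P).
Local Notation pr := (@Defs.proj R n P).
Local Notation H := (@fund R n P).
Local Notation Hb := (@fundbar R n P).
Local Notation G := (@tmet R n P).
Local Notation hz := (@hz R n P).
Implicit Types (x z : tM) (p q : M) (v w : tvec tM) (X Y Z : vfield M)
  (A : Helt P) (xi : M -> Helt P).

Let kt := tmet_kahler P.
Let hb := pk_bilin kt.

Lemma push_act_act (b b' : C) x v : b != 0 -> b' != 0 ->
  push (act b') (act b x) (push (act b) x v) = push (act (b' * b)) x v.
Proof.
move=> b0 b'0; rewrite push_comp; last exact: holo_at_act.
by congr (push _ _ _); apply/funext => z; rewrite actM.
Qed.

Lemma push_act1 x v : is_tvec x v -> push (act 1) x v = v.
Proof.
move=> tv; rewrite -[RHS](push_id tv); congr (push _ _ _).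
by apply/funext => z; rewrite act1.
Qed.

Lemma push_pr_act (b : C) x v : b != 0 ->
  push pr (act b x) (push (act b) x v) = push pr x v.
Proof.
move=> b0; rewrite push_comp; last exact: holo_at_proj.
by congr (push _ _ _); apply/funext => z; rewrite pr_act.
Qed.

Lemma act_over x x' : pr x' = pr x -> exists b, b != 0 /\ x' = act b x.
Proof. by move=> e; apply/proj_fib. Qed.

Lemma Hclass_self x v : is_tvec x v -> Hclass x v (x, v).
Proof.
by move=> tv; exists 1; rewrite oner_eq0 act1 push_act1 // invr1 scale1r.
Qed.

(** As the action is free, a class has only one representative at each point of its fibre. *)
Lemma Hclass_fun x v v' : is_tvec x v -> Hclass x v (x, v') -> v' = v.
Proof.
move=> tv [b [b0 [e ->]]]; have b1 : b = 1 by exact: (act_free b0 (esym e)).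
by rewrite b1 invr1 scale1r push_act1.
Qed.

Lemma Hclass_inj x v w : is_tvec x v -> is_tvec x w -> Hclass x v = Hclass x w -> v = w.
Proof.
by move=> tv tw e; apply: (Hclass_fun tw); rewrite -e; exact: Hclass_self.
Qed.

(** Moves the representative of a class from x to [act b x]. A field V defines a section of H
    exactly when it is compatible with this transport. *)
Definition tr (b : C) x v : tvec tM := b^-1 *: push (act b) x v.

Lemma Hclass_move (b : C) x v : b != 0 -> Hclass (act b x) (tr b x v) = Hclass x v.
Proof.
move=> b0; apply/seteqP; split=> q [b' [b'0 ->]].
  exists (b' * b); split; first exact: mulf_neq0.
  by rewrite -actM // /tr pushZ push_act_act // scalerA invfM.
exists (b' / b); split; first by rewrite mulf_neq0 ?invr_neq0.
rewrite /tr pushZ push_act_act ?mulf_neq0 ?invr_neq0 // divfK // scalerA.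
by rewrite -actM ?mulf_neq0 ?invr_neq0 // divfK // invfM invrK mulfK.
Qed.

Lemma tr_tv (b : C) x v : b != 0 -> is_tvec x v -> is_tvec (act b x) (tr b x v).
Proof. by move=> b0 tv; apply: tvZ; apply: push_tv => //; exact: holo_at_act. Qed.

(** Since c g~(v, conj H) = v N for v of type (1,0), the scaling law of N replaces a scaling law for
    the whole metric. *)
Lemma hz_push (b : C) x v : b != 0 -> hz x v -> hz (act b x) (push (act b) x v).
Proof.
move=> b0 [v10 gv]; have hA := holo_at_act x b0; have p10 := push10 hA v10.
split=> //; apply: (mulfI (cc_neq0 P)); rewrite mulr0 -(tv_Nf p10).
rewrite pushE; last exact: sn_Nf.
have -> : (fun y : tM => Nf (act b y)) = (fun y : tM => b * conjc b * Nf y).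
  by apply/funext => y; rewrite Nf_act.
by rewrite (tv_scale (type10_tv v10)) (tv_Nf v10) gv !mulr0.
Qed.

Lemma hz_tr (b : C) x v : b != 0 -> hz x v -> hz (act b x) (tr b x v).
Proof. by move=> b0 hv; apply: hzZ; exact: hz_push. Qed.

Lemma tr_fund (b k : C) x : b != 0 -> tr b x (k *: H x) = (b^-1 * k) *: H (act b x).
Proof. by move=> b0; rewrite /tr pushZ push_act_fund // scalerA. Qed.

Lemma hlift_act (b : C) x X : b != 0 -> is_tvec (pr x) (X (pr x)) ->
  hlift X (act b x) = push (act b) x (hlift X x).
Proof.
move=> b0 tX; have [[v1 [v2 [h1 h2 e]]] pX] := hliftP tX.
apply: hliftE; last by rewrite push_pr_act // pX pr_act.
exists (push (act b) x v1), (push (act b) x v2).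
by split; [exact: hz_push|exact: hz_push|rewrite e pushD push_conjv].
Qed.

(** By freeness, two representatives at the same point come from the same b. *)
Lemma hadd_cl x v w : hadd (Hclass x v) (Hclass x w) = Hclass x (v + w).
Proof.
apply/seteqP; split=> [[x' u] [v1 [w1 [[b [b0 [e1 ->]]] [b' [b'0 [e2 ->]]] /= ->]]]|].
  have bb : b' = b by apply: (@act_inj _ _ P _ _ x) => //; rewrite -e1 -e2.
  by exists b; rewrite bb e1 pushD scalerDr.
move=> _ [b [b0 ->]]; exists (tr b x v), (tr b x w).
by split; [exists b|exists b|rewrite /= pushD scalerDr].
Qed.

Lemma hscale_cl k x v : hscale k (Hclass x v) = Hclass x (k *: v).
Proof.
apply/seteqP; split=> [[x' u] [v1 [[b [b0 [e1 ->]]] /= ->]]|].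
  by exists b; rewrite e1 pushZ !scalerA mulrC.
move=> _ [b [b0 ->]]; exists (tr b x v).
by split; [exists b|rewrite /= pushZ /tr !scalerA mulrC].
Qed.

Definition hpart x v : tvec tM := v - (G x v (Hb x) / Nf x) *: H x.

Lemma hpart_hz x v : type10 x v -> hz x (hpart x v).
Proof.
move=> v10; have tv := type10_tv v10; have tH := fund_tv x; have tHb := fundbar_tv x.
split; first by apply: type10B => //; apply: type10Z; exact: fund10.
rewrite (gBl hb tv (tvZ _ tH) tHb) (gZl hb _ tH tHb).
by rewrite -[G x (H x) (Hb x)]/(Nf x) mulrVK ?subrr // unitfE Nf_neq0.
Qed.

Lemma push_hpart x v : push pr x (hpart x v) = push pr x v.
Proof. by rewrite pushB pushZ push_pr_fund scaler0 subr0. Qed.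

Lemma hpart_uniq x v w (k : C) : hz x w -> v = w + k *: H x -> hpart x v = w.
Proof.
move=> hw e; have v10 : type10 x v.
  by rewrite e; apply: type10D; [case: hw|apply: type10Z; exact: fund10].
apply: (hz_inj (hpart_hz v10) hw); rewrite push_hpart e pushD pushZ push_pr_fund.
by rewrite scaler0 addr0.
Qed.

Lemma hpart_id x v : hz x v -> hpart x v = v.
Proof. by move=> hv; apply: (@hpart_uniq _ _ _ 0) => //; rewrite scale0r addr0. Qed.

Lemma hpartD x v w : is_tvec x v -> is_tvec x w ->
  hpart x (v + w) = hpart x v + hpart x w.
Proof.
move=> tv tw; rewrite /hpart (gDl hb) //; last exact: fundbar_tv.
by rewrite mulrDl scalerDl opprD addrACA.
Qed.

Lemma hpartZ x (k : C) v : is_tvec x v -> hpart x (k *: v) = k *: hpart x v.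
Proof.
move=> tv; rewrite /hpart (gZl hb) //; last exact: fundbar_tv.
by rewrite scalerBr scalerA mulrA.
Qed.

Lemma hpart_tr (b : C) x v : b != 0 -> type10 x v ->
  hpart (act b x) (tr b x v) = tr b x (hpart x v).
Proof.
move=> b0 v10; have e : v = hpart x v + (G x v (Hb x) / Nf x) *: H x by rewrite subrK.
apply: (hpart_uniq (k := b^-1 * (G x v (Hb x) / Nf x))).
  exact: hz_tr (hpart_hz v10).
by rewrite -tr_fund // -scalerDr -pushD -e.
Qed.

Lemma p_h_cl x v : type10 x v -> p_h (Hclass x v) = Hclass x (hpart x v).
Proof.
move=> v10; apply/seteqP; split=> [[x' u] [v1 [l [[b [b0 [/= -> ->]]] /= hu e]]]|].
  exists b; split=> //; congr (_, _); have hu' := proj1 (horP _ _) hu.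
  by rewrite -(hpart_uniq hu' e) -/(tr b x v) hpart_tr.
move=> _ [b [b0 ->]]; exists (tr b x v), (G (act b x) (tr b x v) (Hb (act b x)) / Nf (act b x)).
split; [by exists b|apply/horP; apply: hz_tr b0 (hpart_hz v10)|].
by rewrite /= -/(tr b x (hpart x v)) -hpart_tr // subrK.
Qed.

Lemma inhor_at x A : inhor (pr x) A -> exists v, hz x v /\ A = Hclass x v.
Proof.
move=> [x' [v [e /horP hv ->]]]; have [b [b0 xb]] := act_over (esym e).
by exists (tr b x' v); rewrite xb Hclass_move //; split; [exact: hz_tr|].
Qed.

Lemma inL_at x A : inL (pr x) A -> exists l : C, A = Hclass x (l *: H x).
Proof.
move=> [x' [l [e ->]]]; have [b [b0 xb]] := act_over (esym e).
exists (b^-1 * l); rewrite -(Hclass_move x' (l *: H x') b0) tr_fund //.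
by rewrite xb.
Qed.

Lemma inhorP x v : hz x v -> inhor (pr x) (Hclass x v).
Proof. by move=> hv; exists x, v; split=> //; apply/horP. Qed.

Lemma inLP x l : inL (pr x) (Hclass x (l *: H x)).
Proof. by exists x, l. Qed.

Lemma field_ofE xi x v : is_tvec x v -> xi (pr x) = Hclass x v -> field_of xi x = v.
Proof.
move=> tv e; apply: (Hclass_fun tv); rewrite -e /field_of.
have : [set v | xi (pr x) (x, v)] (xget 0 [set v | xi (pr x) (x, v)]).
  by apply: xgetPex; exists v => /=; rewrite e; exact: Hclass_self.
by [].
Qed.

Lemma field_of_hor xi x : inhor (pr x) (xi (pr x)) ->
  hz x (field_of xi x) /\ xi (pr x) = Hclass x (field_of xi x).
Proof.
move=> /inhor_at[v [hv e]]; have [v10 _] := hv.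
by rewrite (field_ofE (type10_tv v10) e).
Qed.

(** For a section of L, the function sigma whose product with H is the associated field. *)
Definition coefL xi x : C := G x (field_of xi x) (Hb x) / Nf x.

Lemma coefLE x (l : C) xi : xi (pr x) = Hclass x (l *: H x) ->
  field_of xi x = l *: H x /\ coefL xi x = l.
Proof.
move=> e; have tH := fund_tv x; have e1 := field_ofE (tvZ l tH) e.
split=> //; rewrite /coefL e1 (gZl hb _ tH (fundbar_tv x)).
by rewrite -[G x (H x) (Hb x)]/(Nf x) mulfK // Nf_neq0.
Qed.

Lemma field_of_L xi x : inL (pr x) (xi (pr x)) ->
  field_of xi x = coefL xi x *: H x /\ xi (pr x) = Hclass x (coefL xi x *: H x).
Proof. by move=> /inL_at[l e]; have [e1 e2] := coefLE e; rewrite e2. Qed.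

Lemma class_ofE (V : vfield tM) x :
  (forall b, b != 0 -> V (act b x) = tr b x (V x)) ->
  class_of V (pr x) = Hclass x (V x).
Proof.
move=> eV; apply/seteqP; split=> [[x' u] [/= e ->]|].
  have [b [b0 ->]] := act_over e; exists b; split=> //; congr (_, _).
  exact: eV.
by move=> _ [b [b0 ->]]; split; rewrite /= ?pr_act // eV.
Qed.

Lemma sec_svf inB (U : set M) xi x : open U -> sec_in inB U xi -> U (pr x) ->
  svf x (field_of xi).
Proof.
move=> oU [_ sF] Ux; move/(smooth_vfP _ (open_pr oU)): sF; exact.
Qed.

Lemma sec_sub inB (U V : set M) xi : open U -> open V -> V `<=` U ->
  sec_in inB U xi -> sec_in inB V xi.
Proof.
move=> oU oV VU sx; have [ix _] := sx; split=> [p /VU /ix //|].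
by apply/(smooth_vfP _ (open_pr oV)) => x /VU; exact: sec_svf sx.
Qed.

Lemma sec_inP inB (U : set M) xi : open U ->
  (forall p, U p -> inB p (xi p)) -> (forall x, U (pr x) -> svf x (field_of xi)) ->
  sec_in inB U xi.
Proof. by move=> oU ix sx; split=> //; apply/(smooth_vfP _ (open_pr oU)). Qed.

Lemma near_U (U : set M) x : open U -> U (pr x) -> \forall z \near x, U (pr z).
Proof. by move=> oU Ux; apply: near_pr; exact: open_nbhs_nbhs. Qed.

Lemma pr_surj p : exists x, pr x = p.
Proof. by have [U [s [[_ _ ps] Up _]]] := triv p; exists (s p); rewrite ps. Qed.

Lemma sn_coefL xi x : svf x (field_of xi) -> smooth_near x (coefL xi).
Proof.
move=> sF; apply: snM; first by apply: (sn_g kt) => //; exact: svf_fundbar.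
by apply: snV; [exact: sn_Nf|exact: Nf_neq0].
Qed.

Lemma ycoord_act (U : set M) s (b : C) x : hol_section U s -> U (pr x) -> b != 0 ->
  ycoord s (act b x) = b * ycoord s x.
Proof.
move=> hs Ux b0; have [y0 e] := ycoordP hs Ux; apply: (ycoordE hs).
- by rewrite pr_act.
- exact: mulf_neq0.
- by rewrite pr_act // actM // -e.
Qed.

Section LocalForm.
Variables (U : set M) (xi : M -> Helt P).
Hypotheses (oU : open U) (sxi : sechor U xi).

Lemma field_hz x : U (pr x) -> hz x (field_of xi x).
Proof. by move=> Ux; have [ix _] := sxi; have [] := field_of_hor (ix _ Ux). Qed.

Lemma field_tr x (b : C) : U (pr x) -> b != 0 ->
  field_of xi (act b x) = tr b x (field_of xi x).
Proof.
move=> Ux b0; have [ix _] := sxi; have [[h10 _] e] := field_of_hor (ix _ Ux).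
apply: field_ofE; first by apply: tr_tv => //; exact: type10_tv.
by rewrite pr_act // Hclass_move.
Qed.

Variables (V : set M) (s : M -> tM).
Hypothesis hs : hol_section V s.

(** The vector field on M that represents xi when L is trivialized by the section s. *)
Definition Yloc : vfield M := fun q => push pr (s q) (field_of xi (s q)).

Lemma svf_Yloc q : U q -> V q -> svf q Yloc.
Proof.
move=> Uq Vq; have [oV _ ps] := hs.
have N : \forall q' \near q, U q' /\ V q' by apply: filterI; exact: open_nbhs_nbhs.
apply: filterS (near_join N) => q' nq'; have [Uq' Vq'] := nbhs_singleton nq'.
have U' : U (pr (s q')) by rewrite ps.
have sF := sec_svf oU sxi U'.
split.
  by rewrite -[X in is_tvec X _](ps _ Vq'); apply: push_tv;
    [exact: holo_at_proj|exact: svf_tv].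
move=> f sf; have hsq := hol_section_at hs Vq'.
have sf' : smooth_near (pr (s q')) f by rewrite ps.
have s1 := svf_sn sF (sn_holo_at (holo_at_proj (s q')) sf').
apply: sn_eq (sn_holo_at hsq s1).
apply: filterS (filterI nq' (sn_near sf)) => q1 [[_ V1] sf1].
by rewrite /Yloc pushE // ps.
Qed.

Lemma Yloc10 q : U q -> V q -> type10 q (Yloc q).
Proof.
move=> Uq Vq; have [_ _ ps] := hs; rewrite -[X in type10 X _](ps _ Vq).
apply: push10 (holo_at_proj _) _.
by have [] := @field_hz (s q); rewrite ?ps.
Qed.

(** On the section s both sides agree by construction of [Yloc]; the transport from s to x supplies
    the factor y^-1. *)
Lemma field_loc x : U (pr x) -> V (pr x) ->
  field_of xi x = (ycoord s x)^-1 *: hlift Yloc x.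
Proof.
move=> Ux Vx; have [_ _ ps] := hs; have [y0 e] := ycoordP hs Vx.
have Y10 := Yloc10 Ux Vx; have [_ pY] := hliftP (type10_tv Y10).
apply: (hz_inj (field_hz Ux)); first by apply: hzZ; exact: hlift10.
rewrite pushZ pY {2}e field_tr ?ps // {1}e /tr pushZ push_pr_act //.
Qed.

End LocalForm.

End Classes.

(** * The projected connection on hor(H) *)

Section HatConnection.
Variables (R : realType) (n : nat) (P : proj_kahler R n).
Local Notation C := R[i].
Local Notation tM := (tot P).
Local Notation M := (base P).
Local Notation pr := (@Defs.proj R n P).
Local Notation H := (@fund R n P).
Local Notation Hb := (@fundbar R n P).
Local Notation G := (@tmet R n P).
Local Notation cc := ((Defs.cst P)%:C%C).
Local Notation tD := (@tD R n P).
Local Notation hz := (@hz R n P).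
Implicit Types (x z : tM) (p q : M) (v w : tvec tM) (X Y Z : vfield M)
  (A : Helt P) (xi : M -> Helt P) (f : M -> C).

Let kt := tmet_kahler P.
Let lt := tD_lc P.
Let cD := lc_conn lt.

Variable g : tensor2 M.
Hypothesis hg : induced_metric g.
Variable D : vfield M -> vfield M -> vfield M.
Hypothesis hD : levi_civita g D.

Lemma svf_on (U : set M) X p : open U -> smooth_vf U X -> U p -> svf p X.
Proof. by move=> oU /(smooth_vfP _ oU) sX; exact: sX. Qed.

Lemma smooth_on (U : set M) f p : open U -> smooth_fun U f -> U p -> smooth_near p f.
Proof. by move=> oU sf Up; exists U. Qed.

Section DLift.
Variables (X Y : vfield M) (x : tM).
Hypotheses (sX : svf (pr x) X) (sY : svf (pr x) Y) (tY : tf10 (pr x) Y).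

Let v := tD (hlift X) (hlift Y) x.
Definition kap : C := G x v (Hb x) / Nf x.

Lemma D_lift_tot10 : type10 x v.
Proof.
apply: (D_10 kt lt (svf_hlift sX) (svf_hlift sY)).
have n1 : \forall z \near x, type10 (pr z) (Y (pr z)).
  exact: (near_pr (Q := fun q => type10 q (Y q))).
by apply: filterS n1 => z /(@hlift10 _ _ P Y)[].
Qed.

Lemma hpart_D_lift : hpart x v = hlift (D X Y) x.
Proof.
have v10 := D_lift_tot10; have D10 := D_M10 hg hD sX sY tY.
apply: (hz_inj (hpart_hz v10) (hlift10 D10)).
by rewrite push_hpart (D_lift hg hD sX sY); have [_ ->] := hliftP (type10_tv D10).
Qed.

Lemma D_lift_tot : v = hlift (D X Y) x + kap *: H x.
Proof. by rewrite -hpart_D_lift subrK. Qed.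

Lemma kapE : kap = - cc * (ak x * g (pr x) (Y (pr x)) (X (pr x))) / Nf x.
Proof. by rewrite /kap /v (D_lift_vert hg hD sX sY tY). Qed.

End DLift.

Lemma ak_act (b : C) x : b != 0 -> ak (act b x) = b * conjc b * ak x.
Proof.
move=> b0; rewrite /ak !normrEsg kpot_sg //.
have M2 (r t : R) : (r * t)%:C%C = r%:C%C * t%:C%C :> C by rewrite rmorphM.
rewrite (M2 (Num.sg _) (kpot (act b x))) (M2 (Num.sg _) (kpot x)) kpot_act //.
by move: (_%:C%C) (_%:C%C) (conjc b) => *; ring.
Qed.

(** By [kapE] the coefficient is - c |K| g(Y, X) / N, and both |K| and N scale by b conj b. *)
Lemma kap_act X Y (b : C) x : b != 0 -> svf (pr x) X -> svf (pr x) Y ->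
  tf10 (pr x) Y -> kap X Y (act b x) = kap X Y x.
Proof.
move=> b0 sX sY tY; rewrite (kapE sX sY tY) (@kapE X Y (act b x)) ?pr_act //.
rewrite ak_act // Nf_act //; have : conjc b != 0 by rewrite conjc_eq0.
move: (conjc b) (Nf x) (Nf_neq0 x) (ak x) (g _ _ _) cc => c N N0 a t k c0.
by field; rewrite b0 c0 N0.
Qed.

Section OneSection.
Variables (U : set M) (X : vfield M) (xi : M -> Helt P).
Hypotheses (oU : open U) (uX : smooth_vf U X) (sxi : sechor U xi).

Let F := field_of xi.
Let W := tD (hlift X) F.

Lemma near_hz x : U (pr x) -> \forall z \near x, hz z (F z).
Proof.
move=> Ux; apply: filterS (near_U oU Ux) => z Uz.
by have [ix _] := sxi; have [] := field_of_hor (ix _ Uz).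
Qed.

Lemma svf_F x : U (pr x) -> svf x F.
Proof. by move=> Ux; exact: (sec_svf oU sxi Ux). Qed.

Lemma svf_X x : U (pr x) -> svf x (hlift X).
Proof. by move=> Ux; apply: svf_hlift; exact: svf_on uX Ux. Qed.

Lemma svf_W x : U (pr x) -> svf x W.
Proof. by move=> Ux; apply: (cn_svf cD); [exact: svf_X|exact: svf_F]. Qed.

Lemma W10 x : U (pr x) -> type10 x (W x).
Proof.
move=> Ux; apply: (D_10 kt lt (svf_X Ux) (svf_F Ux)).
by apply: filterS (near_hz Ux) => z [].
Qed.

Section Local.
Variables (V : set M) (s : M -> tM).
Hypothesis hs : hol_section V s.
Let Y := Yloc xi s.
Let si z : C := (ycoord s z)^-1.

Lemma sn_si x : V (pr x) -> smooth_near x si.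
Proof.
move=> Vx; have [sy _] := ycoord_sn_holo hs Vx.
by apply: snV => //; have [] := ycoordP hs Vx.
Qed.

Lemma near_UV x : U (pr x) -> V (pr x) -> \forall z \near x, U (pr z) /\ V (pr z).
Proof.
have [oV _ _] := hs => Ux Vx.
by apply: filterI; exact: near_U.
Qed.

Lemma svf_Y x : U (pr x) -> V (pr x) -> svf (pr x) Y /\ tf10 (pr x) Y.
Proof.
move=> Ux Vx; have [oV _ _] := hs; split; first exact: (svf_Yloc oU sxi hs Ux Vx).
have N : \forall q \near pr x, U q /\ V q by apply: filterI; exact: open_nbhs_nbhs.
by apply: filterS N => q [Uq Vq]; exact: (Yloc10 sxi hs Uq Vq).
Qed.

Lemma W_loc x : U (pr x) -> V (pr x) ->
  W x = hlift X x si *: hlift Y x +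
        si x *: (hlift (D X Y) x + kap X Y x *: H x).
Proof.
move=> Ux Vx; have [sY tY] := svf_Y Ux Vx.
have sX := svf_on oU uX Ux; have sX' := svf_X Ux.
have eF : \forall z \near x, F z = si z *: hlift Y z.
  by apply: filterS (near_UV Ux Vx) => z [Uz Vz]; exact: (field_loc sxi hs).
rewrite -D_lift_tot // -(proj2 (cnZ cD (sn_si Vx) sX' (svf_hlift sY))).
apply: (cn_eq cD sX' (svf_F Ux)) => //.
exact: filterS filterT.
Qed.

Lemma X_si x (b : C) : U (pr x) -> V (pr x) -> b != 0 ->
  hlift X (act b x) si = b^-1 * hlift X x si.
Proof.
move=> Ux Vx b0; have tX := svf_tv (svf_on oU uX Ux).
have Vb : V (pr (act b x)) by rewrite pr_act.
rewrite hlift_act // pushE; last exact: sn_si.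
have tv := svf_tv (svf_X Ux); rewrite -(tv_scale tv); apply: (tv_eq tv).
apply: filterS (near_UV Ux Vx) => z [_ Vz].
by rewrite /si (ycoord_act hs Vz b0) invfM.
Qed.

(** Read off from [W_loc]: lifts and H are invariant, y^-1 and its derivative along X~ have weight
    -1, and [kap] has weight 0. *)
Lemma W_tr_loc x (b : C) : U (pr x) -> V (pr x) -> b != 0 -> W (act b x) = tr b x (W x).
Proof.
move=> Ux Vx b0; have [sY tY] := svf_Y Ux Vx; have sX := svf_on oU uX Ux.
have D10 := D_M10 hg hD sX sY tY; have tX := svf_tv sX; have tY' := svf_tv sY.
rewrite (W_loc Ux Vx) (@W_loc (act b x)) ?pr_act // kap_act // X_si //.
rewrite !hlift_act //; last exact: type10_tv.
have -> : si (act b x) = b^-1 * si x by rewrite /si (ycoord_act hs Vx b0) invfM.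
rewrite /tr pushD !pushZ pushD pushZ push_act_fund //.
by rewrite [RHS]scalerDr !scalerA.
Qed.

End Local.

Lemma W_tr x (b : C) : U (pr x) -> b != 0 -> W (act b x) = tr b x (W x).
Proof.
by move=> Ux b0; have [V [s [hs Vx _]]] := triv (pr x); exact: (W_tr_loc hs Ux Vx b0).
Qed.

Lemma calD_at x : U (pr x) -> calD X xi (pr x) = Hclass x (W x).
Proof. by move=> Ux; apply: class_ofE => b; exact: W_tr. Qed.

Lemma hatD_at x : U (pr x) -> hatD X xi (pr x) = Hclass x (hpart x (W x)).
Proof. by move=> Ux; rewrite /hatD calD_at // p_h_cl //; exact: W10. Qed.

Lemma secH_calD : secH U (calD X xi).
Proof.
apply: sec_inP => // [p Up|x Ux].
  have [x e] := pr_surj p; rewrite -e in Up *.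
  by exists x, (W x); split=> //; [exact: W10|exact: calD_at].
apply: svf_eq (svf_W Ux); apply: filterS (near_U oU Ux) => z Uz.
by rewrite (field_ofE _ (calD_at Uz)) //; exact: type10_tv (W10 Uz).
Qed.

Lemma field_hatD x : U (pr x) -> field_of (hatD X xi) x = hpart x (W x).
Proof.
move=> Ux; apply: (field_ofE _ (hatD_at Ux)).
by have [h10 _] := hpart_hz (W10 Ux); exact: type10_tv.
Qed.

Lemma sechor_hatD : sechor U (hatD X xi).
Proof.
apply: sec_inP => // [p Up|x Ux].
  have [x e] := pr_surj p; rewrite -e in Up *.
  by rewrite hatD_at //; apply: inhorP; exact: hpart_hz (W10 Up).
apply: (@svf_eq _ _ _ _ (fun z => W z - (G z (W z) (Hb z) / Nf z) *: H z)).
  by apply: filterS (near_U oU Ux) => z Uz; rewrite field_hatD.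
have sW := svf_W Ux; apply: svfB => //; apply: svfZ; last exact: svf_fund.
apply: snM; first by apply: (sn_g kt) => //; exact: svf_fundbar.
by apply: snV; [exact: sn_Nf|exact: Nf_neq0].
Qed.

End OneSection.

Lemma hor_sum_hlift X X' x : is_tvec (pr x) (X (pr x)) -> is_tvec (pr x) (X' (pr x)) ->
  hlift (fun q => X q + X' q) x = hlift X x + hlift X' x.
Proof.
move=> tX tX'; have [h1 p1] := hliftP tX; have [h2 p2] := hliftP tX'.
apply: hliftE; last by rewrite pushD p1 p2.
move: h1 h2 => [a1 [a2 [k1 k2 ->]]] [b1 [b2 [l1 l2 ->]]].
exists (a1 + b1), (a2 + b2); split; [exact: hzD|exact: hzD|].
by rewrite conjvD addrACA.
Qed.

Lemma hlift_scale f X x : is_tvec (pr x) (X (pr x)) ->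
  hlift (fun q => f q *: X q) x = f (pr x) *: hlift X x.
Proof.
move=> tX; have [h1 p1] := hliftP tX.
apply: hliftE; last by rewrite pushZ p1.
move: h1 => [a1 [a2 [k1 k2 ->]]].
exists (f (pr x) *: a1), (conjc (f (pr x)) *: a2); split; [exact: hzZ|exact: hzZ|].
by rewrite scalerDr conjvZ conjcK.
Qed.

Lemma hatD_local (U : set M) X xi xi' p : open U -> smooth_vf U X ->
  sechor U xi -> sechor U xi' -> U p -> (forall q, U q -> xi q = xi' q) ->
  hatD X xi p = hatD X xi' p.
Proof.
move=> oU uX sxi sxi' Up e; have [x px] := pr_surj p; rewrite -px in Up *.
rewrite (hatD_at oU uX sxi Up) (hatD_at oU uX sxi' Up); congr (Hclass x (hpart x _)).
apply: (cn_eq cD); [exact: (svf_X oU uX Up)|exact: (svf_F oU sxi Up)|exact: filterS filterT|].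
apply: filterS (near_U oU Up) => z Uz.
by rewrite /field_of e.
Qed.

Lemma sechor_add (U : set M) xi xi' : open U -> sechor U xi -> sechor U xi' ->
  sechor U (fun q => hadd (xi q) (xi' q)) /\
  forall x, U (pr x) -> field_of (fun q => hadd (xi q) (xi' q)) x =
    field_of xi x + field_of xi' x.
Proof.
move=> oU sxi sxi'; have [ix _] := sxi; have [ix' _] := sxi'.
have key x : U (pr x) -> hz x (field_of xi x + field_of xi' x) /\
    hadd (xi (pr x)) (xi' (pr x)) = Hclass x (field_of xi x + field_of xi' x).
  move=> Ux; have [h e] := field_of_hor (ix _ Ux); have [h' e'] := field_of_hor (ix' _ Ux).
  by split; [exact: hzD|rewrite {1}e {1}e' hadd_cl].
have fE x : U (pr x) -> field_of (fun q => hadd (xi q) (xi' q)) x =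
    field_of xi x + field_of xi' x.
  move=> Ux; have [[h10 _] e] := key x Ux.
  by apply: field_ofE => //; exact: type10_tv.
split=> //; apply: sec_inP => // [p Up|x Ux].
  by have [x px] := pr_surj p; rewrite -px in Up *; have [h ->] := key x Up; exact: inhorP.
apply: svf_eq (svfD (sec_svf oU sxi Ux) (sec_svf oU sxi' Ux)).
by apply: filterS (near_U oU Ux) => z Uz; rewrite fE.
Qed.

Lemma sechor_scale (U : set M) f xi : open U -> smooth_fun U f -> sechor U xi ->
  sechor U (fun q => hscale (f q) (xi q)) /\
  forall x, U (pr x) -> field_of (fun q => hscale (f q) (xi q)) x =
    f (pr x) *: field_of xi x.
Proof.
move=> oU sf sxi; have [ix _] := sxi.
have key x : U (pr x) -> hz x (f (pr x) *: field_of xi x) /\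
    hscale (f (pr x)) (xi (pr x)) = Hclass x (f (pr x) *: field_of xi x).
  move=> Ux; have [h e] := field_of_hor (ix _ Ux).
  by split; [exact: hzZ|rewrite {1}e hscale_cl].
have fE x : U (pr x) -> field_of (fun q => hscale (f q) (xi q)) x =
    f (pr x) *: field_of xi x.
  move=> Ux; have [[h10 _] e] := key x Ux.
  by apply: field_ofE => //; exact: type10_tv.
split=> //; apply: sec_inP => // [p Up|x Ux].
  by have [x px] := pr_surj p; rewrite -px in Up *; have [h ->] := key x Up; exact: inhorP.
have sfx : smooth_near x (fun z => f (pr z)).
  by apply: (sn_holo_at (holo_at_proj x)); exact: smooth_on sf Ux.
apply: svf_eq (svfZ sfx (sec_svf oU sxi Ux)).
by apply: filterS (near_U oU Ux) => z Uz; rewrite fE.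
Qed.

(** The axioms pass from D~ because [hlift] and [hpart] are linear over the relevant functions; in
    the Leibniz rule [hpart] fixes the term (X f) xi~, as xi~ is horizontal. *)
Lemma hatD_connection :
  is_connection (@hadd R n P) (@hscale R n P) (@sechor R n P) (@hatD R n P).
Proof.
move=> U X X' xi xi' f oU uX uX' sxi sxi' uf; split; first exact: sechor_hatD.
move=> p Up; have [x px] := pr_surj p; rewrite -px in Up *.
have sX := svf_on oU uX Up; have sX' := svf_on oU uX' Up.
have lX := svf_X oU uX Up; have lX' := svf_X oU uX' Up.
have sF := svf_F oU sxi Up; have sF' := svf_F oU sxi' Up.
have sf := smooth_on oU uf Up; have sfx := sn_holo_at (holo_at_proj x) sf.
have uXX : smooth_vf U (fun q => X q + X' q).
  apply/(smooth_vfP _ oU) => q Uq.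
  by apply: svfD; [exact: svf_on uX Uq|exact: svf_on uX' Uq].
have ufX : smooth_vf U (fun q => f q *: X q).
  apply/(smooth_vfP _ oU) => q Uq.
  by apply: svfZ; [exact: smooth_on uf Uq|exact: svf_on uX Uq].
have [sadd fadd] := sechor_add oU sxi sxi'.
have [sscal fscal] := sechor_scale oU uf sxi.
have w1 := type10_tv (W10 oU uX sxi Up); have w2 := type10_tv (W10 oU uX' sxi Up).
have w3 := type10_tv (W10 oU uX sxi' Up).
have eTT (T : vfield tM) : \forall z \near x, T z = T z by exact: filterS filterT.
split.
- rewrite (hatD_at oU uXX sxi Up) (hatD_at oU uX sxi Up) (hatD_at oU uX' sxi Up).
  rewrite hadd_cl -hpartD // -(cnDl cD lX lX' sF); congr (Hclass x (hpart x _)).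
  apply: (cn_eq cD) => //; first exact: (svf_X oU uXX Up).
  apply: filterS (filterI (near_tvec sX) (near_tvec sX')) => z [tX tX'].
  exact: hor_sum_hlift.
- rewrite (hatD_at oU ufX sxi Up) (hatD_at oU uX sxi Up).
  rewrite hscale_cl -hpartZ // -(proj1 (cnZ cD sfx lX sF)); congr (Hclass x (hpart x _)).
  apply: (cn_eq cD) => //; first exact: (svf_X oU ufX Up).
  by apply: filterS (near_tvec sX) => z tX; exact: hlift_scale.
- rewrite (hatD_at oU uX sadd Up) (hatD_at oU uX sxi Up) (hatD_at oU uX sxi' Up).
  rewrite hadd_cl -hpartD // -(cnDr cD lX sF sF'); congr (Hclass x (hpart x _)).
  apply: (cn_eq cD) => //; first exact: (svf_F oU sadd Up).
  by apply: filterS (near_U oU Up) => z Uz; exact: fadd.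
rewrite (hatD_at oU uX sscal Up) (hatD_at oU uX sxi Up).
have [ix _] := sxi; have [hF eF] := field_of_hor (ix _ Up).
rewrite [in RHS]eF !hscale_cl hadd_cl; congr (Hclass x _).
have -> : tD (hlift X) (field_of (fun q => hscale (f q) (xi q))) x =
    tD (hlift X) (fun z => f (pr z) *: field_of xi z) x.
  apply: (cn_eq cD) => //; first exact: (svf_F oU sscal Up).
  by apply: filterS (near_U oU Up) => z Uz; exact: fscal.
rewrite (proj2 (cnZ cD sfx lX sF)) (hlift_pr (svf_tv sX) sf).
have [F10 _] := hF; have tF := type10_tv F10.
by rewrite hpartD ?hpartZ ?(hpart_id hF) //; exact: tvZ.
Qed.

End HatConnection.

(** * The Chern connection of L and the tensor product *)

Section LineBundle.
Variables (R : realType) (n : nat) (P : proj_kahler R n).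
Local Notation C := R[i].
Local Notation tM := (tot P).
Local Notation M := (base P).
Local Notation pr := (@Defs.proj R n P).
Local Notation H := (@fund R n P).
Local Notation Hb := (@fundbar R n P).
Local Notation G := (@tmet R n P).
Local Notation hz := (@hz R n P).
Implicit Types (x z : tM) (p q : M) (v w : tvec tM) (X Y Z : vfield M)
  (A : Helt P) (xi : M -> Helt P) (f : M -> C).

Let kt := tmet_kahler P.
Let hb := pk_bilin kt.

Lemma scale_fund_inj x (k l : C) : k *: H x = l *: H x -> k = l.
Proof.
move=> e; have tH := fund_tv x; have tHb := fundbar_tv x.
have := congr1 (fun v => G x v (Hb x)) e; rewrite /= !(gZl hb _ tH tHb).
exact: (mulIf (Nf_neq0 x)).
Qed.

(** [hermL] is a choice among values over the whole fibre. From x to b x, l and m are multiplied by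
    b^-1 and N by b conj b, so there is only one value. *)
Lemma hermLE x (l m : C) :
  hermL (pr x) (Hclass x (l *: H x)) (Hclass x (m *: H x)) = l * conjc m * Nf x.
Proof.
apply: xget_subset1; first by exists x, l, m.
have key k : [set k | exists x' (l' s : C), [/\ pr x' = pr x,
    Hclass x (l *: H x) = Hclass x' (l' *: H x'),
    Hclass x (m *: H x) = Hclass x' (s *: H x')
    & k = l' * conjc s * G x' (H x') (conjv (H x'))]] k -> k = l * conjc m * Nf x.
  move=> [x' [l' [m' [e e1 e2 ->]]]]; have [b [b0 xb]] := act_over e.
  have E (t t' : C) : Hclass x (t *: H x) = Hclass x' (t' *: H x') -> t' = b^-1 * t.
    move=> et; have tH := fund_tv x'; apply: (@scale_fund_inj x').
    apply: (@Hclass_inj _ _ P x'); [exact: tvZ|exact: tvZ|].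
    by rewrite -et -(Hclass_move x (t *: H x) b0) tr_fund // -xb.
  rewrite (E _ _ e1) (E _ _ e2) -[G x' _ _]/(Nf x') xb Nf_act // rmorphM /= conjc_inv.
  have : conjc b != 0 by rewrite conjc_eq0.
  by move: (conjc b) (conjc m) (Nf x) => c m0 N c0; field; rewrite b0 c0.
by move=> k1 k2 /key -> /key ->.
Qed.

Section Herm.
Variables (U : set M) (s t : M -> Helt P).
Hypotheses (oU : open U) (ss : secL U s) (st : secL U t).

Lemma hermL_sec x : U (pr x) ->
  hermL (pr x) (s (pr x)) (t (pr x)) = coefL s x * conjc (coefL t x) * Nf x.
Proof.
move=> Ux; have [is_ _] := ss; have [it _] := st.
have [_ e1] := field_of_L (is_ _ Ux); have [_ e2] := field_of_L (it _ Ux).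
by rewrite {1}e1 {1}e2 hermLE.
Qed.

Lemma sn_coef x : U (pr x) -> smooth_near x (coefL t).
Proof. by move=> Ux; apply: sn_coefL; exact: (sec_svf oU st Ux). Qed.

End Herm.

(** Pulled back to the total space, h(s, t) is a product of the two coefficients and N, and N is
    constant along X~. *)
Lemma tv_herm (U : set M) s t X x : open U -> secL U s -> secL U t -> U (pr x) ->
  is_tvec (pr x) (X (pr x)) ->
  X (pr x) (fun q => hermL q (s q) (t q)) =
  (hlift X x (coefL s) * conjc (coefL t x) +
   coefL s x * hlift X x (fun z => conjc (coefL t z))) * Nf x.
Proof.
move=> oU ss st Ux tX; have [hX _] := hliftP tX; have tv := hor_tv hX.
have s1 := sn_coef oU ss Ux; have s2 := snJ (sn_coef oU st Ux).
have N : \forall z \near x, hermL (pr z) (s (pr z)) (t (pr z)) =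
    coefL s z * conjc (coefL t z) * Nf z.
  by apply: filterS (near_U oU Ux) => z Uz; exact: (hermL_sec ss st).
have sh : smooth_near x (fun z => hermL (pr z) (s (pr z)) (t (pr z))).
  apply: (@sn_eq _ _ _ x (fun z => coefL s z * conjc (coefL t z) * Nf z)).
    by apply: filterS N => z ->.
  by apply: snM; [exact: snM|exact: sn_Nf].
have sh' := sn_descend (f := fun q => hermL q (s q) (t q)) sh.
rewrite -(hlift_pr tX sh') (tv_eq tv N).
rewrite (tv_mul tv (snM s1 s2) (sn_Nf x)) (tv_hor_Nf hX) mulr0 addr0.
by rewrite (tv_mul tv s1 s2).
Qed.

(* The holomorphic frame [s, H] of L: on it the (0,1) part of the Chern
   connection vanishes, and compatibility with h determines the (1,0) part. *)
Definition esec (s : M -> tM) : M -> Helt P := fun q => Hclass (s q) (H (s q)).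

Section LocalSection.
Variables (V : set M) (s : M -> tM).
Hypothesis hs : hol_section V s.

Lemma esec_at x : V (pr x) ->
  esec s (pr x) = Hclass x ((ycoord s x)^-1 *: H x).
Proof.
move=> Vx; have [y0 e] := ycoordP hs Vx.
rewrite /esec -[X in Hclass _ X]scale1r.
rewrite -(Hclass_move (s (pr x)) (1 *: H (s (pr x))) y0) tr_fund // mulr1.
by rewrite -e.
Qed.

Lemma coef_esec x : V (pr x) -> field_of (esec s) x = (ycoord s x)^-1 *: H x /\
  coefL (esec s) x = (ycoord s x)^-1.
Proof. by move=> Vx; exact: coefLE (esec_at Vx). Qed.

Lemma svf_esec x : V (pr x) -> svf x (field_of (esec s)).
Proof.
move=> Vx; have [oV _ _] := hs.
apply: (@svf_eq _ _ _ _ (fun z => (ycoord s z)^-1 *: H z)).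
  by apply: filterS (near_U oV Vx) => z Vz; rewrite (proj1 (coef_esec Vz)).
apply: svfZ; last exact: svf_fund.
have [sy _] := ycoord_sn_holo hs Vx.
by apply: snV => //; have [] := ycoordP hs Vx.
Qed.

Lemma secL_esec (W : set M) : open W -> W `<=` V -> secL W (esec s).
Proof.
move=> oW WV; apply: sec_inP => // [p Wp|x Wx]; last exact: svf_esec (WV _ Wx).
have [_ _ ps] := hs; exists (s p), 1; rewrite ps; last exact: WV.
by rewrite /esec scale1r.
Qed.

Lemma coef_esec_bar x v : V (pr x) -> type10 x v ->
  v (fun z => conjc (coefL (esec s) z)) = 0.
Proof.
move=> Vx v10; have tv := type10_tv v10; have [oV _ _] := hs.
have [sy hy] := ycoord_sn_holo hs Vx; have [y0 _] := ycoordP hs Vx.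
have N : \forall z \near x, conjc (coefL (esec s) z) = (conjc (ycoord s z))^-1.
  by apply: filterS (near_U oV Vx) => z Vz; rewrite (proj2 (coef_esec Vz)) conjc_inv.
rewrite (tv_eq tv N) (tv_inv tv) ?conjc_eq0 //; last exact: snJ.
by rewrite hy // oppr0 mul0r.
Qed.

Lemma holo_esec (W : set M) : open W -> W `<=` V ->
  holo_fun (pr @^-1` V) (ycoord s) -> holo_vf (pr @^-1` W) (field_of (esec s)).
Proof.
move=> oW WV hy; have opW := open_pr oW; split.
  apply/(smooth_vf10P _ opW) => x Wx; have Vx := WV _ Wx.
  split; first exact: svf_esec.
  by rewrite (proj1 (coef_esec Vx)); apply: type10Z; exact: fund10.
move=> S f oS SW hf a; have oSa : open (phi a @` (S `&` dom a)) by exact: open_phi.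
have [_ hH] := fund_holo P.
have h1 : holo (@JE R n.+1) (phi a @` (S `&` dom a))
    (fun u => (ycoord s (psi a u))^-1 * H (psi a u) f).
  apply: holoM => //; last by apply: hH.
  apply: holoV => //.
    by move=> u [x [Sx ax] <-]; rewrite phiK //; have [] := ycoordP hs (WV _ (SW _ Sx)).
  apply: holo_sub (hy a) => u [x [Sx ax] <-]; exists x => //; split=> //.
  exact: WV _ (SW _ Sx).
apply: holo_eq h1 => // u [x [Sx ax] <-]; rewrite phiK //.
by rewrite (proj1 (coef_esec (WV _ (SW _ Sx)))).
Qed.

End LocalSection.

(** * Determination of the Chern connection *)

Section Chern.
Variable nL : vfield M -> (M -> Helt P) -> M -> Helt P.
Hypothesis hnL : chern_connection nL.
Let cL := ch_conn hnL.

Lemma nL_in (U : set M) X s : open U -> smooth_vf U X -> secL U s -> secL U (nL X s).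
Proof. by move=> oU uX ss; have [] := cL oU uX uX ss ss (ind_smooth oU). Qed.

Section Esec.
Variables (V W : set M) (s : M -> tM).
Hypotheses (hs : hol_section V s) (hy : holo_fun (pr @^-1` V) (ycoord s)).
Hypotheses (oW : open W) (WV : W `<=` V).
Let e := esec s.
Let se : secL W e := secL_esec hs oW WV.

Lemma coef_e_neq0 x : W (pr x) -> coefL e x != 0.
Proof.
move=> Wx; rewrite (proj2 (coef_esec hs (WV Wx))) invr_neq0 //.
by have [] := ycoordP hs (WV Wx).
Qed.

Lemma nL_e01 X x : smooth_vf W X -> (forall q, W q -> type01 q (X q)) -> W (pr x) ->
  nL X e (pr x) = Hclass x (0 *: H x).
Proof.
move=> uX X01 Wx.
rewrite (ch_holo hnL oW uX X01 se (holo_esec hs oW WV hy) Wx).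
have [ie _] := se; have [_ ->] := field_of_L (ie _ Wx).
by rewrite hscale_cl !scale0r.
Qed.

Lemma nL_e10 X x : smooth_vf W X -> (forall q, W q -> type10 q (X q)) -> W (pr x) ->
  nL X e (pr x) = Hclass x (hlift X x (coefL e) *: H x).
Proof.
move=> uX X10 Wx; have uXb : smooth_vf W (fun q => conjv (X q)).
  by apply/(smooth_vfP _ oW) => q Wq; apply: svfJ; exact: svf_on uX Wq.
have Xb01 q : W q -> type01 q (conjv (X q)) by move=> Wq; apply: type01J; exact: X10.
have := ch_metric hnL oW uX se se Wx; rewrite (nL_e01 uXb Xb01 Wx).
have tX := type10_tv (X10 _ Wx); rewrite (tv_herm oW se se Wx tX).
have [h10 _] := hlift10 (X10 _ Wx).
rewrite (coef_esec_bar hs (WV Wx) h10) mulr0 addr0.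
have sN := nL_in oW uX se; have [iN _] := sN; have [ie _] := se.
have [_ eE] := field_of_L (ie _ Wx); have [_ eN] := field_of_L (iN _ Wx).
rewrite eE eN !hermLE conjc0 mulr0 mul0r addr0 => /(mulIf (Nf_neq0 x)).
have c0 : conjc (coefL e x) != 0 by rewrite conjc_eq0 coef_e_neq0.
by move/(mulIf c0) => ->.
Qed.

(** X is split by type; on the (0,1) part the derivative of the frame coefficient also vanishes,
    because y is holomorphic. *)
Lemma nL_e X x : smooth_vf W X -> W (pr x) ->
  nL X e (pr x) = Hclass x (hlift X x (coefL e) *: H x).
Proof.
move=> uX Wx; pose X1 q := prj10 q (X q); pose X2 q := X q - prj10 q (X q).
have sX q (Wq : W q) := svf_on oW uX Wq.
have u1 : smooth_vf W X1.
  by apply/(smooth_vfP _ oW) => q Wq; apply: svf_prj10; exact: sX.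
have u2 : smooth_vf W X2.
  by apply/(smooth_vfP _ oW) => q Wq; apply: svfB; [|apply: svf_prj10]; exact: sX.
have X10 q : W q -> type10 q (X1 q) by move=> _; exact: type10_prj.
have X01 q : W q -> type01 q (X2 q).
  by move=> Wq; apply: type01_prj; exact: svf_tv (sX q Wq).
have eX : X = (fun q => X1 q + X2 q).
  by apply/funext => q; rewrite /X1 /X2 addrC subrK.
have t1 := type10_tv (X10 _ Wx); have t2 := type01_tv (X01 _ Wx).
rewrite eX hor_sum_hlift //.
have [_ /(_ _ Wx)[-> _ _ _]] := cL oW u1 u2 se se (ind_smooth oW).
rewrite (nL_e10 u1 X10 Wx) (nL_e01 u2 X01 Wx) hadd_cl scale0r addr0.
congr (Hclass x (_ *: H x)); rewrite -[RHS]/(hlift X1 x _ + hlift X2 x _).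
suff -> : hlift X2 x (coefL e) = 0 by rewrite addr0.
have t2b : type10 (pr x) (conjv (X2 (pr x))) by exact: X01.
have [h10 _] := hlift10 (X := fun q => conjv (X2 q)) t2b.
have := coef_esec_bar hs (WV Wx) h10.
by rewrite hliftJ // conjvE => /eqP; rewrite conjc_eq0 => /eqP.
Qed.

End Esec.

Lemma nL_coef (U : set M) X s x : open U -> smooth_vf U X -> secL U s -> U (pr x) ->
  nL X s (pr x) = Hclass x (hlift X x (coefL s) *: H x).
Proof.
move=> oU uX ss Ux; have [V [s0 [hs Vx hy]]] := triv (pr x); have [oV _ _] := hs.
pose W := V `&` U; have oW : open W by exact: openI.
have WV : W `<=` V by move=> q [].
have WU : W `<=` U by move=> q [].
have Wx : W (pr x) by split.
have uXW : smooth_vf W X by apply/(smooth_vfP _ oW) => q /WU; exact: svf_on uX.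
have ssW := sec_sub oU oW WU ss; have se := secL_esec hs oW WV.
have uXb : smooth_vf W (fun q => conjv (X q)).
  by apply/(smooth_vfP _ oW) => q Wq; apply: svfJ; exact: svf_on uXW Wq.
have tX := svf_tv (svf_on oW uXW Wx).
have := ch_metric hnL oW uXW ssW se Wx.
rewrite (nL_e hs hy oW WV uXb Wx) (tv_herm oW ssW se Wx tX).
have [iN _] := nL_in oW uXW ssW; have [ie _] := se; have [is_ _] := ssW.
have [_ eE] := field_of_L (ie _ Wx); have [_ eS] := field_of_L (is_ _ Wx).
have [_ eN] := field_of_L (iN _ Wx).
rewrite eE eS eN !hermLE => h.
have c0 : conjc (coefL (esec s0) x) != 0.
  by rewrite conjc_eq0; exact: (coef_e_neq0 hs WV Wx).
(* Both sides of the compatibility with h contain a derivative of the conjugate frame coefficient;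
   this identity makes the two terms cancel. *)
have eb : conjc (hlift (fun q => conjv (X q)) x (coefL (esec s0))) =
    hlift X x (fun z => conjc (coefL (esec s0) z)).
  by rewrite hliftJ // -conjvE conjvK.
move: h; rewrite eb -mulrDl => /(mulIf (Nf_neq0 x)) /addIr /(mulIf c0) ->.
by [].
Qed.

End Chern.

(** * The tensor product and its isomorphism with hor(H) *)

Section Tensor.
Variable p : M.
Implicit Types (u : tvec M).

Lemma tensE A u (B : Helt P -> tvec M -> C) : bilin_form p B -> tens p A u B = B A u.
Proof. by move=> hB; rewrite /tens asboolT. Qed.

Lemma tens_out A u (B : Helt P -> tvec M -> C) : ~ bilin_form p B -> tens p A u B = 0.
Proof. by move=> hB; rewrite /tens asboolF. Qed.

Lemma tensD A u u' : inL p A -> type10 p u -> type10 p u' ->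
  tens p A (u + u') = tens p A u + tens p A u'.
Proof.
move=> LA u10 u10'; apply/funext => B; rewrite -[RHS]/(tens p A u B + tens p A u' B).
have [hB|hB] := pselect (bilin_form p B); last by rewrite !tens_out ?addr0.
by rewrite !tensE //; have [_ _ -> _] := hB 0 A A u u' LA LA u10 u10'.
Qed.

Lemma tensZ (k : C) A u : inL p A -> type10 p u ->
  tens p A (k *: u) = k *: tens p A u.
Proof.
move=> LA u10; apply/funext => B; rewrite -[RHS]/(k * tens p A u B).
have [hB|hB] := pselect (bilin_form p B); last by rewrite !tens_out ?mulr0.
by rewrite !tensE //; have [_ _ _ ->] := hB k A A u u LA LA u10 u10.
Qed.

Lemma tensZl (k : C) A u : inL p A -> type10 p u ->
  tens p (hscale k A) u = k *: tens p A u.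
Proof.
move=> LA u10; apply/funext => B; rewrite -[RHS]/(k * tens p A u B).
have [hB|hB] := pselect (bilin_form p B); last by rewrite !tens_out ?mulr0.
by rewrite !tensE //; have [_ -> _ _] := hB k A A u u LA LA u10 u10.
Qed.

Lemma tens_sum A (I : Type) (r : seq I) (u : I -> tvec M) : inL p A ->
  (forall i, type10 p (u i)) ->
  tens p A (\sum_(i <- r) u i) = \sum_(i <- r) tens p A (u i).
Proof.
move=> LA u10; elim: r => [|i r IH]; last first.
  by rewrite !big_cons tensD ?IH //; exact: type10_sum.
rewrite !big_nil -[in LHS](scale0r (0 : tvec M)) tensZ ?scale0r //.
exact: type100.
Qed.

End Tensor.

Lemma tens_inj x (u u' : tvec M) : type10 (pr x) u -> type10 (pr x) u' ->
  tens (pr x) (Hclass x (H x)) u = tens (pr x) (Hclass x (H x)) u' -> u = u'.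
Proof.
move=> u10 u10' e; apply/funext => f.
(* The bilinear form (l H(x), w) |-> l (w f) separates the tensors. *)
pose co (A : Helt P) : C := xget 0 [set l | A = Hclass x (l *: H x)].
have coE (l : C) : co (Hclass x (l *: H x)) = l.
  apply: xget_subset1 => // l1 l2 /= e1 e2; apply: (@scale_fund_inj x).
  have tH := fund_tv x; apply: (@Hclass_inj _ _ P x); [exact: tvZ|exact: tvZ|].
  by rewrite -e1 -e2.
pose B (A : Helt P) (w : tvec M) : C := co A * w f.
have hB : bilin_form (pr x) B.
  move=> k A A' w w' /inL_at[l ->] /inL_at[l' ->] w10 w10'.
  rewrite /B hadd_cl hscale_cl -scalerDl scalerA !coE; split.
  - exact: mulrDl.
  - by rewrite mulrA.
  - exact: mulrDr.
  - by rewrite -[(k *: w) f]/(k * w f) mulrCA.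
have := congr1 (fun t => t B) e; rewrite !tensE // /B.
by rewrite -[X in Hclass x X]scale1r coE !mul1r.
Qed.

Lemma inL_fund x : inL (pr x) (Hclass x (H x)).
Proof. by rewrite -[X in Hclass _ X]scale1r; exact: inLP. Qed.

Lemma isoLTE x v : hz x v ->
  isoLT (pr x) (Hclass x v) = tens (pr x) (Hclass x (H x)) (push pr x v).
Proof.
move=> hv; apply: xget_subset1; first by exists x, v; split=> //; exact/horP.
have key t : [set t | exists x' v', [/\ pr x' = pr x, horizontal10 x' v',
    Hclass x v = Hclass x' v' & t = tens (pr x) (Hclass x' (H x')) (push pr x' v')]] t ->
    t = tens (pr x) (Hclass x (H x)) (push pr x v).
  move=> [x' [v' [e /horP[v10' _] ev ->]]]; have [b [b0 xb]] := act_over e.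
  have [v10 _] := hv.
  have -> : v' = tr b x v.
    apply: (@Hclass_inj _ _ P x'); first exact: type10_tv.
      by rewrite xb; apply: tr_tv => //; exact: type10_tv.
    by rewrite -ev xb Hclass_move.
  have p10 := push10 (holo_at_proj x) v10.
  (* This factor b in L compensates the b^-1 by which the horizontal representative is transported,
     so the tensor is independent of the representative. *)
  have eH : Hclass x' (H x') = hscale b (Hclass x (H x)).
    rewrite hscale_cl -(Hclass_move x (b *: H x) b0) tr_fund // mulVf // scale1r.
    by rewrite xb.
  rewrite eH /tr pushZ xb push_pr_act //.
  rewrite tensZ //; last by rewrite hscale_cl; exact: inLP.
  by rewrite tensZl ?scalerA ?mulVf ?scale1r //; exact: inL_fund.
by move=> t1 t2 /key -> /key ->.
Qed.

Lemma isoLT_inj p A A' : inhor p A -> inhor p A' -> isoLT p A = isoLT p A' -> A = A'.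
Proof.
have [x <-] := pr_surj p.
move=> /inhor_at[v [hv ->]] /inhor_at[w [hw ->]]; rewrite !isoLTE //.
have [v10 _] := hv; have [w10 _] := hw.
move/(tens_inj (push10 (holo_at_proj x) v10) (push10 (holo_at_proj x) w10)).
by move/(hz_inj hv hw) => ->.
Qed.

Lemma isoLT_invE p A t : inhor p A -> isoLT p A = t -> isoLT_inv p t = A.
Proof.
move=> hA e; have : [set A | inhor p A /\ isoLT p A = t] (isoLT_inv p t).
  by apply: xgetPex; exists A.
by move=> [h' e']; apply: (isoLT_inj h' hA); rewrite e e'.
Qed.

Lemma isoLT_add p A A' : inhor p A -> inhor p A' ->
  inhor p (hadd A A') /\ isoLT p (hadd A A') = isoLT p A + isoLT p A'.
Proof.
have [x <-] := pr_surj p.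
move=> /inhor_at[v [hv ->]] /inhor_at[w [hw ->]]; rewrite hadd_cl.
have hvw := hzD hv hw; split; first exact: inhorP.
have [v10 _] := hv; have [w10 _] := hw.
rewrite !isoLTE // pushD tensD //; first exact: inL_fund.
  exact: push10 (holo_at_proj x) v10.
exact: push10 (holo_at_proj x) w10.
Qed.

Lemma isoLT_scale p (k : C) A : inhor p A ->
  inhor p (hscale k A) /\ isoLT p (hscale k A) = k *: isoLT p A.
Proof.
have [x <-] := pr_surj p.
move=> /inhor_at[v [hv ->]]; rewrite hscale_cl.
have hkv := hzZ k hv; split; first exact: inhorP.
have [v10 _] := hv.
rewrite !isoLTE // pushZ tensZ //; first exact: inL_fund.
exact: push10 (holo_at_proj x) v10.
Qed.

Lemma secLT_of_sechor (U : set M) xi : open U -> sechor U xi ->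
  secLT U (fun q => isoLT q (xi q)).
Proof.
move=> oU sxi p Up; have [V [s [hs Vp _]]] := triv p; have [oV _ ps] := hs.
have oW : open (V `&` U) by exact: openI.
(* Where s is defined, a single tensor is enough because [esec s] is a frame of the line bundle. *)
exists (V `&` U), 1%N, (fun=> esec s), (fun=> Yloc xi s); split=> //.
- move=> _; split; first by apply: (secL_esec hs) => // q [].
  by apply/(smooth_vf10P _ oW) => q [Vq Uq]; split;
    [exact: (svf_Yloc oU sxi hs Uq Vq)|exact: (Yloc10 sxi hs Uq Vq)].
- move=> q [Vq Uq]; rewrite big_ord1; have [ix _] := sxi.
  have pq := ps _ Vq; have U' : U (pr (s q)) by rewrite pq.
  have [hF eF] := field_of_hor (ix _ U').
  by move: (isoLTE hF); rewrite -eF pq.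
Qed.

Section FromTensor.
Variables (U : set M) (t : M -> LTelt P).
Hypotheses (oU : open U) (st : secLT U t).
Let xi q := isoLT_inv q (t q).

(** L has rank one: writing every section of L as a multiple of [esec s] merges the finite sum of
    tensors into one. *)
Lemma secLT_local p : U p -> exists W V s Y,
  [/\ hol_section V s, open W, W p, W `<=` V &
      W `<=` U /\ forall q, W q ->
        [/\ t q = tens q (esec s q) (Y q), svf q Y & type10 q (Y q)]].
Proof.
move=> Up; have [V1 [k [sk [Yk [oV1 V1p V1U sY eT]]]]] := st Up.
have [V [s [hs Vp _]]] := triv p; have [oV _ ps] := hs.
have oW : open (V `&` V1) by exact: openI.
pose c i q := coefL (sk i) (s q).
exists (V `&` V1), V, s, (fun q => \sum_i c i q *: Yk i q); split=> //.
split; first by move=> q [_ /V1U].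
move=> q [Vq V1q]; have pq := ps _ Vq.
have V1' : V1 (pr (s q)) by rewrite pq.
have Y10 i : svf q (Yk i) /\ type10 q (Yk i q).
  by have [_ /(smooth_vf10P _ oV1) h] := sY i; exact: h.
have cY10 i : type10 q (c i q *: Yk i q) by apply: type10Z; have [] := Y10 i.
have Le : inL q (esec s q).
  by have [ie _] := secL_esec hs oV (fun=> id); exact: ie.
split.
- rewrite (eT q V1q) tens_sum //; apply: eq_bigr => i _.
  have [Yi10 _] := Y10 i; rewrite tensZ //; last by have [] := Y10 i.
  rewrite -tensZl //; last by have [] := Y10 i.
  congr (tens q _ _); have [[iL _] _] := sY i.
  have [_ e1] := field_of_L (iL _ V1'); rewrite pq in e1.
  by rewrite e1 /esec hscale_cl.
- apply: svf_sum => i _; apply: svfZ; last by have [] := Y10 i.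
  have [sL _] := sY i; apply: (sn_holo_at (hol_section_at hs Vq) (f := coefL (sk i))).
  by apply: sn_coefL; exact: (sec_svf oV1 sL V1').
- exact: type10_sum.
Qed.

(** [isoLT_inv] is a pointwise choice. For t of the local form [esec s] (x) Y its value has the
    field y^-1 Y~, which is visibly smooth. *)
Lemma sechor_of_secLT : sechor U xi /\ forall q, U q -> isoLT q (xi q) = t q.
Proof.
have key p : U p -> exists W V s Y, [/\ hol_section V s, open W, W p, W `<=` V &
    (forall q, W q -> svf q Y) /\ forall x, W (pr x) ->
     [/\ hz x ((ycoord s x)^-1 *: hlift Y x),
         xi (pr x) = Hclass x ((ycoord s x)^-1 *: hlift Y x) &
         isoLT (pr x) (xi (pr x)) = t (pr x)]].
  move=> Up; have [W [V [s [Y [hs oW Wp WV [WU hW]]]]]] := secLT_local Up.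
  exists W, V, s, Y; split=> //; split; first by move=> q /hW[].
  move=> x Wx; have [eT sY Y10] := hW _ Wx.
  have hx : hz x ((ycoord s x)^-1 *: hlift Y x) by apply: hzZ; exact: hlift10.
  have e : isoLT (pr x) (Hclass x ((ycoord s x)^-1 *: hlift Y x)) = t (pr x).
    rewrite isoLTE // eT (esec_at hs (WV _ Wx)) pushZ.
    have [_ ->] := hliftP (type10_tv Y10).
    have LH := inL_fund x.
    by rewrite (tensZ _ LH Y10) -(tensZl _ LH Y10) hscale_cl.
  have e2 : xi (pr x) = Hclass x ((ycoord s x)^-1 *: hlift Y x).
    by apply: isoLT_invE => //; exact: inhorP.
  by split=> //; rewrite e2.
split; last first.
  move=> q Uq; have [W [V [s [Y [hs oW Wq WV [_ hW]]]]]] := key q Uq.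
  by have [x px] := pr_surj q; rewrite -px in Wq *; have [] := hW _ Wq.
apply: sec_inP => // [p Up|x Ux].
  have [W [V [s [Y [hs oW Wp WV [_ hW]]]]]] := key p Up.
  have [x px] := pr_surj p; rewrite -px in Wp *; have [h -> _] := hW _ Wp.
  exact: inhorP.
have [W [V [s [Y [hs oW Wx WV [sY hW]]]]]] := key _ Ux.
apply: (@svf_eq _ _ _ _ (fun z => (ycoord s z)^-1 *: hlift Y z)).
  apply: filterS (near_U oW Wx) => z Wz; have [[h10 _] e _] := hW _ Wz.
  by rewrite (field_ofE _ e) //; exact: type10_tv.
apply: svfZ; last by apply: svf_hlift; exact: sY.
have [sy _] := ycoord_sn_holo hs (WV _ Wx).
by apply: snV => //; have [] := ycoordP hs (WV _ Wx).
Qed.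

End FromTensor.

End LineBundle.

(** * The transported connection is the tensor product connection *)

Section TensorConnection.
Variables (R : realType) (n : nat) (P : proj_kahler R n).
Local Notation C := R[i].
Local Notation tM := (tot P).
Local Notation M := (base P).
Local Notation pr := (@Defs.proj R n P).
Local Notation tD := (@tD R n P).
Local Notation hz := (@hz R n P).
Implicit Types (x z : tM) (p q : M) (X Y : vfield M) (xi : M -> Helt P)
  (t : M -> LTelt P).

Let lt := tD_lc P.
Let cD := lc_conn lt.

Variable g : tensor2 M.
Hypothesis hg : induced_metric g.
Variable D : vfield M -> vfield M -> vfield M.
Hypothesis hD : levi_civita g D.

Lemma sechor_eq (U : set M) xi xi' : open U -> sechor U xi ->
  (forall q, U q -> xi' q = xi q) -> sechor U xi'.
Proof.
move=> oU sxi e; have [ix _] := sxi.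
apply: sec_inP => // [p Up|x Ux]; first by rewrite e //; exact: ix.
apply: svf_eq (sec_svf oU sxi Ux); apply: filterS (near_U oU Ux) => z Uz.
by rewrite /field_of e.
Qed.

(** Transport of [hatD_connection] by a fibrewise linear isomorphism. The linearity of [isoLT_inv]
    is known on U only, hence the appeals to [hatD_local]. *)
Lemma hatD_LT_connection :
  is_connection (fun t t' : LTelt P => t + t')
    (fun (k : C) (t : LTelt P) => k *: t) (@secLT R n P) (@hatD_LT R n P).
Proof.
move=> U X X' t t' f oU uX uX' st st' uf.
have [] := sechor_of_secLT oU st; set xi := fun q => isoLT_inv q (t q) => sxi et.
have [] := sechor_of_secLT oU st'; set xi' := fun q => isoLT_inv q (t' q) => sxi' et'.
have [sh eD] := hatD_connection hg hD oU uX uX' sxi sxi' uf.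
split; first exact: (secLT_of_sechor oU sh).
move=> p Up; have [e1 e2 e3 e4] := eD p Up.
have [i1 _] := sh; have [i2 _] := sechor_hatD hg hD oU uX' sxi.
have [i3 _] := sechor_hatD hg hD oU uX sxi'.
have [j _] := sxi; have [j' _] := sxi'.
have i1p := i1 _ Up; have i2p := i2 _ Up; have i3p := i3 _ Up; have jp := j _ Up.
split.
- rewrite /hatD_LT -/xi e1; exact: (proj2 (isoLT_add i1p i2p)).
- rewrite /hatD_LT -/xi e2; exact: (proj2 (isoLT_scale _ i1p)).
- have eA q : U q -> isoLT_inv q (t q + t' q) = hadd (xi q) (xi' q).
    move=> Uq; have [h e] := isoLT_add (j _ Uq) (j' _ Uq).
    by apply: isoLT_invE => //; rewrite e et // et'.
  have [sa _] := sechor_add oU sxi sxi'; have sA := sechor_eq oU sa eA.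
  rewrite /hatD_LT (hatD_local hg hD oU uX sA sa Up eA) e3.
  exact: (proj2 (isoLT_add i1p i3p)).
have eA q : U q -> isoLT_inv q (f q *: t q) = hscale (f q) (xi q).
  move=> Uq; have [h e] := isoLT_scale (f q) (j _ Uq).
  by apply: isoLT_invE => //; rewrite e et.
have [sa _] := sechor_scale oU uf sxi; have sA := sechor_eq oU sa eA.
rewrite /hatD_LT (hatD_local hg hD oU uX sA sa Up eA) e4.
have [h1 l1] := isoLT_scale (X p f) jp; have [h2 l2] := isoLT_scale (f p) i1p.
have [_ ->] := isoLT_add h1 h2.
by rewrite l1 l2 et.
Qed.

Variable nL : vfield M -> (M -> Helt P) -> M -> Helt P.
Hypothesis hnL : chern_connection nL.

Section TensorSection.
Variables (U : set M) (X Y : vfield M) (s : M -> Helt P).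
Hypotheses (oU : open U) (uX : smooth_vf U X) (ss : secL U s) (uY : smooth_vf10 U Y).
Let xi q := isoLT_inv q (tens q (s q) (Y q)).
Let F := field_of xi.

Lemma Y_at p : U p -> svf p Y /\ type10 p (Y p).
Proof. by move: uY => /(smooth_vf10P _ oU); exact. Qed.

Lemma xi_at z : U (pr z) ->
  hz z (coefL s z *: hlift Y z) /\ xi (pr z) = Hclass z (coefL s z *: hlift Y z).
Proof.
move=> Uz; have [sY Y10] := Y_at Uz; have [is_ _] := ss.
have [_ es] := field_of_L (is_ _ Uz); have LH := inL_fund z.
have hz' : hz z (coefL s z *: hlift Y z) by apply: hzZ; exact: hlift10.
split=> //; apply: isoLT_invE; first exact: inhorP.
rewrite isoLTE // pushZ; have [_ ->] := hliftP (type10_tv Y10).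
by rewrite (tensZ _ LH Y10) -(tensZl _ LH Y10) hscale_cl -es.
Qed.

Lemma F_at z : U (pr z) -> F z = coefL s z *: hlift Y z.
Proof.
by move=> Uz; have [[h10 _] e] := xi_at Uz; apply: (field_ofE (type10_tv h10) e).
Qed.

Lemma sn_s z : U (pr z) -> smooth_near z (coefL s).
Proof. by move=> Uz; apply: sn_coefL; exact: (sec_svf oU ss Uz). Qed.

Lemma sechor_tens : sechor U xi.
Proof.
apply: sec_inP => // [p Up|x Ux].
  have [x px] := pr_surj p; rewrite -px in Up *; have [h ->] := xi_at Up.
  exact: inhorP.
apply: (@svf_eq _ _ _ _ (fun z => coefL s z *: hlift Y z)).
  by apply: filterS (near_U oU Ux) => z Uz; rewrite -F_at.
apply: svfZ; first exact: sn_s.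
by apply: svf_hlift; have [] := Y_at Ux.
Qed.

Lemma hatD_LT_tens p : U p ->
  hatD_LT X (fun q => tens q (s q) (Y q)) p =
  tens p (nL X s p) (Y p) + tens p (s p) (D X Y p).
Proof.
move=> Up; have [x px] := pr_surj p; rewrite -px in Up *.
have sX := svf_on oU uX Up; have [sY Y10] := Y_at Up.
have tY : tf10 (pr x) Y.
  by apply: filterS (open_nbhs_nbhs (conj oU Up)) => q Uq; have [] := Y_at Uq.
have D10 := D_M10 hg hD sX sY tY.
have lX := svf_hlift sX; have lY := svf_hlift sY; have sc := sn_s Up.
have hY := hlift10 Y10; have hDY := hlift10 D10.
have eW : tD (hlift X) F x =
    hlift X x (coefL s) *: hlift Y x + coefL s x *: tD (hlift X) (hlift Y) x.
  rewrite -(proj2 (cnZ cD sc lX lY)); apply: (cn_eq cD lX).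
  - exact: (svf_F oU sechor_tens Up).
  - exact: filterS filterT.
  - by apply: filterS (near_U oU Up) => z Uz; exact: F_at.
have eh : hpart x (tD (hlift X) F x) =
    hlift X x (coefL s) *: hlift Y x + coefL s x *: hlift (D X Y) x.
  have t1 := svf_tv lY; have t2 := cn_tv cD lX lY.
  rewrite eW hpartD; [|exact: tvZ|exact: tvZ].
  by rewrite !hpartZ // (hpart_id hY) (hpart_D_lift hg hD sX sY tY).
have [is_ _] := ss; have [_ es] := field_of_L (is_ _ Up); have LH := inL_fund x.
rewrite /hatD_LT -/xi (hatD_at hg hD oU uX sechor_tens Up) -/F eh.
rewrite isoLTE; last by apply: hzD; exact: hzZ.
rewrite (nL_coef hnL oU uX ss Up) [in RHS]es pushD !pushZ.
have [_ ->] := hliftP (type10_tv Y10); have [_ ->] := hliftP (type10_tv D10).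
rewrite -!hscale_cl (tensZl _ LH Y10) (tensZl _ LH D10).
by rewrite (tensD LH (type10Z _ Y10) (type10Z _ D10)) (tensZ _ LH Y10) (tensZ _ LH D10).
Qed.

End TensorSection.

End TensorConnection.

Theorem mainTheorem2 (R : realType) (n : nat) (P : proj_kahler R n)
    (g : tensor2 (base P)) (hg : induced_metric g)
    (D : vfield (base P) -> vfield (base P) -> vfield (base P))
    (hD : levi_civita g D)
    (nL : vfield (base P) -> (base P -> Helt P) -> base P -> Helt P)
    (hnL : chern_connection nL) :
  (forall (U : set (base P)) (X : vfield (base P)) (xi : base P -> Helt P),
     open U -> smooth_vf U X -> sechor U xi -> secH U (calD X xi)) /\
  is_connection (@hadd R n P) (@hscale R n P) (@sechor R n P) (@hatD R n P) /\
  tensor_connection nL D (@hatD_LT R n P).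
Proof.
split; first by move=> U X xi oU uX sxi; exact: (secH_calD hg hD oU uX sxi).
split; first exact: (hatD_connection hg hD).
split; first exact: (hatD_LT_connection hg hD).
by move=> U X s Y p oU uX ss uY Up; exact: (hatD_LT_tens hg hD hnL oU uX ss uY Up).
Qed.
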